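(* Let $k$ be a finite field of characteristic $p$ and $\ell\neq p$ a prime. Every irreducible $\mathbb F_\ell^{ac}$-representation $\sigma$ of $GL_2(k)$ is the reduction modulo $\ell$ of a $\mathbb Q_\ell^{ac}$-representation $\tilde\sigma$ of $GL_2(k)$ such that $\tilde\sigma|_{SL_2(k)}$ and $\sigma|_{SL_2(k)}$ have the same length. Every irreducible $\mathbb F_\ell^{ac}$-representation of $SL_2(k)$ is the reduction modulo $\ell$ of a $\mathbb Q_\ell^{ac}$-representation of $SL_2(k)$.
   Context: Representations of the finite groups are finite-dimensional; every $\mathbb Q_\ell^{ac}$-representation of a finite group preserves a lattice over the integers of $\mathbb Q_\ell^{ac}$, and its reduction modulo $\ell$ is the semisimplification of the reduction of such a lattice (independent of the lattice). *)

(* Defs.v *)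
From HB Require Import structures.
From mathcomp Require Import all_boot all_order all_algebra all_fingroup all_solvable all_field all_character.
Set Implicit Arguments. Unset Strict Implicit. Unset Printing Implicit Defensive.
Import GRing.Theory.
Local Open Scope ring_scope.

Definition GL2 (k : finFieldType) : {group {'GL_2[k]}} := [group of [set: {'GL_2[k]}]].

Definition SL2_set (k : finFieldType) : {set {'GL_2[k]}} :=
  [set g : {'GL_2[k]} | \det (GLval g) == 1].

Lemma SL2_group_set (k : finFieldType) : group_set (SL2_set k).
Proof.
apply/group_setP; split; first by rewrite inE GL_1E det1.
move=> x y; rewrite !inE GL_MxE det_mulmx => /eqP -> /eqP ->.
by rewrite mulr1.
Qed.

Canonical SL2 (k : finFieldType) : {group {'GL_2[k]}} := Group (SL2_group_set k).

Lemma SL2_sub_GL2 (k : finFieldType) : SL2 k \subset GL2 k.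
Proof. by apply/subsetP => x _; rewrite inE. Qed.

(* O is a valuation ring of the field K and red : K -> F restricts on O to a
   surjective ring morphism onto F whose kernel is the maximal ideal of O.
   (Values of red outside O are irrelevant.) *)
Definition residue_data (K F : fieldType) (O : {pred K}) (red : K -> F) : Prop :=
  [/\ 0 \in O, 1 \in O,
      (forall x y, x \in O -> y \in O -> x - y \in O),
      (forall x y, x \in O -> y \in O -> x * y \in O) &
      (forall x : K, x \in O \/ x^-1 \in O) ]
  /\
  [/\ red 1 = 1,
      (forall x y, x \in O -> y \in O -> red (x + y) = red x + red y),
      (forall x y, x \in O -> y \in O -> red (x * y) = red x * red y),
      (forall x, x \in O -> (red x = 0 <-> (x = 0 \/ x^-1 \notin O))) &
      (forall z : F, exists2 x, x \in O & red x = z) ].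

Definition full_comp_series (F : fieldType) (gT : finGroupType) (G : {group gT})
    n (rG : mx_representation F G n) (U : seq 'M[F]_n) : Prop :=
  mx_composition_series rG U /\ (last 0 U == 1%:M)%MS.

Definition mx_length (F : fieldType) (gT : finGroupType) (G : {group gT})
    n (rG : mx_representation F G n) (len : nat) : Prop :=
  exists U : seq 'M[F]_n, full_comp_series rG U /\ size U = len.

(* r1 and r2 have the same composition factors with multiplicities,
   i.e. isomorphic semisimplifications *)
Definition same_ss (F : fieldType) (gT : finGroupType) (G : {group gT})
    n m (r1 : mx_representation F G n) (r2 : mx_representation F G m) : Prop :=
  exists (U : seq 'M[F]_n) (V : seq 'M[F]_m)
         (cU : mx_composition_series r1 U) (cV : mx_composition_series r2 V),
    [/\ (last 0 U == 1%:M)%MS, (last 0 V == 1%:M)%MS, size U = size V &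
        exists s : 'S_(size U), forall i : 'I_(size U),
          mx_rsim (series_repr i cU) (series_repr (s i) cV)].

(* sigma is the reduction modulo the maximal ideal of O of st: there is an
   O-lattice (given by the rows of an invertible P) stable under st, and the
   semisimplification of the reduction of this lattice is that of sigma *)
Definition is_reduction (K F : fieldType) (O : {pred K}) (red : K -> F)
    (gT : finGroupType) (G : {group gT}) n (st : mx_representation K G n)
    m (sigma : mx_representation F G m) : Prop :=
  exists P : 'M[K]_n, P \in unitmx /\
   (forall g, g \in G -> forall i j, (P *m st g *m invmx P) i j \in O) /\
   exists rb : mx_representation F G n,
     (forall g, g \in G -> rb g = map_mx red (P *m st g *m invmx P)) /\
     same_ss rb sigma.

(* Main.v *)
(* The representations of GL2(k) are handled through the presentation of GL2(k) by
   the unipotent matrices U b, the diagonal matrices D a d and the Weyl element W, and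
   what is lifted to K are explicit matrices for U, D, W.

   If sigma has a nonzero U-fixed vector, it has a Borel eigenvector, hence is a quotient
   of a principal series: either a character of the determinant, or a Steinberg
   representation, or the whole principal series. It lifts with its inducing characters.

   If sigma has no U-fixed vector, Gelfand's commutativity argument shows that it has a
   Kirillov model on the functions on k^*, in which W acts by a Bessel kernel J(xy). The
   traces T(s,n) of sigma on the nonscalar elements of trace s and determinant n are the
   Fourier coefficients of J. A class sum acts by a scalar, so T satisfies a
   d'Alembert functional equation on the quadratic extension L of k; therefore T comes
   from a character theta of L^*, and J(u) = -(1/q) sum_(N t = u) psi(Tr t) theta(t).
   A lift of theta that does not factor through the norm gives a model over K.

   By Clifford theory sigma restricted to SL2(k) has length 1 or 2. When it is reducible,
   chi1/chi2, resp. theta^(q-1), takes the value -1 at a generator; keeping this relation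
   in the lift provides a nonscalar operator commuting with SL2(k) over K, while an
   invariant K-subspace always reduces to an invariant F-subspace of the same dimension.
   Finally an irreducible tau of SL2(k) occurs in some such sigma, and is the reduction
   of a constituent of the restricted lift of sigma, up to conjugation by GL2(k). *)
Require Import Defs.
From HB Require Import structures.
From mathcomp Require Import all_boot all_order all_algebra all_fingroup all_solvable all_field all_character.
From mathcomp Require Import ring zify.
From Stdlib Require Import Classical_Prop.
Set Implicit Arguments. Unset Strict Implicit. Unset Printing Implicit Defensive.
Import GRing.Theory.
Local Open Scope ring_scope.

(** * Quadratic extensions of finite fields *)

(** Reduction can only break representations up, so equal lengths on [SL2] come down to one
    implication: a reducible restriction of [sigma] must be matched by a reducible restriction of
    the lift. The obstacle is that the characteristic of [F] may divide [q + 1]. Then a cuspidal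
    [sigma] can have a parameter [theta] that does factor through the norm; what stays true over [F]
    is that [theta] sums to 0 over every norm fibre. Over [K] this vanishing requires honest
    nontriviality on the norm one group. So the restriction of [theta] to that group is lifted
    first, to a [(q + 1)]-th root of unity other than 1, which exists above 1 exactly when [q + 1]
    vanishes in [F]. Traces recover the kernel [J] by Fourier inversion on [k], which needs only [q]
    invertible, so they can be used over [F] as well. All lifted character values are roots of
    unity, hence integral, and lifting them amounts to factoring polynomials over the closed field
    [K]. *)

Lemma sum_card_fibers (A B : finType) (f : A -> B) :
  (\sum_b #|[pred a | f a == b]| = #|A|)%N.
Proof.
rewrite -sum1_card (partition_big f xpredT) //=.
by apply: eq_bigr => b _; rewrite -sum1_card.
Qed.

Lemma sum_nat_eq_le (I : finType) (P : pred I) (f g : I -> nat) :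
  (forall i, P i -> (f i <= g i)%N) ->
  (\sum_(i | P i) f i = \sum_(i | P i) g i)%N -> forall i, P i -> f i = g i.
Proof.
move=> le E i Pi; apply/eqP; rewrite eqn_leq le //=.
move/eqP: E; apply: contraLR; rewrite -ltnNge => lt; rewrite neq_ltn.
apply/orP; left; rewrite (bigD1 i) //= [X in (_ < X)%N](bigD1 i) //=.
by rewrite -addSn leq_add //; apply: leq_sum => j /andP [/le].
Qed.

(** The map sending [(x, y)] to [(x + y, x * y)] identifies [(0, 1)] and [(1, 0)], so on the finite
    set [k * k] it is not onto. A missed pair gives a monic quadratic without roots, and adjoining a
    root yields [L]. *)
Lemma quadratic_extension (k : finFieldType) :
  exists (L : finFieldType) (iota : {rmorphism k -> L}), #|L| = (#|k| ^ 2)%N.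
Proof.
pose g (x : k * k) := (x.1 + x.2, x.1 * x.2).
case: (pickP [pred y | y \notin codom g]) => [[s n] /= nimg | surj]; last first.
  have ginj : uniq (codom g).
    apply/card_uniqP; rewrite size_codom; apply: eq_card => y.
    by have /negbFE := surj y.
  have /injectiveP inj_g : injectiveb g by [].
  have /inj_g/eqP : g (0, 1) = g (1, 0) by rewrite /g /= addrC mulrC.
  by rewrite xpair_eqE eq_sym oner_eq0.
pose p : {poly k} := 'X^2 - s *: 'X + n%:P.
have sp : size p = 3.
  rewrite /p -addrA size_polyDl size_polyXn //.
  rewrite (leq_ltn_trans (size_polyD _ _)) // gtn_max size_polyN.
  rewrite (leq_ltn_trans (size_scale_leq _ _)) ?size_polyX //=.
  by rewrite (leq_ltn_trans (size_polyC_leq1 _)).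
have irr : irreducible_poly p.
  apply: cubic_irreducible; first by rewrite sp.
  move=> x; apply/negP => /eqP; rewrite !hornerE => rx.
  move/negP: nimg; apply; apply/codomP; exists (x, s - x); rewrite /g /=.
  congr (_, _); first by rewrite addrC subrK.
  by apply/eqP; rewrite eq_sym -subr_eq0 -[X in _ == X]oppr0 -rx; apply/eqP; ring.
have [L dimL _] := irredp_FAdjoin irr.
exists (FinFieldExtType L), (in_alg L).
have := @card_vspace k (finvect_type L) (Vector.class (finvect_type L)) fullv.
rewrite [\dim _]dimL sp => <-; symmetry; apply: eq_card => v.
exact: (@memvf _ (finvect_type L)).
Qed.

Lemma finField_generator (k : finFieldType) :
  exists2 g : k, g != 0 & forall x, x != 0 -> exists i, x = g ^+ i.
Proof.
have /cyclicP [u Eu] := field_unit_group_cyclic [group of [set: {unit k}]].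
exists (val u); first by rewrite -unitfE (valP u).
move=> x; rewrite -unitfE => ux.
have : FinRing.Unit ux \in <[u]>%g by rewrite -Eu inE.
case/cycleP => i Ei; exists i.
have -> : x = val (FinRing.Unit ux) by [].
by rewrite Ei FinRing.val_unitX.
Qed.

Section QuadExt.
Variables (k L : finFieldType) (iota : {rmorphism k -> L}).
Hypothesis cardL : #|L| = (#|k| ^ 2)%N.
Let q := #|k|.

Lemma card_k_gt1 : (1 < q)%N. Proof. exact: finNzRing_gt1. Qed.

Definition fconj (t : L) : L := t ^+ q.

Lemma fconjV t : fconj t^-1 = (fconj t)^-1.
Proof. exact: exprVn. Qed.

Lemma fconjM t u : fconj (t * u) = fconj t * fconj u.
Proof. by rewrite /fconj exprMn. Qed.

Lemma pchar_nat_q (R : nzRingType) (f : {rmorphism k -> R}) : [pchar R].-nat q.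
Proof.
have [p p_pr pk] := finPcharP k.
have pR : p \in [pchar R] by apply: (rmorph_pchar f).
rewrite (eq_pnat _ (pcharf_eq pR)).
by have := pprimeChar_pgroup pk; rewrite /pgroup cardsT.
Qed.

Lemma fconjD t u : fconj (t + u) = fconj t + fconj u.
Proof. by rewrite /fconj exprDn_pchar // (pchar_nat_q iota). Qed.

Lemma fconjN t : fconj (- t) = - fconj t.
Proof.
apply/eqP; rewrite -addr_eq0 -fconjD addNr /fconj expr0n.
by case: q card_k_gt1.
Qed.

Lemma fconjB t u : fconj (t - u) = fconj t - fconj u.
Proof. by rewrite fconjD fconjN. Qed.

Lemma fconjK : involutive fconj.
Proof. by move=> t; rewrite /fconj -exprM mulnn -cardL expf_card. Qed.

Lemma fconj_iota a : fconj (iota a) = iota a.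
Proof. by rewrite /fconj -rmorphXn expf_card. Qed.

(** The polynomial ['X^q - 'X] has at most [q] roots in [L], and the image of [iota] already
    supplies [q] of them. *)
Lemma fconj_fix t : fconj t = t -> {a | t = iota a}.
Proof.
move=> ft; case: (pickP (fun a => t == iota a)) => [a /eqP -> | no]; first by exists a.
exfalso; pose p : {poly L} := 'X^q - 'X.
have sp : size p = q.+1.
  by rewrite size_polyDl size_polyXn // size_polyN size_polyX ltnS card_k_gt1.
have p0 : p != 0 by rewrite -size_poly_eq0 sp.
pose rs := t :: [seq iota a | a <- enum k].
have rrs : all (root p) rs.
  apply/allP => u; rewrite inE /root !hornerE subr_eq0 -/(fconj u).
  by case/predU1P => [->|/mapP [a _ ->]]; rewrite ?ft ?fconj_iota eqxx.
have urs : uniq rs.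
  rewrite /= map_inj_uniq ?enum_uniq; last exact: fmorph_inj.
  by rewrite andbT; apply/mapP => -[a _ E]; have := no a; rewrite E eqxx.
by have := max_poly_roots p0 rrs urs; rewrite sp /= size_map -cardE ltnn.
Qed.

(** Returns 0 off the image of [iota]; it is applied to conjugation-invariant elements, where
    [iota_invK] makes it a true inverse. *)
Definition iota_inv (t : L) : k := odflt 0 [pick a | iota a == t].

Lemma iota_invK t : fconj t = t -> iota (iota_inv t) = t.
Proof.
case/fconj_fix => a ->; rewrite /iota_inv; case: pickP => [b /eqP //|/(_ a)].
by rewrite eqxx.
Qed.

Definition Nm t := iota_inv (t * fconj t).
Definition Tr t := iota_inv (t + fconj t).

Lemma NmE t : iota (Nm t) = t * fconj t.
Proof. by rewrite iota_invK // fconjM fconjK mulrC. Qed.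

Lemma TrE t : iota (Tr t) = t + fconj t.
Proof. by rewrite iota_invK // fconjD fconjK addrC. Qed.

Let iinj : injective iota := fmorph_inj iota.

Lemma NmM t u : Nm (t * u) = Nm t * Nm u.
Proof. by apply: iinj; rewrite rmorphM !NmE fconjM; ring. Qed.

Lemma Nm_iota a : Nm (iota a) = a ^+ 2.
Proof. by apply: iinj; rewrite rmorphXn !NmE fconj_iota. Qed.

Lemma Tr_iota a : Tr (iota a) = a + a.
Proof. by apply: iinj; rewrite rmorphD !TrE fconj_iota. Qed.

Lemma TrD t u : Tr (t + u) = Tr t + Tr u.
Proof. by apply: iinj; rewrite rmorphD !TrE fconjD; ring. Qed.

Lemma TrZ a t : Tr (iota a * t) = a * Tr t.
Proof. by apply: iinj; rewrite rmorphM !TrE fconjM fconj_iota; ring. Qed.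

Lemma TrN t : Tr (- t) = - Tr t.
Proof. by apply: iinj; rewrite rmorphN !TrE fconjN; ring. Qed.

Lemma Nm_conj t : Nm (fconj t) = Nm t.
Proof. by apply: iinj; rewrite !NmE fconjK mulrC. Qed.

Lemma Tr_conj t : Tr (fconj t) = Tr t.
Proof. by apply: iinj; rewrite !TrE fconjK addrC. Qed.

Lemma fconj_eq0 t : (fconj t == 0) = (t == 0).
Proof. by rewrite /fconj expf_eq0; case: q card_k_gt1. Qed.

Lemma Nm_eq0 t : (Nm t == 0) = (t == 0).
Proof. by rewrite -(fmorph_eq0 iota) NmE mulf_eq0 fconj_eq0 orbb. Qed.

Lemma NmD t u : Nm (t + u) = Nm t + Tr (t * fconj u) + Nm u.
Proof.
by apply: iinj; rewrite !rmorphD /= !NmE TrE fconjD fconjM fconjK; ring.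
Qed.

Lemma NmN t : Nm (- t) = Nm t.
Proof. by apply: iinj; rewrite !NmE fconjN; ring. Qed.

Lemma same_charpoly t u : Tr u = Tr t -> Nm u = Nm t -> u = t \/ u = fconj t.
Proof.
move=> /(congr1 iota) + /(congr1 iota); rewrite !TrE !NmE => Et En.
have : (u - t) * (u - fconj t) == 0.
  have -> : (u - t) * (u - fconj t) = u * (u - (t + fconj t)) + t * fconj t by ring.
  by rewrite -Et -En; apply/eqP; ring.
by rewrite mulf_eq0 !subr_eq0 => /orP [] /eqP; [left | right].
Qed.

Lemma NmV t : Nm t^-1 = (Nm t)^-1.
Proof. by apply: iinj; rewrite fmorphV !NmE /fconj exprVn invfM. Qed.

Lemma NmX t i : Nm (t ^+ i) = Nm t ^+ i.
Proof.
elim: i => [|i IH]; last by rewrite !exprS NmM IH.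
by rewrite !expr0 -(rmorph1 iota) Nm_iota expr1n.
Qed.

Lemma NmExp t : iota (Nm t) = t ^+ q.+1.
Proof. by rewrite NmE exprS. Qed.

Lemma card_Nm0 : #|[pred t | Nm t == 0]| = 1%N.
Proof. by rewrite -(card1 (0 : L)); apply: eq_card => t; rewrite !inE Nm_eq0. Qed.

Lemma card_Nm_le c : c != 0 -> (#|[pred t | Nm t == c]| <= q.+1)%N.
Proof.
move=> c0; pose p : {poly L} := 'X^(q.+1) - (iota c)%:P.
have sp : size p = q.+2 by rewrite size_XnsubC.
have p0 : p != 0 by rewrite -size_poly_eq0 sp.
have := @max_poly_roots _ p (enum [pred t | Nm t == c]) p0.
rewrite sp -cardE ltnS; apply; last exact: enum_uniq.
apply/allP => t; rewrite mem_enum inE => /eqP Et.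
by rewrite /root !hornerE subr_eq0 -Et NmExp.
Qed.

(* The fibres of the norm over [k^*] have at most [q + 1] points and their
   sizes add up to [q ^ 2 - 1 = (q - 1) (q + 1)]. *)
Lemma card_Nm c : c != 0 -> #|[pred t | Nm t == c]| = q.+1.
Proof.
have tot : (\sum_(c | c != 0%R) #|[pred t | Nm t == c]| = \sum_(c : k | c != 0%R) q.+1)%N.
  have := sum_card_fibers Nm; rewrite cardL (bigD1 (0 : k)) //= card_Nm0 => h.
  rewrite sum_nat_const; have -> : #|[pred c : k | c != 0]| = q.-1.
    by rewrite -(cardC1 (0 : k)); apply: eq_card => x; rewrite !inE.
  move: h; rewrite -/q; case: (q) card_k_gt1 => // m _ /=.
  by rewrite expnS expn1 add1n mulSn mulnS addSn => -[->]; rewrite !mulnS; nia.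
by apply: (sum_nat_eq_le _ tot) => d d0; exact: card_Nm_le.
Qed.

Lemma Nm_generator (z : L) : z != 0 -> (forall t, t != 0 -> exists i, t = z ^+ i) ->
  forall x : k, x != 0 -> exists i, x = Nm z ^+ i.
Proof.
move=> z0 gz x x0; have : #|[pred t | Nm t == x]| != 0%N by rewrite card_Nm.
case: (pickP [pred t | Nm t == x]) => [t /eqP Et _ | no]; last first.
  by rewrite (eq_card0 no).
have [|i Ei] := gz t; first by rewrite -Nm_eq0 Et.
by exists i; rewrite -NmX -Ei.
Qed.

(* Each pair (trace, norm) is hit exactly twice, counting the roots of
   [X^2 - s X + n] in [k] and in [L]: at most twice by inspection, and the
   total is [2 q^2]. *)
Lemma charpoly_split s n :
  (forall a d, a + d = s -> a * d <> n) -> exists t, Tr t = s /\ Nm t = n.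
Proof.
pose fL (t : L) := (Tr t, Nm t); pose fk (x : k * k) := (x.1 + x.2, x.1 * x.2).
pose c (y : k * k) := (#|[pred t | fL t == y]| + #|[pred x | fk x == y]|)%N.
have tot : (\sum_y c y = \sum_(y : k * k) 2)%N.
  rewrite big_split /= !sum_card_fibers sum_nat_const cardL card_prod -/q expnS expn1; lia.
have le2 y : (c y <= 2)%N.
  rewrite /c; case: (pickP [pred x | fk x == y]) => [[a d] /eqP /= Ey | no]; last first.
    rewrite (eq_card0 no) addn0.
    case: (pickP [pred t | fL t == y]) => [t /eqP /= Ey | no']; last by rewrite (eq_card0 no').
    rewrite (leq_trans _ (card_size [:: t; fconj t])) //.
    apply/subset_leq_card/subsetP => u; rewrite !inE -Ey => /eqP [Et En].
    by case: (same_charpoly Et En) => ->; rewrite eqxx ?orbT.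
  have kroot t : fL t == y -> t = iota a \/ t = iota d.
    rewrite -Ey => /eqP [/(congr1 iota) + /(congr1 iota)].
    rewrite TrE NmE rmorphD rmorphM => Et En.
    have : (t - iota a) * (t - iota d) == 0.
      have -> : (t - iota a) * (t - iota d) = t * (t - (iota a + iota d)) + iota a * iota d by ring.
      by rewrite -Et -En; apply/eqP; ring.
    by rewrite mulf_eq0 !subr_eq0 => /orP [] /eqP; [left | right].
  have kpair x : fk x == y -> x = (a, d) \/ x = (d, a).
    case: x => x1 x2; rewrite -Ey => /eqP [Et En].
    have : (x1 - a) * (x1 - d) == 0.
      have -> : (x1 - a) * (x1 - d) = x1 * (x1 - (a + d)) + a * d by ring.
      by rewrite -Et -En; apply/eqP; ring.
    rewrite mulf_eq0 !subr_eq0 => /orP [] /eqP E; [left | right]; move: Et; rewrite E.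
      by move/addrI => ->.
    by rewrite addrC => /addIr ->.
  have iok e : fL (iota e) == y -> a = d.
    move=> h; have Et : e + e = a + d by move: h; rewrite -Ey /fL Tr_iota => /eqP [].
    case: (kroot _ h) => /iinj Ee; move: Et; rewrite Ee; first by move/addrI.
    by move/addIr.
  have [ad | nad] := eqVneq a d.
    apply: (@leq_add _ _ 1 1).
      rewrite (leq_trans _ (card_size [:: iota a])) //.
      apply/subset_leq_card/subsetP => u; rewrite !inE => /kroot.
      by rewrite ad => -[] ->.
    rewrite (leq_trans _ (card_size [:: (a, d)])) //.
    apply/subset_leq_card/subsetP => u; rewrite !inE => /kpair.
    by rewrite ad => -[] ->.
  rewrite (eq_card0 (A := [pred t | fL t == y])); last first.
    move=> t; apply/negP; rewrite inE => h; move/eqP: nad; apply.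
    by case: (kroot _ h) => E; [apply: (iok a) | apply: (iok d)]; rewrite -E.
  rewrite add0n (leq_trans _ (card_size [:: (a, d); (d, a)])) //.
  apply/subset_leq_card/subsetP => u; rewrite !inE => /kpair [] ->; by rewrite eqxx ?orbT.
have eq2 y : c y = 2%N by exact: (sum_nat_eq_le (fun y _ => le2 y) tot).
move=> nsplit; have := eq2 (s, n); rewrite /c (eq_card0 (A := [pred x | fk x == _])); last first.
  by move=> [a d]; apply/negP; rewrite inE => /eqP [/nsplit].
rewrite addn0; case: (pickP [pred t | fL t == (s, n)]) => [t /eqP /= [Et En] | no].
  by exists t.
by rewrite (eq_card0 no).
Qed.

Lemma sub_charpoly x t : iota (x * (x - Tr t) + Nm t) = (iota x - t) * (iota x - fconj t).
Proof. by rewrite rmorphD rmorphM rmorphB /= TrE NmE; ring. Qed.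

End QuadExt.

(** * Generators and relations of GL2(k) *)

Section Elements.
Variable k : finFieldType.
Implicit Types (a b c d : k) (g h : {'GL_2[k]}).

Definition mx2 a b c d : 'M[k]_2 :=
  \matrix_(i, j) if i == 0 then (if j == 0 then a else b)
                 else (if j == 0 then c else d).

Lemma det_mx2 (M : 'M[k]_2) : \det M = M 0 0 * M 1 1 - M 0 1 * M 1 0.
Proof.
rewrite (expand_det_row M 0) !big_ord_recl big_ord0 addr0 /cofactor.
rewrite !det_mx11 !mxE /= expr0 mul1r expr1 mulN1r mulrN.
by congr (_ * M _ _ - M _ _ * M _ _); apply/val_inj.
Qed.

Lemma mx2_eta (M : 'M[k]_2) : M = mx2 (M 0 0) (M 0 1) (M 1 0) (M 1 1).
Proof.
apply/matrixP => i j; rewrite mxE.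
case: i => [[|[|//]] Hi]; case: j => [[|[|//]] Hj] /=; congr (M _ _); exact: val_inj.
Qed.

Lemma mx2M a b c d a' b' c' d' :
  mx2 a b c d *m mx2 a' b' c' d' =
  mx2 (a * a' + b * c') (a * b' + b * d') (c * a' + d * c') (c * b' + d * d').
Proof.
apply/matrixP => i j; rewrite !mxE !big_ord_recl big_ord0 addr0 !mxE /=.
by case: (i == 0); case: (j == 0).
Qed.

(** Singular entries give the default [1]; hence the determinant hypotheses below, and a spurious
    case in the parametrisation of conjugacy classes. *)
Definition gl a b c d : {'GL_2[k]} := insubd (1%g : {'GL_2[k]}) (mx2 a b c d).

Lemma glval a b c d : a * d - b * c != 0 -> GLval (gl a b c d) = mx2 a b c d.
Proof.
move=> D; have U : mx2 a b c d \is a GRing.unit.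
  by rewrite -[_ \is a _]/(_ \in unitmx) unitmxE unitfE det_mx2 !mxE /=.
by rewrite /gl /insubd insubT.
Qed.

Lemma GLval_inj : injective (@GLval 2 k). Proof. exact: val_inj. Qed.

Lemma GL_det2 g : GLval g 0 0 * GLval g 1 1 - GLval g 0 1 * GLval g 1 0 != 0.
Proof. by rewrite -det_mx2 -unitfE; exact: (valP g). Qed.

Lemma gl_eta g : g = gl (GLval g 0 0) (GLval g 0 1) (GLval g 1 0) (GLval g 1 1).
Proof. by apply: GLval_inj; rewrite glval ?GL_det2 // -mx2_eta. Qed.

Lemma glM a b c d a' b' c' d' : a * d - b * c != 0 -> a' * d' - b' * c' != 0 ->
  (gl a b c d * gl a' b' c' d')%g =
  gl (a * a' + b * c') (a * b' + b * d') (c * a' + d * c') (c * b' + d * d').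
Proof.
move=> D D'; apply: GLval_inj; rewrite GL_MxE !glval ?mx2M //.
apply: contra_neq (mulf_neq0 D D') => E.
by rewrite -[RHS]E; ring.
Qed.

Lemma gl1 : 1%g = gl 1 0 0 1.
Proof.
apply: GLval_inj; rewrite GL_1E glval ?mul0r ?subr0 ?mulr1 ?oner_eq0 //.
by rewrite [LHS]mx2_eta !mxE.
Qed.

Definition gu b := gl 1 b 0 1.
Definition gd a d := gl a 0 0 d.
Definition gw := gl 0 1 (-1) 0.

Lemma gl_borel a b d : a != 0 -> d != 0 -> gl a b 0 d = (gd a d * gu (b / a)%R)%g.
Proof.
move=> a0 d0; rewrite glM ?mulf_neq0 // ?mulr1 ?mul1r ?mulr0 ?mul0r ?subr0 ?oner_eq0 ?mulf_neq0 //.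
by congr gl; field.
Qed.

(** The open Bruhat cell. With [gl_borel] it gives the normal form copied by [sys_mx] and used by
    the two generation lemmas. *)
Lemma gl_cell a b c d : c != 0 -> a * d - b * c != 0 ->
  gl a b c d = (gu (a / c)%R * gd (- (a * d - b * c) / c)%R (- c)%R * gw * gu (d / c)%R)%g.
Proof.
move=> c0 D.
have dD : - (a * d - b * c) / c * - c - 0 * 0 != 0.
  by apply: contra_neq D => E; rewrite -[RHS]E; field.
have d1 x : 1 * 1 - x * 0 != 0 :> k by rewrite mulr0 subr0 mulr1 oner_eq0.
have dw : 0 * 0 - 1 * -1 != 0 :> k by rewrite mulrN opprK mulr0 mulr1 add0r oner_eq0.
rewrite /gu /gd /gw glM // glM //; last by apply: contra_neq D => E; rewrite -[RHS]E; field.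
rewrite glM //; last by apply: contra_neq D => E; rewrite -[RHS]E; field.
by congr gl; field.
Qed.

Lemma guM b c : (gu b * gu c)%g = gu (b + c)%R.
Proof. by rewrite glM ?mulr0 ?subr0 ?mulr1 ?oner_eq0 //; congr gl; ring. Qed.

Lemma gu0 : gu 0 = 1%g. Proof. by rewrite gl1. Qed.

Lemma gd1 : gd 1 1 = 1%g. Proof. by rewrite gl1. Qed.

Lemma gdM a d a' d' : a != 0 -> d != 0 -> a' != 0 -> d' != 0 ->
  (gd a d * gd a' d')%g = gd (a * a')%R (d * d')%R.
Proof. by move=> *; rewrite glM ?mulr0 ?subr0 ?mulf_neq0 //; congr gl; ring. Qed.

Lemma gdu a d b : a != 0 -> d != 0 -> (gd a d * gu b)%g = (gu (a * b / d)%R * gd a d)%g.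
Proof.
move=> a0 d0; rewrite !glM ?mulr0 ?mul0r ?subr0 ?mulr1 ?mulf_neq0 ?oner_eq0 //.
by congr gl; field.
Qed.

Lemma dw_neq0 : 0 * 0 - 1 * -1 != 0 :> k.
Proof. by rewrite mulrN opprK mulr0 mulr1 add0r oner_eq0. Qed.

Lemma gwd a d : a != 0 -> d != 0 -> (gw * gd a d)%g = (gd d a * gw)%g.
Proof.
move=> a0 d0; rewrite !glM ?dw_neq0 ?mulr0 ?mul0r ?subr0 ?mulr1 ?mulf_neq0 ?oner_eq0 //.
by congr gl; ring.
Qed.

Lemma gww : (gw * gw)%g = gd (-1) (-1).
Proof. by rewrite glM ?dw_neq0 //; congr gl; ring. Qed.

Lemma gwuw : (gw * gu 1%R * gw)%g = (gu (-1)%R * gd (-1)%R (-1)%R * gw * gu (-1)%R)%g.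
Proof.
have d1 x : 1 * 1 - x * 0 != 0 :> k by rewrite mulr0 subr0 mulr1 oner_eq0.
have n1 := oner_neq0 k.
rewrite !glM ?dw_neq0 //; first by (congr gl; ring).
all: by apply: contra_neq n1 => E; rewrite -[RHS]E; ring.
Qed.

Lemma gl_in_SL a b c d : a * d - b * c = 1 -> gl a b c d \in SL2 k.
Proof.
move=> D; rewrite inE glval ?D ?oner_eq0 // det_mx2 !mxE /=.
by rewrite D.
Qed.

Lemma gu_in_SL b : gu b \in SL2 k.
Proof. by apply: gl_in_SL; ring. Qed.

Lemma gw_in_SL : gw \in SL2 k.
Proof. by apply: gl_in_SL; ring. Qed.

Lemma gd_in_SL a : a != 0 -> gd a a^-1 \in SL2 k.
Proof. by move=> a0; apply: gl_in_SL; field. Qed.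

Lemma gen_GL2 (P : {'GL_2[k]} -> Prop) :
  (forall g h, P g -> P h -> P (g * h)%g) ->
  (forall b, P (gu b)) -> (forall a d, a != 0 -> d != 0 -> P (gd a d)) -> P gw ->
  forall g, P g.
Proof.
move=> PM Pu Pd Pw g; rewrite (gl_eta g); move: (GL_det2 g).
move: (_ 0 0) (_ 0 1) (_ 1 0) (_ 1 1) => a b c d.
have [-> | c0] := eqVneq c 0.
  rewrite mulr0 subr0 mulf_eq0 => /norP [a0 d0].
  by rewrite gl_borel //; apply: (PM) => //; exact: Pd.
move=> D; rewrite gl_cell //; apply: (PM) => //; apply: (PM) => //; apply: (PM) => //.
apply: Pd; rewrite ?oppr_eq0 // mulNr oppr_eq0 mulf_neq0 // invr_eq0 //.
Qed.

Lemma gen_SL2 (P : {'GL_2[k]} -> Prop) :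
  (forall g h, P g -> P h -> P (g * h)%g) ->
  (forall b, P (gu b)) -> (forall a, a != 0 -> P (gd a a^-1)) -> P gw ->
  forall g, g \in SL2 k -> P g.
Proof.
move=> PM Pu Pd Pw g; rewrite inE det_mx2 {5}(gl_eta g).
move: (_ 0 0) (_ 0 1) (_ 1 0) (_ 1 1) => a b c d /eqP D.
have n1 : a * d - b * c != 0 by rewrite D oner_eq0.
have [c0 | c0] := eqVneq c 0.
  move: (D); rewrite c0 mulr0 subr0 => ad.
  have a0 : a != 0 by apply: contra_eq_neq ad => ->; rewrite mul0r eq_sym oner_eq0.
  have -> : d = a^-1 by rewrite -[d](mulKf a0) ad mulr1.
  by rewrite gl_borel ?invr_eq0 //; apply: (PM) => //; exact: Pd.
rewrite gl_cell //; apply: (PM) => //; apply: (PM) => //; apply: (PM) => //.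
rewrite D; have -> : - c = (- 1 / c)^-1 by rewrite invf_div invrN1 mulrN1.
apply: Pd; by rewrite mulf_neq0 // ?invr_eq0 // oppr_eq0 oner_eq0.
Qed.

End Elements.

Ltac fld := by field; do ?[apply/andP; split]; rewrite ?oppr_eq0 ?oner_neq0 ?oner_eq0.

(** These relations suffice to present [GL2]. Values of [D] at zero arguments are free, and matrices
    act on row vectors from the right. A single relation for [W], [U 1], [W] is enough because the
    torus conjugates [U 1] to every [U b] with [b] nonzero. *)
Record GL2_system (k : finFieldType) (R : fieldType) n
    (U : k -> 'M[R]_n) (D : k -> k -> 'M[R]_n) (W : 'M[R]_n) : Prop := GL2System {
  sysU0 : U 0 = 1%:M;
  sysUM : forall b c, U b *m U c = U (b + c);
  sysD1 : D 1 1 = 1%:M;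
  sysDM : forall a d a' d', a != 0 -> d != 0 -> a' != 0 -> d' != 0 ->
    D a d *m D a' d' = D (a * a') (d * d');
  sysDU : forall a d b, a != 0 -> d != 0 -> D a d *m U b = U (a * b / d) *m D a d;
  sysWD : forall a d, a != 0 -> d != 0 -> W *m D a d = D d a *m W;
  sysWW : W *m W = D (-1) (-1);
  sysWUW : W *m U 1 *m W = U (-1) *m D (-1) (-1) *m W *m U (-1) }.

Section SystemRepr.
Variables (k : finFieldType) (R : fieldType) (n : nat).
Variables (U : k -> 'M[R]_n) (D : k -> k -> 'M[R]_n) (W : 'M[R]_n).
Hypothesis S : GL2_system U D W.
Implicit Types (a b c d : k) (g h : {'GL_2[k]}).

Let Nk0 (a : k) : a != 0 -> - a != 0. Proof. by rewrite oppr_eq0. Qed.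
Let Vk0 (a : k) : a != 0 -> a^-1 != 0. Proof. by rewrite invr_eq0. Qed.
Let o0 : 1 != 0 :> k. Proof. exact: oner_neq0. Qed.

(** [D b 1] conjugates [U 1] into [U b], and crossing [W] turns it into [D 1 b]; this spreads
    [sysWUW] to every nonzero parameter. *)
Lemma sys_wuw (b : k) : b != 0 ->
  W *m U b *m W = U (- b^-1) *m D (- b^-1) (- b) *m W *m U (- b^-1).
Proof.
move=> b0.
have E : U b = D b 1 *m U 1 *m D b^-1 1.
  rewrite (sysDU S) // mulr1 divr1 -mulmxA (sysDM S) ?Vk0 //.
  by rewrite mulfV // mulr1 (sysD1 S) mulmx1.
transitivity (D 1 b *m (W *m U 1 *m W) *m D 1 b^-1).
  by rewrite E -!mulmxA (sysWD S) ?Vk0 // !mulmxA (sysWD S).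
rewrite (sysWUW S) !mulmxA.
rewrite (sysDU S) // -!mulmxA; congr (U _ *m _); first fld.
have -> : U (-1) *m D 1 b^-1 = D 1 b^-1 *m U (- b^-1).
  by rewrite (sysDU S) ?Vk0 //; congr (U _ *m _); fld.
rewrite !(mulmxA W) (sysWD S) ?Vk0 // !mulmxA; congr (_ *m _ *m _).
rewrite !(sysDM S) ?Vk0 ?mulf_neq0 ?Nk0 //.
by congr (D _ _); fld.
Qed.

(** The Bruhat normal forms with [U], [D], [W] in place of group elements. Multiplicativity is
    checked for left multiplication by each generator and then spread by [gen_GL2]. *)
Definition sys_mx (a b c d : k) : 'M[R]_n :=
  if c == 0 then D a d *m U (b / a)
  else U (a / c) *m D (- (a * d - b * c) / c) (- c) *m W *m U (d / c).

Definition sys_fun (g : {'GL_2[k]}) : 'M[R]_n :=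
  let M := GLval g in sys_mx (M 0 0) (M 0 1) (M 1 0) (M 1 1).

Lemma sys_fun_gl a b c d : a * d - b * c != 0 -> sys_fun (gl a b c d) = sys_mx a b c d.
Proof. by move=> h; rewrite /sys_fun glval // !mxE. Qed.

Lemma sys_gu b : sys_fun (gu b) = U b.
Proof.
rewrite sys_fun_gl ?mulr0 ?subr0 ?mulr1 // /sys_mx eqxx (sysD1 S) mul1mx.
by rewrite divr1.
Qed.

Lemma sys_gd a d : a != 0 -> d != 0 -> sys_fun (gd a d) = D a d.
Proof.
move=> a0 d0; rewrite sys_fun_gl ?mulr0 ?subr0 ?mulf_neq0 // /sys_mx eqxx.
by rewrite mul0r (sysU0 S) mulmx1.
Qed.

Lemma sys_gw : sys_fun (gw k) = W.
Proof.
rewrite sys_fun_gl ?dw_neq0 // /sys_mx oppr_eq0 oner_eq0 !mul0r !(sysU0 S).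
rewrite mulmx1 mul1mx; have -> : D (- (0 - 1 * -1) / -1) (- -1) = D 1 1.
  by congr (D _ _); fld.
by rewrite (sysD1 S) mul1mx.
Qed.

Lemma sys_gu_mul b h : sys_fun (gu b * h)%g = U b *m sys_fun h.
Proof.
rewrite (gl_eta h); move: (GL_det2 h); move: (_ 0 0) (_ 0 1) (_ 1 0) (_ 1 1) => A B C E h0.
have e1 : 1 * 1 - b * 0 != 0 :> k by rewrite mulr0 subr0 mulr1.
rewrite glM // !sys_fun_gl //; last first.
  by apply: contra_neq h0 => e; rewrite -[RHS]e; ring.
rewrite /sys_mx !mul0r !add0r !mul1r; have [C0 | C0] := eqVneq C 0.
  move: h0; rewrite C0 mulr0 subr0 mulf_eq0 => /norP [A0 E0].
  rewrite mulr0 addr0 mulmxA.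
  have -> : U b *m D A E = D A E *m U (b * E / A).
    by rewrite (sysDU S) //; congr (U _ *m _); fld.
  by rewrite -mulmxA (sysUM S); congr (_ *m U _); fld.
rewrite !mulmxA (sysUM S); congr (U _ *m D _ _ *m _ *m _); fld.
Qed.

Lemma sys_gd_mul a d h : a != 0 -> d != 0 -> sys_fun (gd a d * h)%g = D a d *m sys_fun h.
Proof.
move=> a0 d0.
rewrite (gl_eta h); move: (GL_det2 h); move: (_ 0 0) (_ 0 1) (_ 1 0) (_ 1 1) => A B C E h0.
have e1 : a * d - 0 * 0 != 0 :> k by rewrite mulr0 subr0 mulf_neq0.
rewrite glM // !sys_fun_gl //; last first.
  apply: contra_neq (mulf_neq0 e1 h0) => e; rewrite -[RHS]e; ring.
rewrite /sys_mx !mul0r !add0r !addr0 mulf_eq0 (negPf d0) /=.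
have [C0 | C0] := eqVneq C 0.
  move: h0; rewrite C0 mulr0 subr0 mulf_eq0 => /norP [A0 E0].
  by rewrite mulmxA (sysDM S) //; congr (_ *m U _); field; rewrite a0 A0.
have h1 : - (A * E - B * C) / C != 0 by rewrite mulf_neq0 ?Nk0 ?Vk0.
rewrite !mulmxA (sysDU S) // -(mulmxA (U _) (D a d)) (sysDM S) ?Nk0 //.
congr (U _ *m D _ _ *m _ *m U _); fld.
Qed.

Lemma sys_gw_mul h : sys_fun (gw k * h)%g = W *m sys_fun h.
Proof.
rewrite (gl_eta h); move: (GL_det2 h); move: (_ 0 0) (_ 0 1) (_ 1 0) (_ 1 1) => A B C E h0.
rewrite glM ?dw_neq0 // !sys_fun_gl //; last first.
  by apply: contra_neq h0 => e; rewrite -[RHS]e; ring.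
rewrite /sys_mx !mul0r !add0r !addr0 !mul1r !mulN1r oppr_eq0.
have [C0 | C0] := eqVneq C 0.
  move: h0; rewrite C0 mulr0 subr0 mulf_eq0 => /norP [A0 E0].
  rewrite (negPf A0) !mul0r (sysU0 S) mul1mx mulmxA (sysWD S) //.
  congr (D _ _ *m _ *m U _); fld.
have h1 : - (A * E - B * C) / C != 0 by rewrite mulf_neq0 ?Nk0 ?Vk0.
(* Left multiplication by [gw] makes [- A] the lower left entry. For [A = 0] the product falls back
   into the Borel subgroup and [sysWW] applies; otherwise it stays in the big cell and [sys_wuw] is
   needed. *)
have [A0 | A0] := eqVneq A 0.
  have B0 : B != 0 by apply: contra_neq h0 => ->; rewrite A0; ring.
  have m1 : -1 != 0 :> k by rewrite Nk0.
  have -> : A / C = 0 by rewrite A0 mul0r.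
  rewrite (sysU0 S) mul1mx !mulmxA (sysWD S) ?Nk0 // -(mulmxA _ W W) (sysWW S) (sysDM S) ?Nk0 //.
  rewrite A0; congr (D _ _ *m _); fld.
rewrite !mulmxA -(mulmxA (W *m _) (D _ _) W) -(sysWD S) ?Nk0 // !mulmxA.
rewrite sys_wuw ?mulf_neq0 ?Vk0 //.
have h2 : A / C != 0 by rewrite mulf_neq0 ?Vk0.
rewrite -(mulmxA _ (U _) (D _ _)).
have -> : U (- (A / C)^-1) *m D (- C) (- (A * E - B * C) / C) =
    D (- C) (- (A * E - B * C) / C) *m U (- (A * E - B * C) / (A * C)).
  rewrite (sysDU S) ?Nk0 //; congr (U _ *m _); fld.
rewrite !mulmxA -(mulmxA _ W (D _ _)) (sysWD S) ?Nk0 // !mulmxA.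
rewrite -(mulmxA _ (D _ _) (D _ _)) (sysDM S) ?Nk0 ?Vk0 // -(mulmxA _ (U _) (U _)).
rewrite (sysUM S); congr (U _ *m D _ _ *m _ *m U _); fld.
Qed.

Lemma sys_mul g h : sys_fun (g * h)%g = sys_fun g *m sys_fun h.
Proof.
move: h; apply: (gen_GL2 (P := fun g => forall h, sys_fun (g * h)%g = sys_fun g *m sys_fun h)).
- by move=> x y Hx Hy h; rewrite -mulgA !Hx Hy mulmxA.
- by move=> b h; rewrite sys_gu_mul sys_gu.
- by move=> a d a0 d0 h; rewrite sys_gd_mul // sys_gd.
- by move=> h; rewrite sys_gw_mul sys_gw.
Qed.

Lemma sys_mx_repr : mx_repr (GL2 k) sys_fun.
Proof. by split=> [|x y _ _]; [rewrite -gu0 sys_gu (sysU0 S) | exact: sys_mul]. Qed.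

Definition sys_repr := MxRepresentation sys_mx_repr.

End SystemRepr.

Section ReprSystem.
Variables (k : finFieldType) (R : fieldType) (n : nat).
Variable rG : mx_representation R (GL2 k) n.

Lemma GL2_mem g : g \in GL2 k. Proof. by rewrite inE. Qed.

Lemma GL2_reprM g h : rG (g * h)%g = rG g *m rG h.
Proof. by rewrite repr_mxM ?GL2_mem. Qed.

Lemma GL2_repr1 : rG (1%g : {'GL_2[k]}) = 1%:M.
Proof. by rewrite repr_mx1. Qed.

Lemma repr_system : GL2_system (fun b => rG (gu b)) (fun a d => rG (gd a d)) (rG (gw k)).
Proof.
split.
- by rewrite gu0 GL2_repr1.
- by move=> b c; rewrite -GL2_reprM guM.
- by rewrite gd1 GL2_repr1.
- by move=> a d a' d' a0 d0 a0' d0'; rewrite -GL2_reprM gdM.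
- by move=> a d b a0 d0; rewrite -!GL2_reprM gdu.
- by move=> a d a0 d0; rewrite -!GL2_reprM gwd.
- by rewrite -GL2_reprM gww.
- by rewrite -!GL2_reprM gwuw.
Qed.

End ReprSystem.

(** * Reduction of integral representations *)

Section MatrixModules.
Variables (E : fieldType) (gT : finGroupType) (G : {group gT}).

Lemma irr_composition_series n (rG : mx_representation E G n) :
  mx_irreducible rG -> mx_composition_series rG [:: 1%:M].
Proof.
move=> irr; split=> [|[|//] _]; first by rewrite /= /mx_subseries /= mxmodule1.
have [n0 irr'] := (mx_irrP rG).1 irr.
split=> [|W [modW W0 W1]].
  by rewrite /= lt0mx -mxrank_eq0 mxrank1 -lt0n.
have /irr' : W != 0 by rewrite lt0mx in W0.
by move/(_ modW); rewrite -sub1mx => h; move: W1; rewrite /ltmx h andbF.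
Qed.

Lemma irr_series_rsim n (rG : mx_representation E G n)
    (cU : mx_composition_series rG [:: 1%:M]) : mx_rsim (series_repr 0 cU) rG.
Proof.
pose m0 := mxmodule0 rG n; pose m1 := mxmodule1 rG.
apply: (mx_rsim_trans (rG2 := section_repr m0 m1)).
  rewrite /series_repr /subseries_repr.
  have e1 := bool_irrelevance (mx_subseries_module' 0 (proj1 cU)) m0.
  have e2 := bool_irrelevance (mx_subseries_module 0 (proj1 cU)) m1.
  by rewrite /= in e1 e2 *; rewrite e1 e2; exact: mx_rsim_refl.
apply: (mx_rsim_trans (rG2 := factmod_repr m0)); first exact: mx_factmod_sub.
apply: (mx_rsim_trans (rG2 := submod_repr m1)); last exact: rsim_submod1.
apply: mx_rsim_factmod; first exact: addsmx0.
by apply/mxdirect_addsP; rewrite capmx0.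
Qed.

Lemma same_ss_irr n m (r1 : mx_representation E G n) (r2 : mx_representation E G m) :
  mx_irreducible r2 -> mx_rsim r1 r2 -> same_ss r1 r2.
Proof.
move=> irr2 sim; have irr1 := mx_rsim_irr (mx_rsim_sym sim) irr2.
have c1 := irr_composition_series irr1; have c2 := irr_composition_series irr2.
exists [:: 1%:M], [:: 1%:M], c1, c2; split=> //=; try exact/eqmxP.
exists 1%g => i; rewrite perm1; have -> : i = ord0 by apply: val_inj; case: i => [[]].
apply: mx_rsim_trans (irr_series_rsim c1) _; apply: mx_rsim_trans sim _.
exact: mx_rsim_sym (irr_series_rsim c2).
Qed.

Lemma mx_length1 n (rG : mx_representation E G n) : mx_irreducible rG -> mx_length rG 1.
Proof.
move=> irr; exists [:: 1%:M]; split=> //; split; last exact/eqmxP.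
exact: irr_composition_series.
Qed.

End MatrixModules.

Lemma closed_Schur (E : closedFieldType) (gT : finGroupType) (G : {group gT}) n
    (rG : mx_representation E G n) (A : 'M_n) :
  mx_irreducible rG -> (forall g, g \in G -> A *m rG g = rG g *m A) ->
  exists a, A = a%:M.
Proof.
move=> irr cA; have [n0 _] := (mx_irrP rG).1 irr.
have /closed_rootP [a ra] : size (char_poly A) != 1 by rewrite size_char_poly eqSS -lt0n.
exists a; apply/eqP; rewrite -subr_eq0; apply: contraLR ra => nz.
have cB : centgmx rG (A - a%:M).
  apply/centgmxP => g Gg; rewrite mulmxBl mulmxBr cA //.
  by rewrite scalar_mxC.
have U := mx_Schur irr cB nz.
rewrite -eigenvalue_root_char /eigenvalue /eigenspace negbK.
by rewrite kermx_eq0 row_free_unit.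
Qed.

Section Residue.
Variables (K F : fieldType) (O : {pred K}) (red : K -> F).
Hypothesis RD : residue_data O red.

Lemma O0 : 0 \in O. Proof. by case: RD => -[]. Qed.
Lemma O1 : 1 \in O. Proof. by case: RD => -[]. Qed.
Lemma OB x y : x \in O -> y \in O -> x - y \in O.
Proof. by case: RD => -[_ _ h _ _] _; exact: h. Qed.
Lemma OM x y : x \in O -> y \in O -> x * y \in O.
Proof. by case: RD => -[_ _ _ h _] _; exact: h. Qed.
Lemma OV x : x \in O \/ x^-1 \in O.
Proof. by case: RD => -[_ _ _ _ h] _; exact: h. Qed.
Lemma ON x : x \in O -> - x \in O.
Proof. by move=> Ox; rewrite -sub0r; exact: (OB O0). Qed.
Lemma OD x y : x \in O -> y \in O -> x + y \in O.
Proof. by move=> Ox Oy; rewrite -[y]opprK; apply: OB => //; exact: ON. Qed.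
Lemma OX x i : x \in O -> x ^+ i \in O.
Proof. by move=> Ox; elim: i => [|i IH]; rewrite ?expr0 ?O1 // exprS OM. Qed.
Lemma Osum I (r : seq I) (P : pred I) (f : I -> K) :
  (forall i, P i -> f i \in O) -> \sum_(i <- r | P i) f i \in O.
Proof. by move=> h; elim/big_ind: _ => //; [exact: O0 | exact: OD]. Qed.
Lemma Oprod I (r : seq I) (P : pred I) (f : I -> K) :
  (forall i, P i -> f i \in O) -> \prod_(i <- r | P i) f i \in O.
Proof. by move=> h; elim/big_ind: _ => //; [exact: O1 | exact: OM]. Qed.
Lemma Onat i : i%:R \in O.
Proof. by elim: i => [|i IH]; rewrite ?O0 // -addn1 natrD OD ?O1. Qed.
(** A root of unity and its inverse are powers of each other, and one of the two lies in [O]. *)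
Lemma Oroot x i : (0 < i)%N -> x ^+ i = 1 -> x \in O.
Proof.
case: i => // i _ xi; case: (OV x) => // Ox.
have x0 : x != 0 by apply: contra_eq_neq xi => ->; rewrite expr0n eq_sym oner_eq0.
have -> : x = (x^-1) ^+ i by rewrite exprVn; apply: (mulIf (expf_neq0 i x0)); rewrite -exprS xi mulVf ?expf_neq0.
exact: OX.
Qed.

Lemma red1 : red 1 = 1. Proof. by case: RD => _ []. Qed.
Lemma redD x y : x \in O -> y \in O -> red (x + y) = red x + red y.
Proof. by case: RD => _ [_ h _ _ _]; exact: h. Qed.
Lemma redM x y : x \in O -> y \in O -> red (x * y) = red x * red y.
Proof. by case: RD => _ [_ _ h _ _]; exact: h. Qed.
Lemma red_surj z : exists2 x, x \in O & red x = z.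
Proof. by case: RD => _ [_ _ _ _ h]; exact: h. Qed.
Lemma red0 : red 0 = 0.
Proof. by apply: (addrI (red 0)); rewrite -redD ?O0 // !addr0. Qed.
Lemma redN x : x \in O -> red (- x) = - red x.
Proof.
move=> Ox; apply/eqP; rewrite -addr_eq0 -redD ?ON //.
by rewrite addNr red0.
Qed.
Lemma redB x y : x \in O -> y \in O -> red (x - y) = red x - red y.
Proof. by move=> Ox Oy; rewrite redD ?ON // redN. Qed.
Lemma redX x i : x \in O -> red (x ^+ i) = red x ^+ i.
Proof. by move=> Ox; elim: i => [|i IH]; rewrite ?red1 // !exprS redM ?OX // IH. Qed.
Lemma redsum I (r : seq I) (P : pred I) (f : I -> K) :
  (forall i, P i -> f i \in O) ->
  red (\sum_(i <- r | P i) f i) = \sum_(i <- r | P i) red (f i).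
Proof.
move=> h; elim: r => [|i r IH]; rewrite ?big_nil ?red0 // !big_cons.
by case: ifP => Pi //; rewrite redD ?IH ?h ?Osum.
Qed.
Lemma redprod I (r : seq I) (P : pred I) (f : I -> K) :
  (forall i, P i -> f i \in O) ->
  red (\prod_(i <- r | P i) f i) = \prod_(i <- r | P i) red (f i).
Proof.
move=> h; elim: r => [|i r IH]; rewrite ?big_nil ?red1 // !big_cons.
by case: ifP => Pi //; rewrite redM ?IH ?h ?Oprod.
Qed.
Lemma red_nat i : red i%:R = i%:R.
Proof. by elim: i => [|i IH]; rewrite ?red0 // -addn1 !natrD redD ?Onat ?O1 // IH red1. Qed.

Definition Omx m n (A : 'M[K]_(m, n)) := forall i j, A i j \in O.

Lemma OmxM m n p (A : 'M[K]_(m, n)) (B : 'M_(n, p)) : Omx A -> Omx B -> Omx (A *m B).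
Proof. by move=> OA OBm i j; rewrite mxE; apply: Osum => h _; exact: OM. Qed.

Lemma Omx_scalar n a : a \in O -> Omx (a%:M : 'M_n).
Proof. by move=> Oa i j; rewrite mxE; case: eqP => _; rewrite ?mulr1n ?mulr0n ?O0. Qed.

Lemma red_mxM m n p (A : 'M[K]_(m, n)) (B : 'M_(n, p)) : Omx A -> Omx B ->
  map_mx red (A *m B) = map_mx red A *m map_mx red B.
Proof.
move=> OA OBm; apply/matrixP => i j; rewrite !mxE redsum => [|h _]; last exact: OM.
by apply: eq_bigr => h _; rewrite redM // !mxE.
Qed.

Lemma red_scalar n a : map_mx red (a%:M : 'M_n) = (red a)%:M.
Proof. by apply/matrixP => i j; rewrite !mxE; case: eqP => _; rewrite ?mulr1n ?mulr0n ?red0. Qed.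

(** Stronger than [is_reduction]: the standard lattice itself is stable, and its reduction is
    isomorphic to [sigma] instead of merely sharing its composition factors. *)
Definition lifts gT (G : {group gT}) n (st : mx_representation K G n)
    m (sigma : mx_representation F G m) :=
  (forall g, g \in G -> Omx (st g)) /\
  exists B : 'M[F]_(n, m), [/\ n = m, row_free B &
    forall g, g \in G -> map_mx red (st g) *m B = B *m sigma g].

Section RedRepr.
Variables (gT : finGroupType) (G : {group gT}) (n : nat) (st : mx_representation K G n).
Hypothesis Ost : forall g, g \in G -> Omx (st g).

Lemma red_mx_repr : mx_repr G (fun g => map_mx red (st g)).
Proof.
split=> [|x y Gx Gy]; first by rewrite repr_mx1 red_scalar red1.
by rewrite repr_mxM // red_mxM //; exact: Ost.
Qed.
Definition red_repr := MxRepresentation red_mx_repr.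
End RedRepr.

Lemma lifts_is_reduction gT (G : {group gT}) n (st : mx_representation K G n)
    m (sigma : mx_representation F G m) :
  mx_irreducible sigma -> lifts st sigma -> is_reduction O red st sigma.
Proof.
move=> irr [Ost [B [nm fB hB]]]; exists 1%:M; split; first exact: unitmx1.
have E g : 1%:M *m st g *m invmx 1%:M = st g by rewrite mul1mx invmx1 mulmx1.
split=> [g Gg|]; first by rewrite E; exact: Ost.
exists (red_repr Ost); split=> [g _|]; first by rewrite E.
by apply: same_ss_irr => //; exists B.
Qed.

(** Divisibility in a valuation ring is a total preorder, so a finite family with a nonzero member
    has one that divides all the others. *)
Lemma valuation_max (T : eqType) (v : T -> K) (s : seq T) :
  has (fun x => v x != 0) s ->
  exists x, [/\ x \in s, v x != 0 & forall y, y \in s -> v y / v x \in O].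
Proof.
elim: s => //= a s IH; case: (boolP (has _ s)) => [/IH [x [xs vx mx]] _ | /hasPn no].
  case: (OV (v a / v x)) => [Oa | ].
    exists x; rewrite inE xs orbT; split=> // y /predU1P [-> // | /mx //].
  rewrite invf_div => Oa; have [va0 | va0] := eqVneq (v a) 0.
    exists x; rewrite inE xs orbT; split=> // y /predU1P [-> | /mx //].
    by rewrite va0 mul0r O0.
  exists a; rewrite inE eqxx; split=> // y /predU1P [-> | /mx Oy].
    by rewrite divff ?O1.
  by have := OM Oy Oa; rewrite mulrA divfK.
rewrite orbF => va; exists a; rewrite inE eqxx; split=> // y /predU1P [-> | /no].
  by rewrite divff ?O1.
by rewrite negbK => /eqP ->; rewrite mul0r O0.
Qed.

(** Cramer's rule in disguise: the matrix is the identity with column [i] replaced. It turns an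
    entry of [X *m N] into a quotient of maximal minors. *)
Lemma det_delta_col r (A : 'M[K]_r) i :
  (forall i' j', j' != i -> A i' j' = (i' == j')%:R) -> \det A = A i i.
Proof.
move=> hA; rewrite (expand_det_row A i) (bigD1 i) //= big1 ?addr0 => [|j ji]; last first.
  by rewrite hA // eq_sym (negPf ji) mul0r.
rewrite /cofactor addnn -signr_odd odd_double mul1r.
have -> : row' i (col' i A) = 1%:M.
  by apply/matrixP => a b; rewrite !mxE hA ?(inj_eq (@lift_inj _ i)) // eq_sym neq_lift.
by rewrite det1 mulr1.
Qed.

(* Scaling by the inverse of the maximal minor with the largest valuation makes
   all entries integral (they are quotients of maximal minors) and one of the
   maximal submatrices equal to the identity. *)
Lemma saturated_basis r n (N : 'M[K]_(r, n)) : row_free N ->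
  exists (X : 'M[K]_r) (f : 'I_r -> 'I_n),
    [/\ X \in unitmx, Omx (X *m N) & colsub f (X *m N) = 1%:M].
Proof.
move=> fN; pose v (f : {ffun 'I_r -> 'I_n}) := \det (colsub f N).
have [|f [_ vf mf]] := @valuation_max _ v (enum {: {ffun 'I_r -> 'I_n}}).
  have fT : row_full N^T by rewrite /row_full mxrank_tr.
  pose f0 := fullrankfun fT.
  apply/hasP; exists [ffun i => f0 i]; first exact: mem_enum.
  have := fullrowsub_unit fT; rewrite unitmxE unitfE -det_tr.
  rewrite /v; set A1 := (rowsub _ _)^T; set A2 := colsub _ _.
  have E : A1 = A2 by apply/matrixP => i j; rewrite !mxE; congr (N i _); rewrite [RHS]ffunE.
  by rewrite E.
have uA : colsub f N \in unitmx by rewrite unitmxE unitfE.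
pose X := invmx (colsub f N); exists X, f.
have subM (f' : 'I_r -> 'I_n) (Y : 'M_r) (M : 'M[K]_(r, n)) : colsub f' (Y *m M) = Y *m colsub f' M.
  by apply/matrixP => i j; rewrite !mxE; apply: eq_bigr => h _; rewrite !mxE.
have X1 : colsub f (X *m N) = 1%:M by rewrite subM mulVmx.
split=> //; first by rewrite unitmx_inv.
move=> i j; pose f' := [ffun a => if a == i then j else f a].
have -> : (X *m N) i j = v f' / v f.
  rewrite -[LHS](_ : \det (colsub f' (X *m N)) = _).
    by rewrite subM det_mulmx mulrC det_inv.
  rewrite (@det_delta_col _ _ i) ?mxE ?ffunE ?eqxx //.
  move=> i' j' ji; have /matrixP/(_ i' j') := X1.
  by rewrite [in RHS]mxE => <-; rewrite [LHS]mxE [RHS]mxE ffunE (negPf ji).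
exact: mf (mem_enum _ _).
Qed.

(** In a saturated basis [M] the columns [f] form the identity, so they read off the coordinates of
    any vector of the row space. Hence the action on the submodule is integral, and the identity
    block survives reduction, which keeps the rank. *)
Lemma lattice_submodule gT (H : {group gT}) n (st : mx_representation K H n)
    r (N : 'M[K]_(r, n)) :
  (forall g, g \in H -> Omx (st g)) -> row_free N ->
  (forall g, g \in H -> (N *m st g <= N)%MS) ->
  exists (A : mx_representation K H r) (N2 : 'M[F]_(r, n)),
    [/\ forall g, g \in H -> Omx (A g), row_free N2 &
        forall g, g \in H -> map_mx red (A g) *m N2 = N2 *m map_mx red (st g)].
Proof.
move=> Ost fN modN; have [X [f [uX OM1 M1]]] := saturated_basis fN.
set M := X *m N in OM1 M1.
have subM (Y : 'M_r) (M' : 'M[K]_(r, n)) : colsub f (Y *m M') = Y *m colsub f M'.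
  by apply/matrixP => i j; rewrite !mxE; apply: eq_bigr => h _; rewrite !mxE.
have actM g : g \in H -> M *m st g = colsub f (M *m st g) *m M.
  move=> Hg; have /submxP [Y EY] := modN g Hg.
  have {1 2}-> : M *m st g = (X *m Y *m invmx X) *m M.
    by rewrite /M -mulmxA EY !mulmxA mulmxKV.
  by rewrite subM M1 mulmx1.
clearbody M; have reprA : mx_repr H (fun g => colsub f (M *m st g)).
  split=> [|x y Hx Hy]; first by rewrite repr_mx1 mulmx1 M1.
  by rewrite repr_mxM // -subM; congr (colsub f _); rewrite !mulmxA -actM.
have OA g : g \in H -> Omx (colsub f (M *m st g)).
  by move=> Hg i j; rewrite !mxE; apply: Osum => h _; apply: OM => //; exact: Ost.
exists (MxRepresentation reprA), (map_mx red M); split.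
- exact: OA.
- apply/row_freeP; exists (colsub f 1%:M).
  have -> : map_mx red M *m colsub f 1%:M = map_mx red (colsub f M).
    apply/matrixP => i j; rewrite !mxE (bigD1 (f j)) //= !mxE eqxx mulr1.
    by rewrite big1 ?addr0 // => h hj; rewrite !mxE (negPf hj) mulr0.
  by rewrite M1 red_scalar red1.
- move=> g Hg /=; have OA1 := OA g Hg; have Og := Ost g Hg.
  by rewrite -(red_mxM OM1 Og) -(red_mxM OA1 OM1) -actM.
Qed.

End Residue.

(** * Clifford theory for SL2(k) *)

(** [mxsimple_exists] yields simple submodules only under [classically]; excluded middle removes the
    modality. *)
Lemma classicallyP (P : Prop) : classically P -> P.
Proof.
by move=> cP; case: (classic P) => // nP; have := cP false (fun p => False_ind _ (nP p)).
Qed.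

Lemma SL2_normal (k : finFieldType) : (SL2 k <| GL2 k)%g.
Proof.
apply/andP; split; first exact: SL2_sub_GL2.
apply/subsetP => x _; rewrite inE; apply/subsetP => _ /imsetP [y Sy ->].
move: Sy; rewrite !inE conjgE !GL_MxE !det_mulmx => /eqP ->.
by rewrite mul1r -det_mulmx -GL_MxE mulVg GL_1E det1.
Qed.

Section SimpleImage.
Variables (E : fieldType) (gT : finGroupType) (G : {group gT}).

Lemma irr_hom_free n m (r1 : mx_representation E G n) (r2 : mx_representation E G m)
    (B : 'M_(n, m)) :
  mx_irreducible r1 -> B != 0 -> (forall g, g \in G -> r1 g *m B = B *m r2 g) -> row_free B.
Proof.
move=> irr B0 hB; rewrite -kermx_eq0; apply: contraNT B0 => nz.
have [_ /(_ (kermx B))] := (mx_irrP r1).1 irr.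
have mk : mxmodule r1 (kermx B).
  apply/mxmoduleP => g Gg; apply/sub_kermxP.
  by rewrite -mulmxA hB // mulmxA mulmx_ker mul0mx.
move=> /(_ mk nz); rewrite -sub1mx => /sub_kermxP.
by rewrite mul1mx => ->.
Qed.

Lemma hom_image_module n m (r1 : mx_representation E G n) (r2 : mx_representation E G m)
    (B : 'M_(n, m)) :
  (forall g, g \in G -> r1 g *m B = B *m r2 g) -> mxmodule r2 <<B>>%MS.
Proof.
move=> hB; rewrite (eqmx_module _ (genmxE _)).
by apply/mxmoduleP => g Gg; rewrite -hB // submxMl.
Qed.

Lemma hom_image_simple n m (r1 : mx_representation E G n) (r2 : mx_representation E G m)
    (B : 'M_(n, m)) :
  mx_irreducible r1 -> row_free B -> (forall g, g \in G -> r1 g *m B = B *m r2 g) ->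
  mxsimple r2 <<B>>%MS.
Proof.
move=> irr fB hB; have mB := hom_image_module hB.
apply/(submod_mx_irr mB); apply: mx_rsim_irr irr.
have sB : (B <= <<B>>)%MS by rewrite genmxE.
exists (in_submod <<B>>%MS B).
- by rewrite genmxE; apply/esym/eqP.
- rewrite -row_leq_rank mxrank_in_submod //.
  by rewrite (eqP fB).
- by move=> g Gg; rewrite -in_submodJ // -hB // [in LHS]in_submodE [RHS]in_submodE mulmxA.
Qed.

(** An isomorphism of submodules of the ambient module becomes a matrix: [f] carries the rows of [N]
    into the span of [B], and [Y] holds their coordinates there. *)
Lemma rowspace_simple_iso n m (r1 : mx_representation E G n) (r2 : mx_representation E G m)
    d (A : mx_representation E G d) (N : 'M_(d, m)) (B : 'M_(n, m)) :
  row_free N -> (forall g, g \in G -> A g *m N = N *m r2 g) ->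
  row_free B -> (forall g, g \in G -> r1 g *m B = B *m r2 g) ->
  mx_iso r2 <<N>>%MS <<B>>%MS ->
  exists Y : 'M_(d, n), [/\ d = n, row_free Y & forall g, g \in G -> A g *m Y = Y *m r1 g].
Proof.
move=> fN hN fB hB [f uf homf Nf].
have Nf' : (N *m f :=: B)%MS.
  apply: eqmx_trans (genmxE B); apply: eqmx_trans Nf.
  by apply: eqmxMr; apply: eqmx_sym; exact: genmxE.
have /submxP [Y EY] : (N *m f <= B)%MS by rewrite Nf'.
have fNf : row_free (N *m f) by rewrite /row_free mxrankMfree ?row_free_unit.
have dn : d = n by move: (eqP fNf); rewrite Nf' (eqP fB).
exists Y; split=> //.
  by rewrite /row_free -(mxrankMfree Y fB) -EY.
move=> g Gg; apply: (row_free_inj fB).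
rewrite -!mulmxA -EY hB // [RHS]mulmxA -EY [LHS]mulmxA hN //.
apply: (hom_mxP _ _ Gg); apply: submx_trans homf; by rewrite genmxE.
Qed.

End SimpleImage.

Lemma conj_subg_repr (R : fieldType) (gT : finGroupType) (G H : {group gT}) (x : gT) n
    (A : mx_representation R H n) :
  (H <| G)%g -> x \in G ->
  exists Ax : mx_representation R H n, forall h, Ax h = A (x * h * x^-1)%g.
Proof.
move=> nHG Gx; have nH h : h \in H -> (x * h * x^-1)%g \in H.
  by move=> Hh; rewrite -[(x * h * _)%g]mulgA -{1}[x]invgK -conjgE memJ_norm // groupV (subsetP (normal_norm nHG)).
have r : mx_repr H (fun h => A (x * h * x^-1)%g).
  split=> [|a b Ha Hb]; first by rewrite mulg1 mulgV repr_mx1.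
  rewrite -repr_mxM ?nH //; congr (A _).
  by rewrite !mulgA mulgKV.
by exists (MxRepresentation r).
Qed.

Section Clifford.
Variables (k : finFieldType) (E : closedFieldType) (n : nat).
Variable rG : mx_representation E (GL2 k) n.
Hypothesis irr : mx_irreducible rG.
Variable gam : k.
Hypotheses (gam0 : gam != 0) (gamP : forall x, x != 0 -> exists i, x = gam ^+ i).

Let rS := subg_repr rG (normal_sub (SL2_normal k)).
Local Notation X := (rG (gd gam 1)).

Lemma central_scalar (a : k) : a != 0 -> exists c, rG (gd a a) = c%:M.
Proof.
move=> a0; apply: (closed_Schur irr) => g _; rewrite -!GL2_reprM; congr (rG _).
apply: GLval_inj; rewrite !GL_MxE glval ?mulr0 ?subr0 ?mulf_neq0 //.
have -> : mx2 a 0 0 a = a%:M.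
  by apply/matrixP => i j; rewrite !mxE; case: i => [[|[|]]] //; case: j => [[|[|]]].
by rewrite scalar_mxC.
Qed.

(** Write the determinant of [g] as [gam ^+ j] with [j] equal to [b] plus twice [i]. Then [g] is the
    scalar matrix of [gam ^+ i], times an element of [SL2], times [gd gam 1] if [b] holds. Scalar
    matrices act by scalars, so only two translates of [M] occur. *)
Lemma SL2_coset (M : 'M_n) g : mxmodule rS M ->
  (M *m rG g <= M)%MS \/ (M *m rG g <= M *m X)%MS.
Proof.
move=> /mxmoduleP modM; have := GL_det2 g; set dt := (X in X != 0) => d0.
have Edt : dt = \det (GLval g) by rewrite det_mx2.
have [j Ej] := gamP d0; pose i := j./2; pose b := odd j.
have g1 : gam ^+ i != 0 by rewrite expf_neq0.
pose x : {'GL_2[k]} := if b then gd gam 1 else 1%g.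
pose s := ((gd (gam ^+ i)%R (gam ^+ i)%R)^-1 * g * x^-1)%g.
have detx : \det (GLval x) = gam ^+ b.
  rewrite /x; case: (b); last by rewrite GL_1E det1.
  by rewrite glval ?mulr0 ?subr0 ?mulr1 // det_mx2 !mxE /= mulr0 subr0 mulr1.
have Ss : s \in SL2 k.
  rewrite inE !GL_MxE !GL_VxE !det_mulmx !det_inv detx -Edt Ej.
  rewrite glval ?mulr0 ?subr0 ?mulf_neq0 // det_mx2 !mxE /= mulr0 subr0 -exprD addnn.
  rewrite -(odd_double_half j) -/b -/i exprD; apply/eqP; field.
  by rewrite !expf_neq0.
have Eg : g = (gd (gam ^+ i)%R (gam ^+ i)%R * s * x)%g by rewrite /s !mulgA mulgV mul1g mulgKV.
clearbody s. have [c Ec] := central_scalar g1.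
have sub : (M *m rG g <= M *m rG x)%MS.
  rewrite Eg !GL2_reprM Ec !mulmxA submxMr //.
  by rewrite mul_mx_scalar -scalemxAl scalemx_sub // modM.
have [Ex | Ex] : x = gd gam 1 \/ x = 1%g by rewrite /x; case: (b); [left | right].
  by right; rewrite -Ex.
by left; rewrite Ex GL2_repr1 mulmx1 in sub.
Qed.

Lemma Clifford_sum (M : 'M_n) : mxmodule rS M -> M != 0 -> (M + M *m X :=: 1%:M)%MS.
Proof.
move=> modM M0; apply/eqmxP; rewrite submx1 /=.
have [_ h] := (mx_irrP rG).1 irr; rewrite sub1mx h //.
  apply/mxmoduleP => g _; rewrite addsmxMr addsmx_sub.
  have aux y : (M *m rG y <= M + M *m X)%MS.
    case: (SL2_coset y modM) => sub; first exact: submx_trans sub (addsmxSl _ _).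
    exact: submx_trans sub (addsmxSr _ _).
  by rewrite aux -mulmxA -GL2_reprM aux.
apply: contraNneq M0 => e; rewrite -submx0 -e; exact: addsmxSl.
Qed.

(** By minimality [M] either meets [M *m X] in 0 or lies inside it; in the latter case their sum,
    which is everything by [Clifford_sum], has the rank of [M]. *)
Lemma Clifford_dichotomy (M : 'M_n) : mxsimple rS M ->
  \rank M = n \/ (\rank M + \rank M = n)%N /\ (M :&: M *m X = 0)%MS.
Proof.
move=> sM; have [modM M0 minM] := sM.
have S1 := Clifford_sum modM M0.
have modX : mxmodule rS (M *m X).
  exact: (mxsimple_module (Clifford_simple sM (GL2_mem _))).
have rX : \rank (M *m X) = \rank M by rewrite mxrankMfree ?repr_mx_free ?GL2_mem.
have [I0 | I0] := eqVneq (M :&: M *m X)%MS 0.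
  by right; split=> //; rewrite -{2}rX -mxrank_sum_cap I0 mxrank0 addn0 S1 mxrank1.
left; have sub : (M <= M *m X)%MS.
  apply: submx_trans (capmxSr M _).
  by apply: minM => //; [exact: capmx_module | exact: capmxSl].
have : \rank (M + M *m X)%MS = n by rewrite S1 mxrank1.
by rewrite (addsmx_idPr sub) rX.
Qed.

Lemma SL2_length2 : ~ mx_irreducible rS -> mx_length rS 2.
Proof.
move=> red; have [_ nz1 _] := irr.
have [M sM _] := classicallyP (mxsimple_exists (mxmodule1 rS) nz1).
have [modM M0 minM] := sM.
have S1 := Clifford_sum modM M0.
case: (Clifford_dichotomy sM) => [rM | [rM I0]].
  case: red; have M1 : (M :=: 1%:M)%MS.
    by apply/eqmxP; rewrite submx1 sub1mx /row_full rM eqxx.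
  split; [exact: mxmodule1 | exact: nz1 | move=> U modU _ U0].
  by rewrite -M1; apply: minM => //; rewrite M1 submx1.
have sMX := Clifford_simple sM (GL2_mem (gd gam 1)); have [modX X0 minX] := sMX.
have rX : \rank (M *m X) = \rank M by rewrite mxrankMfree ?repr_mx_free ?GL2_mem.
have rM0 : (0 < \rank M)%N by rewrite lt0n mxrank_eq0.
exists [:: M; 1%:M]; split=> //; split; last exact/eqmxP.
split; first by rewrite /mx_subseries /= modM mxmodule1.
case=> [|[|//]] _ /=.
  split=> [|W [modW]]; first by rewrite lt0mx.
  rewrite lt0mx => W0 /andP [WM]; apply/negP; rewrite negbK; exact: minM.
(* A submodule strictly above [M] meets the simple module [M *m X] by a dimension count, so it
   contains it and is everything. *)
split=> [|W [modW MW W1]].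
  by rewrite ltmxErank submx1 mxrank1 /=; move: rM rM0; lia.
have := mxrank_sum_cap W (M *m X).
have -> : \rank (W + M *m X) = n.
  apply/eqP; rewrite -[_ == _]/(row_full _) -sub1mx -S1 addsmxS //; exact: ltmxW.
rewrite rX; move: MW; rewrite ltmxErank => /andP [sMW rMW] eqr.
have nI : (W :&: M *m X)%MS != 0.
  by rewrite -mxrank_eq0 -lt0n; move: eqr rMW rM; clear; lia.
have sXW : (M *m X <= W)%MS.
  apply: submx_trans (capmxSl W (M *m X)).
  by apply: minX => //; [exact: capmx_module | exact: capmxSr].
by move: W1; rewrite /ltmx submx1 -S1 addsmx_sub sMW sXW.
Qed.

End Clifford.

Lemma half_rank a b r : (a <= b)%N -> (b + b = r)%N -> (0 < b)%N ->
  a = r \/ (a + a = r)%N -> a = b.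
Proof. lia. Qed.

Section Restriction.
Variables (F : fieldType) (gT : finGroupType) (G H : {group gT}).
Hypothesis nHG : (H <| G)%g.
Let sHG := normal_sub nHG.

(** Frobenius reciprocity by hand: row [i] of [B] is a matrix coefficient of [tau] evaluated at
    inverses, extended by zero from [H] to [G]. *)
Lemma irr_embeds_regular n (tau : mx_representation F H n) :
  mx_irreducible tau ->
  exists B : 'M_(n, #|G|), row_free B /\
    forall h, h \in H -> tau h *m B = B *m subg_repr (regular_repr F G) sHG h.
Proof.
move=> irr; have [n0 _] := (mx_irrP tau).1 irr; pose i0 := Ordinal n0.
pose B : 'M_(n, #|G|) := \matrix_(i, j)
  if (enum_val j : gT) \in H then tau (enum_val j : gT)^-1%g i i0 else 0.
have hB h : h \in H -> tau h *m B = B *m subg_repr (regular_repr F G) sHG h.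
  move=> Hh; have Gh : h \in G by exact: (subsetP sHG).
  apply/matrixP => i j; rewrite !mxE.
  have Gj : enum_val j \in G := enum_valP j.
  have Gjh : (enum_val j * h^-1)%g \in G by rewrite groupM // groupV.
  pose j' := gring_index G (enum_val j * h^-1)%g.
  have vj' : enum_val j' = (enum_val j * h^-1)%g by rewrite /j' gring_indexK.
  rewrite [RHS](bigD1 j') //= [X in _ + X]big1 ?addr0 => [|a aj]; last first.
    rewrite !mxE eqxx /=; case: eqP => [e | _]; rewrite ?mulr0 //=.
    case/eqP: aj; apply: enum_val_inj; rewrite vj' e.
    by rewrite gring_indexK ?groupM ?enum_valP // mulgK.
  rewrite !mxE vj' mulgKV gring_valK !eqxx mulr1 groupMr ?groupV //.
  case: ifP => Hj; last by rewrite big1 // => a _; rewrite !mxE Hj mulr0.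
  rewrite invMg invgK repr_mxM ?groupV // mxE.
  by apply: eq_bigr => a _; rewrite !mxE Hj.
exists B; split=> //; apply: irr_hom_free irr _ hB.
apply/eqP => /matrixP/(_ i0 (gring_index G 1)); rewrite !mxE gring_indexK ?group1 //.
by rewrite invg1 repr_mx1 mxE eqxx => /eqP; rewrite oner_eq0.
Qed.

(* [tau] sits in the restriction of the regular representation of [G]; the
   [G]-submodule generated by it is a sum of [H]-conjugates of [tau], so any
   simple [G]-submodule of it contains one of them, hence [tau] itself. *)
Lemma irr_sub_restriction n (tau : mx_representation F H n) :
  mx_irreducible tau ->
  exists r (sigma : mx_representation F G r) (B : 'M_(n, r)),
    [/\ mx_irreducible sigma, row_free B &
        forall h, h \in H -> tau h *m B = B *m sigma h].
Proof.
move=> irr; have [B [fB hB]] := irr_embeds_regular irr.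
set aG := regular_repr F G in hB; set aH := subg_repr aG sHG in hB.
pose M0 := <<B>>%MS.
have sM0 : mxsimple aH M0 by exact: hom_image_simple irr fB hB.
have [modM0 M00 _] := sM0.
pose V := (\sum_(x in G) M0 *m aG x)%MS.
have modV : mxmodule aG V.
  apply/mxmoduleP => y Gy; rewrite sumsmxMr; apply/sumsmx_subP => x Gx.
  by rewrite -mulmxA -repr_mxM // (sumsmx_sup (x * y)%g) ?groupM.
have V0 : V != 0.
  apply: contraNneq M00 => e; rewrite -submx0 -e (sumsmx_sup 1%g) //.
  by rewrite repr_mx1 mulmx1.
have [N sN NV] := classicallyP (mxsimple_exists modV V0).
have [modN N0 _] := sN.
have modNH : mxmodule aH N by exact: mxmodule_subg.
have [M1 sM1 M1N] := classicallyP (mxsimple_exists modNH N0).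
have [x Gx isoM] : {x | x \in G & mx_iso aH (M0 *m aG x) M1}.
  apply: (hom_mxsemisimple_iso (f := 1%:M) sM1).
  - by move=> x Gx _; apply: (Clifford_simple sM0).
  - by apply: scalar_mx_hom.
  - by rewrite mulmx1; apply: submx_trans NV.
(* Translating [M1] back by the inverse of [x] gives a copy of [M0], still inside [N] because [N] is
   stable under all of [G]. *)
have := Clifford_iso2 isoM (groupVr Gx); rewrite -/aH.
rewrite -mulmxA -repr_mxM ?groupV // mulgV repr_mx1 mulmx1 => -[f uf homf Mf].
have sub : (B *m f <= N)%MS.
  apply: (submx_trans (B := M1 *m aG x^-1%g)).
    by rewrite -Mf submxMr // genmxE.
  apply: submx_trans (mxmoduleP modN _ (groupVr Gx)); exact: submxMr.
exists (\rank N), (submod_repr modN), (in_submod N (B *m f)); split.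
- exact/submod_mx_irr.
- rewrite -row_leq_rank mxrank_in_submod // mxrankMfree ?row_free_unit //.
  by rewrite (eqP fB).
- move=> h Hh; rewrite -in_submodJ // [X in _ = in_submod N X](_ : _ = tau h *m (B *m f)).
    by rewrite [in LHS]in_submodE [RHS]in_submodE mulmxA.
  rewrite mulmxA hB //; apply/esym; apply: (hom_mxP _ _ Hh).
  by apply: submx_trans homf; rewrite genmxE.
Qed.

End Restriction.

Lemma normal_conjV (gT : finGroupType) (G H : {group gT}) x s :
  (H <| G)%g -> x \in G -> s \in H -> (x * s * x^-1)%g \in H.
Proof.
move=> nHG Gx Hs; rewrite -[(x * s * _)%g]mulgA -{1}[x]invgK -conjgE.
by rewrite memJ_norm // groupV (subsetP (normal_norm nHG)).
Qed.

(** * From integral lifts on [GL2] to both assertions *)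

Section FromCore.
Variables (k : finFieldType) (K F : closedFieldType) (O : {pred K}) (red : K -> F).
Hypothesis RD : residue_data O red.

Let sS := normal_sub (SL2_normal k).

Hypothesis core : forall m (sigma : mx_representation F (GL2 k) m),
  mx_irreducible sigma ->
  exists n (st : mx_representation K (GL2 k) n), lifts O red st sigma /\
    (~ mx_irreducible (subg_repr sigma sS) -> ~ mx_irreducible (subg_repr st sS)).

(** A proper nonzero submodule over [K] would reduce, through its saturated lattice, to a submodule
    of [sigma] of the same rank. *)
Lemma lift_irr gT (H : {group gT}) n (st : mx_representation K H n)
    m (sigma : mx_representation F H m) :
  lifts O red st sigma -> mx_irreducible sigma -> mx_irreducible st.
Proof.
case=> Ost [B [nm fB hB]] irr; have [m0 irr'] := (mx_irrP sigma).1 irr.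
apply/mx_irrP; split=> [|U modU U0]; first by rewrite nm.
have modN g : g \in H -> (row_base U *m st g <= row_base U)%MS.
  by move=> Hg; rewrite eq_row_base (submx_trans _ (mxmoduleP modU g Hg)) // submxMr ?eq_row_base.
have [A [N2 [_ fN2 hN2]]] := lattice_submodule RD Ost (row_base_free U) modN.
have fC : row_free (N2 *m B) by rewrite /row_free mxrankMfree.
have hC g : g \in H -> map_mx red (A g) *m (N2 *m B) = N2 *m B *m sigma g.
  by move=> Hg; rewrite mulmxA hN2 // -!mulmxA hB.
have modC : mxmodule sigma <<N2 *m B>>%MS.
  rewrite (eqmx_module _ (genmxE _)); apply/mxmoduleP => g Hg.
  by rewrite -hC // submxMl.
have rC : \rank <<N2 *m B>>%MS = \rank U by rewrite genmxE (eqP fC).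
have := irr' _ modC; rewrite -mxrank_eq0 rC mxrank_eq0 => /(_ U0).
by rewrite /row_full rC => /eqP ->; apply/eqP; rewrite nm.
Qed.

(** Both restrictions have length 1 or 2. Irreducibility of the restriction passes from [sigma] to
    [st] by [lift_irr], and reducibility by [core]. *)
Lemma GL2_part m (sigma : mx_representation F (GL2 k) m) :
  mx_irreducible sigma ->
  exists n (st : mx_representation K (GL2 k) n),
    is_reduction O red st sigma /\
    exists len : nat,
      mx_length (subg_repr st (SL2_sub_GL2 k)) len /\
      mx_length (subg_repr sigma (SL2_sub_GL2 k)) len.
Proof.
move=> irr; have [n [st [lf red_st]]] := core irr; exists n, st.
split; first exact: lifts_is_reduction.
have irr_st := lift_irr lf irr.
rewrite (bool_irrelevance (SL2_sub_GL2 k) sS).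
have [gam g0 gP] := finField_generator k.
case: (classic (mx_irreducible (subg_repr sigma sS))) => [irrS | redS].
  exists 1%N; split; apply: mx_length1 => //; apply: lift_irr irrS.
  case: lf => Ost [B [nm fB hB]]; split=> [g Sg|]; first exact: Ost (GL2_mem g).
  by exists B; split=> // g Sg; apply: hB; rewrite GL2_mem.
exists 2%N; split; first exact: (SL2_length2 irr_st g0 gP (red_st redS)).
exact: (SL2_length2 irr g0 gP redS).
Qed.

Lemma SL2_part n (tau : mx_representation F (SL2 k) n) :
  mx_irreducible tau ->
  exists m (st : mx_representation K (SL2 k) m), is_reduction O red st tau.
Proof.
move=> irr; suff [m [st lf]] : exists m (st : mx_representation K (SL2 k) m), lifts O red st tau.
  by exists m, st; exact: lifts_is_reduction.
have [m [sigma [B [irrs fB hB]]]] := irr_sub_restriction (SL2_normal k) irr.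
have [r [st [lf red_st]]] := core irrs.
have irr_st := lift_irr lf irrs; case: lf => Ost [C [rm fC hC]].
(* The embedding of [tau] is moved from [sigma] to the literal reduction [sg] of [st], where it can
   be compared with reductions of [K]-submodules. *)
pose sg := red_repr RD Ost.
have sim : mx_rsim sg sigma by exists C.
have irrg : mx_irreducible sg by apply: mx_rsim_irr irrs; exact: mx_rsim_sym.
have [D [D' D'D sgD]] := mx_rsim_def (mx_rsim_sym sim).
have [B1 fB1 hB1] : exists2 B1 : 'M_(n, r), row_free B1 &
    forall s, s \in SL2 k -> tau s *m B1 = B1 *m subg_repr sg sS s.
  have hD g : sigma g *m D = D *m sg g.
    by rewrite sgD ?GL2_mem // -!mulmxA D'D mulmx1.
  exists (B *m D); last first.
    by move=> s Ss; rewrite mulmxA hB // -!mulmxA hD.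
  rewrite /row_free mxrankMfree //; apply/row_freeP; exists D'.
  move: D'D; move: (D) (D'); rewrite rm => P P'; exact: mulmx1C.
have OstS g : g \in SL2 k -> Omx O (subg_repr st sS g).
  by move=> _; exact: (Ost g (GL2_mem g)).
have finish d (A : mx_representation K (SL2 k) d) (N : 'M_(d, r)) :
    (forall g, g \in SL2 k -> Omx O (A g)) -> row_free N ->
    (forall g, g \in SL2 k -> map_mx red (A g) *m N = N *m subg_repr sg sS g) ->
    mx_iso (subg_repr sg sS) <<N>>%MS <<B1>>%MS ->
    exists m (st : mx_representation K (SL2 k) m), lifts O red st tau.
  move=> OA fN hN iso; exists d, A; split=> //.
  have [Y [dn fY hY]] := @rowspace_simple_iso _ _ _ _ _ _ _ _ (red_repr RD OA) _ _ fN hN fB1 hB1 iso.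
  by exists Y.
have [gam g0 gP] := finField_generator k.
have sB1 := hom_image_simple irr fB1 hB1.
case: (classic (mx_irreducible (subg_repr st sS))) => [irrS | redS].
  have irrgS : mx_irreducible (subg_repr sg sS).
    apply: NNPP => nirr; apply: (red_st _ irrS) => irr'; apply: nirr.
    apply: mx_rsim_irr irr'; case: (mx_rsim_sym sim) => P e fP hP.
    by exists P => // s Ss; apply: hP; rewrite GL2_mem.
  apply: (finish r (subg_repr st sS) 1%:M) => //.
  - by rewrite row_free_unit unitmx1.
  - by move=> g _; rewrite mulmx1 mul1mx.
  apply: eqmx_iso; apply: eqmx_trans (genmxE _) _; apply: eqmx_sym.
  have [_ nB1 _] := sB1; have [modB1 _ _] := sB1.
  by apply/eqmxP; rewrite submx1 sub1mx ((mx_irrP _).1 irrgS).2.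
have [_ nz1 _] := irr_st.
have [N sN _] := classicallyP (mxsimple_exists (mxmodule1 (subg_repr st sS)) nz1).
have [modN N0 _] := sN.
case: (Clifford_dichotomy irr_st g0 gP sN) => [rN | [rN _]].
  case: redS; have N1 : (N :=: 1%:M)%MS.
    by apply/eqmxP; rewrite submx1 sub1mx /row_full rN eqxx.
  have [_ _ minN] := sN.
  split; [exact: mxmodule1 | exact: nz1 | move=> U modU _ U0].
  by rewrite -N1; apply: minN => //; rewrite N1 submx1.
have rN0 : (0 < \rank N)%N by rewrite lt0n mxrank_eq0.
have modNb g : g \in SL2 k -> (row_base N *m subg_repr st sS g <= row_base N)%MS.
  by move=> Hg; rewrite eq_row_base (submx_trans _ (mxmoduleP modN g Hg)) // submxMr ?eq_row_base.
have [A [N2 [OA fN2 hN2]]] := lattice_submodule RD OstS (row_base_free N) modNb.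
have modN2 : mxmodule (subg_repr sg sS) <<N2>>%MS.
  rewrite (eqmx_module _ (genmxE _)); apply/mxmoduleP => g Hg.
  by rewrite /= -hN2 // submxMl.
have rN2 : \rank <<N2>>%MS = \rank N by rewrite genmxE (eqP fN2).
have nzN2 : <<N2>>%MS != 0 by rewrite -mxrank_eq0 rN2 -lt0n.
(* [N2] has half the dimension. By the dichotomy for [sg] a simple submodule has full or half
   dimension, so one inside [N2] must be [N2]. *)
have sN2 : mxsimple (subg_repr sg sS) <<N2>>%MS.
  have [N3 sN3 N32] := classicallyP (mxsimple_exists modN2 nzN2).
  have r3 : (\rank N3 <= \rank <<N2>>%MS)%N by exact: mxrankS.
  have e3 : (N3 :=: <<N2>>)%MS.
    apply/eqmxP; rewrite -(geq_leqif (mxrank_leqif_eq N32)).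
    have D3 := Clifford_dichotomy irrg g0 gP sN3.
    have D3' : \rank N3 = r \/ (\rank N3 + \rank N3 = r)%N by case: D3 => [|[]]; [left | right].
    by rewrite rN2 in r3 *; rewrite (half_rank r3 rN rN0 D3').
  split=> // U modU UN U0; rewrite -e3; have [_ _ min3] := sN3.
  by apply: min3 => //; rewrite e3.
have S1 := Clifford_sum irrg g0 gP modN2 nzN2.
pose X (b : bool) := sg (if b then gd gam 1 else 1%g).
have GX b : (if b then gd gam 1 else 1%g) \in GL2 k by exact: GL2_mem.
(* The two translates of [N2] are simple and span everything, so the copy [B1] of [tau] is
   isomorphic to one of them. *)
have [b _ isoB] : {b | true & mx_iso (subg_repr sg sS) (<<N2>>%MS *m X b) <<B1>>%MS}.
  apply: (hom_mxsemisimple_iso (P := xpredT) (f := 1%:M) sB1).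
  - by move=> b _ _; apply: (Clifford_simple sN2).
  - by apply: scalar_mx_hom.
  - have e1 : X false = 1%:M by exact: (GL2_repr1 sg).
    rewrite mulmx1 big_bool /= e1 (submx_trans (submx1 _)) // -S1 addsmx_sub.
    by rewrite addsmxSl andbT -[X in (X <= _)%MS]mulmx1 addsmxSr.
(* If [tau] is the translate by [x], its lift is [A] twisted by conjugation with [x], which is again
   integral. *)
have [Ax EAx] := conj_subg_repr A (SL2_normal k) (GX b).
set x := if b then _ else _ in EAx GX.
have nS s : s \in SL2 k -> (x * s * x^-1)%g \in SL2 k.
  exact: (normal_conjV (SL2_normal k) (GL2_mem x)).
apply: (finish _ Ax (N2 *m sg x)).
- by move=> g Sg; rewrite EAx; apply: OA; exact: nS.
- by rewrite /row_free mxrankMfree ?repr_mx_free ?GL2_mem.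
- move=> g Sg; rewrite EAx mulmxA hN2 ?nS // -!mulmxA; congr (_ *m _).
  rewrite -[map_mx red _]/(sg _) -!GL2_reprM.
  by rewrite mulgKV.
- apply: mx_iso_trans isoB; apply: eqmx_iso.
  apply: eqmx_trans (genmxE _) _; apply: eqmxMr; apply: eqmx_sym; exact: genmxE.
Qed.

End FromCore.

(** * Characters and Bessel sums *)

(** A total function on the field whose value at 0 is left free. *)
Definition multiplicative_char (k R : fieldType) (chi : k -> R) :=
  chi 1 = 1 /\ forall x y, x != 0 -> y != 0 -> chi (x * y) = chi x * chi y.

Definition additive_char (k R : fieldType) (psi : k -> R) :=
  [/\ psi 0 = 1, forall x y, psi (x + y) = psi x * psi y & exists x, psi x != 1].

Section MulChar.
Variables (k R : fieldType) (chi : k -> R).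
Hypothesis mc : multiplicative_char chi.

Lemma mchar1 : chi 1 = 1. Proof. by case: mc. Qed.
Lemma mcharM x y : x != 0 -> y != 0 -> chi (x * y) = chi x * chi y.
Proof. by case: mc => _; apply. Qed.
Lemma mchar_neq0 x : x != 0 -> chi x != 0.
Proof.
move=> x0; have : chi x * chi x^-1 = 1 by rewrite -mcharM ?invr_eq0 // mulfV ?mchar1.
by apply: contra_eq_neq => ->; rewrite mul0r eq_sym oner_eq0.
Qed.
Lemma mcharV x : x != 0 -> chi x^-1 = (chi x)^-1.
Proof.
move=> x0; apply: (mulfI (mchar_neq0 x0)).
by rewrite -mcharM ?invr_eq0 // !mulfV ?mchar_neq0 // mchar1.
Qed.
Lemma mcharX x i : x != 0 -> chi (x ^+ i) = chi x ^+ i.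
Proof.
move=> x0; elim: i => [|i IH]; first by rewrite !expr0 mchar1.
by rewrite !exprS mcharM ?expf_neq0 // IH.
Qed.
End MulChar.

Section FinChar.
Variable k : finFieldType.

Lemma expf_card1 (x : k) : x != 0 -> x ^+ #|k|.-1 = 1.
Proof.
move=> x0; apply: (mulfI x0); rewrite -exprS prednK ?expf_card ?mulr1 //.
by rewrite (leq_trans _ (finNzRing_gt1 k)).
Qed.

Lemma generator_primitive (g : k) : g != 0 ->
  (forall x, x != 0 -> exists i, x = g ^+ i) -> #|k|.-1.-primitive_root g.
Proof.
move=> g0 gP; have N0 : (0 < #|k|.-1)%N by move: (finNzRing_gt1 k); case: (#|k|) => [|[|]].
have [m pm dm] := prim_order_exists N0 (expf_card1 g0).
suff le : (#|k|.-1 <= m)%N.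
  have -> : #|k|.-1 = m by apply/eqP; rewrite eqn_leq le dvdn_leq.
  exact: pm.
have -> : #|k|.-1 = size (enum (predC1 (0 : k))) by rewrite -cardE cardC1.
have <- : size [seq g ^+ i | i <- iota 0 m] = m by rewrite size_map size_iota.
apply: uniq_leq_size; first exact: enum_uniq.
move=> x; rewrite mem_enum inE => /gP [i ->]; rewrite -(prim_expr_mod pm).
apply/mapP; exists (i %% m)%N => //.
by rewrite mem_iota add0n ltn_mod (prim_order_gt0 pm).
Qed.

Lemma mul_char_exists (R : fieldType) (g : k) (z : R) : g != 0 ->
  (forall x, x != 0 -> exists i, x = g ^+ i) -> z ^+ #|k|.-1 = 1 ->
  exists chi : k -> R, multiplicative_char chi /\ forall i, chi (g ^+ i) = z ^+ i.
Proof.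
move=> g0 gP zN; have pg := generator_primitive g0 gP.
pose chi (x : k) : R := if [pick i : 'I_(#|k|.-1) | g ^+ i == x] is Some i then z ^+ i else 0.
have chiE i : chi (g ^+ i) = z ^+ i.
  rewrite /chi; case: pickP => [j | no].
    rewrite (eq_prim_root_expr pg) => /eqP e.
    by rewrite -(expr_mod i zN) -(expr_mod j zN) e.
  have lt : (i %% #|k|.-1 < #|k|.-1)%N by rewrite ltn_mod (prim_order_gt0 pg).
  by have := no (Ordinal lt); rewrite /= (prim_expr_mod pg) eqxx.
exists chi; split=> //; split=> [|x y /gP [i ->] /gP [j ->]].
  by rewrite -(expr0 g) chiE expr0.
by rewrite -exprD !chiE exprD.
Qed.

Lemma mul_char_gen (R : fieldType) (g : k) (chi : k -> R) : g != 0 -> multiplicative_char chi ->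
  chi g ^+ #|k|.-1 = 1.
Proof. by move=> g0 mc; rewrite -mcharX // expf_card1 // mchar1. Qed.

Lemma additive_functional p : p \in [pchar k] ->
  exists f : k -> 'F_p, (forall x y, f (x + y) = f x + f y) /\ exists x, f x != 0.
Proof.
move=> pk; pose V := pPrimeCharType pk.
pose b := vbasis (fullv : {vspace V}).
have x1 : (1 : V) \in (fullv : {vspace V}) by exact: memvf.
case: (pickP (fun i => coord b i (1 : V) != 0)) => [i ci | no].
  exists (coord b i); split; last by exists 1.
  by move=> x y; exact: (raddfD (coord b i)).
have : (1 : V) == 0.
  by rewrite (coord_vbasis x1) big1 // => i _; have /negbFE/eqP -> := no i; rewrite scale0r.
by move=> e; have := oner_neq0 k; rewrite e.
Qed.

(** The exponent function is chosen before the field [R], so the additive characters into [K] and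
    into [F] use the same exponents and correspond under reduction. *)
Lemma additive_exponent p : p \in [pchar k] ->
  exists f : k -> nat, forall (R : fieldType) (e : R), e ^+ p = 1 -> e != 1 ->
    additive_char (fun x => e ^+ f x).
Proof.
move=> pk; have p_pr := pcharf_prime pk.
have [f [fD [x0 fx0]]] := additive_functional pk.
have f0 : f 0 = 0 by apply: (addrI (f 0)); rewrite -fD !addr0.
exists (fun x => f x : nat) => R e ep e1.
have eqN (a : 'F_p) : (a < p)%N by rewrite -[X in (_ < X)%N](Fp_cast p_pr) ltn_ord.
split; first by rewrite f0 expr0.
  move=> x y; rewrite fD -exprD -[RHS](expr_mod _ ep).
  by congr (e ^+ (_ %% _)); exact: Fp_cast.
exists x0; have : coprime (f x0) p.
  by rewrite coprime_sym prime_coprime // gtnNdvd // lt0n; apply: contra fx0 => /eqP e'; apply/eqP/val_inj.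
move=> co; apply: contra_neq e1 => e1.
have [a _] := Bezoutl (f x0) (prime_gt0 p_pr).
rewrite gcdnC (eqP co) => /dvdnP [b Eb].
have : e ^+ (1 + a * f x0) = 1 by rewrite Eb mulnC exprM ep expr1n.
by rewrite exprD mulnC exprM e1 expr1n mulr1 expr1.
Qed.

End FinChar.

Section AddCharSums.
Variables (k : finFieldType) (R : fieldType) (psi : k -> R).
Hypothesis ac : additive_char psi.

Lemma achar0 : psi 0 = 1. Proof. by case: ac. Qed.
Lemma acharD x y : psi (x + y) = psi x * psi y. Proof. by case: ac => _ h _; exact: h. Qed.
Lemma sum_additive_char (V : finZmodType) (f : V -> k) :
  (forall x y, f (x + y) = f x + f y) -> (forall a, exists x, f x = a) ->
  \sum_x psi (f x) = 0.
Proof.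
move=> fD fS; have [_ _ [a a1]] := ac; have [v Ev] := fS a.
set s := \sum_x _; have : psi a * s = s.
  rewrite /s mulr_sumr [RHS](reindex_inj (addrI v)); apply: eq_bigr => x _.
  by rewrite fD acharD Ev.
move/eqP; rewrite -subr_eq0 -{2}[s]mul1r -mulrBl mulf_eq0 subr_eq0 (negPf a1).
by move/eqP.
Qed.

Lemma sum_achar (a : k) : \sum_x psi (a * x) = if a == 0 then (#|k|)%:R else 0.
Proof.
case: eqP => [-> | /eqP a0].
  rewrite (eq_bigr (fun=> 1)) => [|x _]; last by rewrite mul0r achar0.
  by rewrite sumr_const.
apply: (sum_additive_char (f := fun x => a * x)) => [x y | b]; first exact: mulrDr.
by exists (a^-1 * b); rewrite mulVKf.
Qed.

Lemma sum_achar_neq0 (a : k) : a != 0 -> \sum_(x | x != 0) psi (a * x) = -1.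
Proof.
move=> a0; have := sum_achar a; rewrite (negPf a0) (bigD1 0) //= mulr0 achar0 => /eqP.
by rewrite addrC addr_eq0 => /eqP.
Qed.

End AddCharSums.

Section GaussSums.
Variables (k L : finFieldType) (iota : {rmorphism k -> L}).
Hypothesis cardL : #|L| = (#|k| ^ 2)%N.
Variables (R : fieldType) (psi : k -> R) (theta : L -> R).
Hypotheses (ac : additive_char psi) (mc : multiplicative_char theta).
Hypothesis q0 : (#|k|)%:R != 0 :> R.
Local Notation q := ((#|k|)%:R : R).
Local Notation Nm := (Nm iota).
Local Notation Tr := (Tr iota).
Implicit Types (x y z u : k) (t v : L).

Lemma Tr0 : Tr 0 = 0.
Proof. by rewrite -(rmorph0 iota) Tr_iota // addr0. Qed.

(** If the trace vanished identically, its value at 1 would force characteristic 2; conjugation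
    would then be trivial and [L] no larger than [k]. *)
Lemma Tr_surj a : exists t, Tr t = a.
Proof.
case: (pickP (fun t => Tr t != 0)) => [t Tt | no].
  by exists (iota (a / Tr t) * t); rewrite TrZ // divfK.
have h t : t + fconj k t = 0.
  by rewrite -(TrE iota cardL); have /negbFE/eqP -> := no t; rewrite rmorph0.
have h1 : (1 : L) + 1 = 0 by have := h 1; rewrite /fconj expr1n.
have fx t : fconj k t = t.
  by apply: (addrI t); rewrite h -[t + t]mulr2n -mulr_natr -[2%:R]/(1 + 1) h1 mulr0.
have : (#|L| <= #|k|)%N.
  apply: (leq_trans _ (leq_image_card iota k)); apply/subset_leq_card/subsetP => t _.
  have [b ->] := fconj_fix iota (fx t); exact: codom_f.
by rewrite cardL leqNgt -{1}(expn1 #|k|) ltn_exp2l ?finNzRing_gt1.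
Qed.

Lemma sum_achar_Tr (c : L) : \sum_t psi (Tr (t * c)) = if c == 0 then q ^+ 2 else 0.
Proof.
case: eqP => [-> | /eqP c0].
  rewrite (eq_bigr (fun=> 1)) => [|t _].
    by rewrite sumr_const -natrX -cardL.
  by rewrite mulr0 Tr0 achar0.
apply: (sum_additive_char ac (f := fun t => Tr (t * c))) => [t v | a].
  by rewrite mulrDl TrD.
by have [t <-] := Tr_surj a; exists (t / c); rewrite divfK.
Qed.

(** The fibre over 0 contributes 1 and every other norm fibre has [q + 1] points, so the sum is
    [1 - (q + 1)]. *)
Lemma sum_achar_Nm (a : k) : a != 0 -> \sum_t psi (a * Nm t) = - q.
Proof.
move=> a0; rewrite (partition_big Nm xpredT) //= (bigD1 0) //=.
have c0 : \sum_(t | Nm t == 0) psi (a * Nm t) = 1.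
  rewrite (eq_bigr (fun=> 1)) => [|t /eqP ->]; last by rewrite mulr0 achar0.
  by rewrite sumr_const card_Nm0.
rewrite c0 (eq_bigr (fun y => (#|k|.+1)%:R * psi (a * y))) => [|y y0]; last first.
  rewrite (eq_bigr (fun=> psi (a * y))) => [|t /eqP -> //].
  by rewrite sumr_const card_Nm // mulr_natl.
by rewrite -mulr_sumr sum_achar_neq0 // -natr1; ring.
Qed.

Definition central_char x := theta (iota x).
Local Notation omega := central_char.

Lemma central_mul_char : multiplicative_char omega.
Proof.
split; first by rewrite /omega rmorph1 mchar1.
by move=> x y x0 y0; rewrite /omega rmorphM mcharM ?fmorph_eq0.
Qed.

(** The Bessel function attached to [theta]; the factor [- q^-1] is the normalisation for which the
    relations of [W] hold on the nose. *)
Definition Jsum u := - q^-1 * \sum_(t | Nm t == u) psi (Tr t) * theta t.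

(** In characteristic 0 this says that [theta] is nontrivial on the norm one group. In positive
    characteristic the sums can also vanish because [q + 1] does. *)
Hypothesis nontriv : forall u, u != 0 -> \sum_(t | Nm t == u) theta t = 0.

(** For summands at [t] and [t'] the new variable is [v = t * t' / iota y]: this cancels [omega y],
    and the joint sum over [y] and [t] with [Nm t = x * y] makes [t] free. The value [b = 0] serves
    the relation for the square of [W], and [b = 1] the one for [W], [U 1], [W]. *)
Lemma Jsum_conv b x z : x != 0 -> z != 0 ->
  \sum_(y | y != 0) (omega y)^-1 * psi (b * y) * Jsum (x * y) * Jsum (y * z) =
  q^-1 ^+ 2 * \sum_(v | Nm v == x * z)
     theta v * \sum_(t | t != 0) psi ((b * Nm t + Tr (t * fconj k (iota x + v))) / x).
Proof.
move=> x0 z0.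
transitivity (q^-1 ^+ 2 * \sum_(y | y != 0) \sum_(t | Nm t == x * y)
   \sum_(v | Nm v == x * z) theta v * psi ((b * Nm t + Tr (t * fconj k (iota x + v))) / x)).
  rewrite mulr_sumr; apply: eq_bigr => y y0.
  have alg (o p i s1 s2 : R) : o * p * (- i * s1) * (- i * s2) = i ^+ 2 * (s1 * (o * p * s2)).
    by ring.
  rewrite /Jsum alg; congr (_ * _); rewrite mulr_suml.
  apply: eq_bigr => t /eqP Nt; have t0 : t != 0 by rewrite -(Nm_eq0 iota cardL) Nt mulf_neq0.
  have f0 : fconj k t != 0 by rewrite fconj_eq0.
  have ix0 : iota x != 0 by rewrite fmorph_eq0.
  rewrite !mulr_sumr (reindex_onto (fun v => v * fconj k t / iota x)
     (fun v => v * iota x / fconj k t)) => [|v _]; last by field; rewrite ix0 f0.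
  apply: eq_big => [v | v /andP [/eqP Nv _]].
    rewrite !(NmM iota cardL) (NmV iota cardL) (Nm_conj iota cardL) (Nm_iota iota cardL) Nt.
    have -> : v * fconj k t / iota x * iota x / fconj k t = v by field; rewrite ix0 f0.
    rewrite eqxx andbT -[RHS](inj_eq (mulIf (mulf_neq0 y0 (invr_neq0 x0)))) /=.
    by congr (_ == _); field; rewrite x0.
  have v0 : v != 0.
    rewrite -(Nm_eq0 iota cardL); apply: contraTneq (mulf_neq0 y0 z0) => e.
    by rewrite -Nv !(NmM iota cardL) e !mul0r eqxx.
  have Et : t * (v * fconj k t / iota x) = v * iota y.
    have : iota (Nm t) = iota (x * y) by rewrite Nt.
    rewrite NmE // rmorphM => e.
    have -> : t * (v * fconj k t / iota x) = v * (t * fconj k t) / iota x by ring.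
    by rewrite e; field; rewrite ix0.
  have alg2 (o p1 p2 a c d : R) : p1 * a * (o * p2 * (c * d)) = o * p2 * (p1 * a * (c * d)) by ring.
  rewrite alg2.
  have -> : psi (Tr t) * theta t * (psi (Tr (v * fconj k t / iota x)) * theta (v * fconj k t / iota x))
     = psi (Tr t + Tr (v * fconj k t / iota x)) * (theta v * omega y).
    rewrite acharD // -(mcharM mc v0) ?fmorph_eq0 // -Et (mcharM mc t0) ?mulf_neq0 ?invr_eq0 //.
    by ring.
  have om0 : omega y != 0 by apply: (mchar_neq0 mc); rewrite fmorph_eq0.
  have -> : psi ((b * Nm t + Tr (t * fconj k (iota x + v))) / x) =
      psi (b * y) * psi (Tr t + Tr (v * fconj k t / iota x)).
    rewrite -acharD //; congr psi.
    have -> : v * fconj k t / iota x = iota x^-1 * fconj k (t * fconj k v).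
      by rewrite fconjM fconjK // fmorphV; ring.
    rewrite TrZ // Tr_conj // fconjD // fconj_iota // mulrDr TrD // [t * iota x]mulrC TrZ // Nt.
    by field; rewrite x0.
  by field; rewrite om0.
congr (_ * _).
under [RHS]eq_bigr do rewrite mulr_sumr.
rewrite [RHS]exchange_big /= [RHS](partition_big (fun t => Nm t / x) (fun y => y != 0)) /=; last first.
  by move=> t t0; rewrite mulf_neq0 ?invr_eq0 // Nm_eq0.
apply: eq_bigr => y y0; apply: eq_bigl => t.
rewrite -(Nm_eq0 iota cardL); apply/eqP/andP => [-> | [_ /eqP <-]].
  by rewrite mulf_neq0 // mulrC mulKf.
by rewrite mulrC divfK.
Qed.

(** The inner sum is [q ^+ 2] at [v = - iota x], and 0 elsewhere, minus 1. The constant dies by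
    [nontriv], and that [v] has norm [x * z] only when [x = z]. *)
Lemma Jsum_ww x z : x != 0 -> z != 0 ->
  \sum_(y | y != 0) (omega y)^-1 * Jsum (x * y) * Jsum (y * z) =
  if x == z then omega (-1) * omega x else 0.
Proof.
move=> x0 z0; have := Jsum_conv 0 x0 z0.
under eq_bigr do rewrite mul0r achar0 // mulr1.
move=> ->.
have xz : x * z != 0 by rewrite mulf_neq0.
have inner v : \sum_(t | t != 0) psi ((0 * Nm t + Tr (t * fconj k (iota x + v))) / x) =
    (if v == - iota x then q ^+ 2 else 0) - 1.
  pose c := fconj k (iota x + v) / iota x.
  have E t : psi ((0 * Nm t + Tr (t * fconj k (iota x + v))) / x) = psi (Tr (t * c)).
    congr psi; rewrite mul0r add0r mulrC -TrZ //; congr (Tr _).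
    by rewrite /c fmorphV; ring.
  under eq_bigr do rewrite E.
  have := sum_achar_Tr c; rewrite (bigD1 0) //= mul0r Tr0 achar0 // => e; apply: (addrI 1); rewrite e addrC subrK.
  have -> : (c == 0) = (v == - iota x).
    by rewrite /c mulf_eq0 invr_eq0 fmorph_eq0 (negPf x0) orbF fconj_eq0 addrC addr_eq0.
  by [].
under eq_bigr do rewrite inner mulrBr mulr1.
rewrite sumrB nontriv // subr0.
have Nmx : Nm (- iota x) = x * x by rewrite NmN // Nm_iota // expr2.
have [exz | nxz] := eqVneq x z.
  rewrite (bigD1 (- iota x)) /= ?Nmx -?exz // eqxx big1 ?addr0 => [|v /andP [_ nv]]; last first.
    by rewrite (negPf nv) mulr0.
  have -> : theta (- iota x) = omega (-1) * omega x.
    by rewrite /omega -mcharM ?fmorph_eq0 ?oppr_eq0 ?oner_eq0 // -rmorphM mulN1r rmorphN.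
  by field; rewrite q0.
rewrite big1 ?mulr0 // => v /eqP Nv; case: eqP => [ev | _]; last by rewrite mulr0.
by move: Nv nxz; rewrite ev Nmx => /(mulfI x0) ->; rewrite eqxx.
Qed.

(* Completing the norm: [N t + Tr (t b^q) = N (t + b) - N b]. *)
Lemma Jsum_wuw x z : x != 0 -> z != 0 ->
  \sum_(y | y != 0) (omega y)^-1 * psi y * Jsum (x * y) * Jsum (y * z) =
  omega (-1) * psi (- x - z) * Jsum (x * z).
Proof.
move=> x0 z0; have := Jsum_conv 1 x0 z0.
under eq_bigr do rewrite mul1r.
move=> ->.
have xz : x * z != 0 by rewrite mulf_neq0.
have inner v : Nm v = x * z ->
   \sum_(t | t != 0) psi ((1 * Nm t + Tr (t * fconj k (iota x + v))) / x) =
    - q * psi (- x - z) * psi (Tr (- v)) - 1.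
  move=> Nv; have Nb : Nm (iota x + v) = x * (x + z + Tr v).
    by rewrite NmD // Nm_iota // TrZ // Tr_conj // Nv; ring.
  have E t : psi ((1 * Nm t + Tr (t * fconj k (iota x + v))) / x) =
     psi (x^-1 * Nm (t + (iota x + v))) * (psi (- x - z) * psi (Tr (- v))).
    rewrite -!acharD //; congr psi; rewrite NmD // Nb TrN //; by field; rewrite x0.
  under eq_bigr do rewrite E.
  have S : \sum_t psi (x^-1 * Nm (t + (iota x + v))) * (psi (- x - z) * psi (Tr (- v))) =
     - q * psi (- x - z) * psi (Tr (- v)).
    rewrite -mulr_suml -!mulrA; congr (_ * _).
    by rewrite -(sum_achar_Nm (invr_neq0 x0)) [RHS](reindex_inj (addIr (iota x + v))).
  have E0 : psi (x^-1 * Nm (0 + (iota x + v))) * (psi (- x - z) * psi (Tr (- v))) = 1.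
    rewrite -(E 0) (_ : _ / x = 0) ?(achar0 ac) //.
    by rewrite mul0r Tr0 (eqP (_ : Nm 0 == 0)) ?Nm_eq0 //; ring.
  by rewrite -S [X in _ = X - 1](bigD1 0) //= E0 addrC addrK.
under eq_bigr => v /eqP Nv do rewrite inner // mulrBr mulr1.
rewrite sumrB nontriv // subr0 /Jsum [in RHS](reindex_inj oppr_inj) /=.
rewrite !mulr_sumr; apply: eq_big => [v | v /eqP Nv]; first by rewrite NmN.
have v0 : v != 0 by rewrite -(Nm_eq0 iota cardL) Nv.
have -> : theta (- v) = omega (-1) * theta v.
  by rewrite /omega -mcharM ?fmorph_eq0 ?oppr_eq0 ?oner_eq0 // rmorphN rmorph1 mulN1r.
have o1 : omega (-1) * omega (-1) = 1.
  by rewrite /omega -mcharM ?fmorph_eq0 ?oppr_eq0 ?oner_eq0 // rmorphN rmorph1 mulrNN mulr1 mchar1.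
have -> : omega (-1) * psi (- x - z) * (- q^-1 * (psi (Tr (- v)) * (omega (-1) * theta v))) =
  (omega (-1) * omega (-1)) * (psi (- x - z) * (- q^-1 * (psi (Tr (- v)) * theta v))) by ring.
by rewrite o1; field; rewrite q0.
Qed.

End GaussSums.

(** * Representations given by kernel matrices *)

Section KernelMatrices.
Variables (R : fieldType) (I : finType).
Implicit Types (f g : I -> I -> R).

Definition kmx f : 'M[R]_#|I| := \matrix_(i, j) f (enum_val i) (enum_val j).
Definition rows_mx m (v : I -> 'rV[R]_m) : 'M_(#|I|, m) := \matrix_i v (enum_val i).
Definition kvec (x : I) : 'rV[R]_#|I| := delta_mx 0 (enum_rank x).

Lemma sum_enum_val (V : nmodType) (F : I -> V) :
  \sum_(i < #|I|) F (enum_val i) = \sum_x F x.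
Proof. by rewrite [RHS](reindex (@enum_val I I)) //; exact: onW_bij (@enum_val_bij I). Qed.

Lemma kvec_rows m (v : I -> 'rV_m) x : kvec x *m rows_mx v = v x.
Proof. by rewrite -rowE rowK enum_rankK. Qed.

Lemma kvec_kmx f x : kvec x *m kmx f = \sum_y f x y *: kvec y.
Proof.
apply/rowP => j; rewrite -rowE !mxE enum_rankK summxE (bigD1 (enum_val j)) //= !mxE.
rewrite enum_valK !eqxx mulr1 big1 ?addr0 // => y yj; rewrite !mxE eqxx /=.
by rewrite -[j]enum_valK (inj_eq enum_rank_inj) eq_sym (negPf yj) mulr0.
Qed.

Lemma kvec_inj m (A B : 'M[R]_(#|I|, m)) : (forall x, kvec x *m A = kvec x *m B) -> A = B.
Proof.
move=> h; apply/row_matrixP => i; have := h (enum_val i).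
by rewrite /kvec enum_valK -!rowE.
Qed.

(** The family [v] need not be independent, so this also produces the noninjective intertwiners of
    quotients. *)
Lemma kmx_rows m (v : I -> 'rV_m) (A : 'M_m) f :
  (forall x, v x *m A = \sum_y f x y *: v y) -> kmx f *m rows_mx v = rows_mx v *m A.
Proof.
move=> h; apply: kvec_inj => x; rewrite !mulmxA kvec_rows h kvec_kmx mulmx_suml.
by apply: eq_bigr => y _; rewrite -scalemxAl kvec_rows.
Qed.

Lemma mxtrace_kmx f : \tr (kmx f) = \sum_x f x x.
Proof.
by rewrite /mxtrace -(sum_enum_val (fun x => f x x)); apply: eq_bigr => i _; rewrite mxE.
Qed.

Definition mono (c : I -> R) (p : I -> I) := kmx (fun x y => if y == p x then c x else 0).

Lemma kvec_mono c p x : kvec x *m mono c p = c x *: kvec (p x).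
Proof.
rewrite kvec_kmx (bigD1 (p x)) //= eqxx big1 ?addr0 // => y yp.
by rewrite (negPf yp) scale0r.
Qed.

Lemma kvec_neq0 x : kvec x != 0.
Proof.
apply/eqP => /rowP/(_ (enum_rank x)); rewrite !mxE !eqxx => /eqP.
by rewrite oner_eq0.
Qed.

Lemma kvec_coord x y : kvec x 0 (enum_rank y) = (x == y)%:R.
Proof. by rewrite mxE eqxx (inj_eq enum_rank_inj) eq_sym. Qed.

End KernelMatrices.

Arguments kvec {R I}.

Section KernelReduction.
Variables (K F : fieldType) (O : {pred K}) (red : K -> F).
Hypothesis RD : residue_data O red.
Variable I : finType.

Lemma Omx_kmx (f : I -> I -> K) : (forall x y, f x y \in O) -> Omx O (kmx f).
Proof. by move=> Of i j; rewrite mxE. Qed.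

Lemma red_kmx (f : I -> I -> K) : map_mx red (kmx f) = kmx (fun x y => red (f x y)).
Proof. by apply/matrixP => i j; rewrite !mxE. Qed.

Lemma Omx_mono (c : I -> K) p : (forall x, c x \in O) -> Omx O (mono c p).
Proof. by move=> Oc; apply: Omx_kmx => x y; case: ifP => _ //; exact: (O0 RD). Qed.

Lemma red_mono (c : I -> K) p : map_mx red (mono c p) = mono (fun x => red (c x)) p.
Proof.
by apply/matrixP => i j; rewrite !mxE; case: ifP => // _; exact: (red0 RD).
Qed.

End KernelReduction.

Section SystemLifts.
Variables (k : finFieldType) (K F : closedFieldType) (O : {pred K}) (red : K -> F).
Hypothesis RD : residue_data O red.
Variables (n : nat) (U : k -> 'M[K]_n) (D : k -> k -> 'M[K]_n) (W : 'M[K]_n).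
Hypothesis S : GL2_system U D W.

(** Integrality and intertwining need checking on generators only. The row free [P] has a nonzero
    invariant image, so irreducibility of [sigma] makes it square. *)
Lemma sys_lifts m (sigma : mx_representation F (GL2 k) m) (P : 'M_(n, m)) :
  mx_irreducible sigma -> row_free P -> (0 < n)%N ->
  (forall b, Omx O (U b)) -> (forall a d, a != 0 -> d != 0 -> Omx O (D a d)) -> Omx O W ->
  (forall b, map_mx red (U b) *m P = P *m sigma (gu b)) ->
  (forall a d, a != 0 -> d != 0 -> map_mx red (D a d) *m P = P *m sigma (gd a d)) ->
  map_mx red W *m P = P *m sigma (gw k) ->
  lifts O red (sys_repr S) sigma.
Proof.
move=> irr fP n0 OU OD1 OW hU hD hW.
have both g : Omx O (sys_repr S g) /\ map_mx red (sys_repr S g) *m P = P *m sigma g.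
  move: g; apply: gen_GL2.
  - move=> g h [Og hg] [Oh hh]; rewrite !GL2_reprM; split; first exact: (OmxM RD).
    by rewrite (red_mxM RD) // -mulmxA hh mulmxA hg mulmxA.
  - by move=> b; rewrite /= sys_gu.
  - by move=> a d a0 d0; rewrite /= sys_gd //; split; [exact: OD1 | exact: hD].
  - by rewrite /= sys_gw.
split=> [g _|]; first by have [] := both g.
exists P; split=> // [|g _]; last by have [] := both g.
have modP : mxmodule sigma <<P>>%MS.
  rewrite (eqmx_module _ (genmxE _)); apply/mxmoduleP => g _.
  by rewrite -(both g).2 submxMl.
have [_ /(_ _ modP)] := (mx_irrP sigma).1 irr.
rewrite -mxrank_eq0 genmxE (eqP fP) -lt0n => /(_ n0).
by rewrite /row_full genmxE (eqP fP) => /eqP.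
Qed.

Lemma sys_reducible (A : 'M[K]_n) :
  (forall b, A *m U b = U b *m A) -> (forall a, a != 0 -> A *m D a a^-1 = D a a^-1 *m A) ->
  A *m W = W *m A -> ~~ is_scalar_mx A ->
  ~ mx_irreducible (subg_repr (sys_repr S) (normal_sub (SL2_normal k))).
Proof.
move=> hU hD hW nsc irr.
have [|a Ea] := closed_Schur (A := A) irr; last by rewrite Ea scalar_mx_is_scalar in nsc.
apply: gen_SL2.
- move=> g h Hg Hh; rewrite /= in Hg Hh *; rewrite sys_mul // mulmxA Hg.
  by rewrite -!mulmxA Hh.
- by move=> b; rewrite /= sys_gu.
- by move=> b b0; rewrite /= sys_gd ?invr_eq0 //; exact: hD.
- by rewrite /= sys_gw.
Qed.

End SystemLifts.

Section Kirillov.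
Variable k : finFieldType.

Definition kx : predArgType := {x : k | x \in predC1 0}.
Implicit Types (x y z : kx).

Lemma kx_neq0 x : val x != 0. Proof. exact: (valP x). Qed.

Lemma sum_kx (V : nmodType) (f : k -> V) : \sum_(x : kx) f (val x) = \sum_(x | x != 0) f x.
Proof. by rewrite -(big_sub (op := +%R)); apply: eq_bigl => x; rewrite !inE. Qed.

Definition kx_scale (a d : k) x : kx := insubd x (val x * a / d).

Lemma val_kx_scale a d x : a != 0 -> d != 0 -> val (kx_scale a d x) = val x * a / d.
Proof.
by move=> a0 d0; rewrite val_insubd !inE !mulf_neq0 ?invr_eq0 // kx_neq0.
Qed.

Variables (R : fieldType) (psi omega J : k -> R).
Hypotheses (ac : additive_char psi) (mc : multiplicative_char omega).

Definition kirU b := mono (fun x => psi (b * val x)) (fun x => x).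
Definition kirD a d := mono (fun _ => omega d) (kx_scale a d).
(** Commutation of [W] with the torus forces this shape: a function of [x * y], up to the twist by
    [omega] at [y]. *)
Definition kirW := kmx (fun x y => (omega (val y))^-1 * J (val x * val y)).

Hypothesis Jww : forall x z : k, x != 0 -> z != 0 ->
  \sum_(y | y != 0) (omega y)^-1 * J (x * y) * J (y * z) =
  if x == z then omega (-1) * omega x else 0.
Hypothesis Jwuw : forall x z : k, x != 0 -> z != 0 ->
  \sum_(y | y != 0) (omega y)^-1 * psi y * J (x * y) * J (y * z) =
  omega (-1) * psi (- x - z) * J (x * z).

Let om0 x : omega (val x) != 0. Proof. exact: (mchar_neq0 mc (kx_neq0 x)). Qed.

Lemma kvec_kirW x : kvec x *m kirW = \sum_y ((omega (val y))^-1 * J (val x * val y)) *: kvec y.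
Proof. exact: kvec_kmx. Qed.

Let Sww x z : \sum_(y : kx) (omega (val y))^-1 * J (val x * val y) * J (val y * val z) =
  if val x == val z then omega (-1) * omega (val x) else 0.
Proof.
by rewrite -(Jww (kx_neq0 x) (kx_neq0 z)) -(sum_kx (fun y : k => (omega y)^-1 * J (val x * y) * J (y * val z))).
Qed.

Let Swuw x z : \sum_(y : kx) (omega (val y))^-1 * psi (val y) * J (val x * val y) * J (val y * val z) =
  omega (-1) * psi (- val x - val z) * J (val x * val z).
Proof.
rewrite -(Jwuw (kx_neq0 x) (kx_neq0 z)).
by rewrite -(sum_kx (fun y : k => (omega y)^-1 * psi y * J (val x * y) * J (y * val z))).
Qed.

Lemma kir_system : GL2_system kirU kirD kirW.
Proof.
have m1 : -1 != 0 :> k by rewrite oppr_eq0 oner_eq0.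
have scN1 x : kx_scale (-1) (-1) x = x.
  by apply: val_inj; rewrite val_kx_scale //; field; rewrite m1.
split.
- by apply: kvec_inj => x; rewrite kvec_mono mul0r (achar0 ac) scale1r mulmx1.
- move=> b c; apply: kvec_inj => x; rewrite mulmxA !kvec_mono -scalemxAl kvec_mono scalerA.
  by rewrite mulrDl (acharD ac).
- apply: kvec_inj => x; rewrite kvec_mono (mchar1 mc) scale1r mulmx1; congr kvec.
  by apply: val_inj; rewrite val_kx_scale ?oner_neq0 // mulr1 divr1.
- move=> a d a' d' a0 d0 a0' d0'; apply: kvec_inj => x.
  rewrite mulmxA !kvec_mono -scalemxAl kvec_mono scalerA (mcharM mc) //; congr (_ *: kvec _).
  by apply: val_inj; rewrite !val_kx_scale ?mulf_neq0 //; field; rewrite d0 d0'.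
- move=> a d b a0 d0; apply: kvec_inj => x.
  rewrite !mulmxA !kvec_mono -!scalemxAl !kvec_mono !scalerA mulrC val_kx_scale //.
  by congr ((psi _ * _) *: _); field; rewrite d0.
- move=> a d a0 d0; apply: kvec_inj => x.
  rewrite !mulmxA kvec_mono kvec_kirW mulmx_suml -scalemxAl kvec_kirW scaler_sumr.
  rewrite [RHS](reindex_inj (h := kx_scale a d)) /=; last first.
    move=> y z /(congr1 val); rewrite !val_kx_scale // => e; apply: val_inj.
    by apply: (mulIf (mulf_neq0 a0 (invr_neq0 d0))); rewrite !mulrA.
  apply: eq_bigr => y _; rewrite -scalemxAl kvec_mono !scalerA; congr (_ *: _).
  rewrite !val_kx_scale // -mulrA (mcharM mc) ?kx_neq0 ?mulf_neq0 ?invr_eq0 //.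
  rewrite (mcharM mc) ?invr_eq0 // (mcharV mc) //.
  have -> : val x * d / a * (val y * (a / d)) = val x * val y by field; rewrite a0 d0.
  have oa := mchar_neq0 mc a0; have od := mchar_neq0 mc d0.
  by field; rewrite oa od om0.
- apply: kvec_inj => x; rewrite !mulmxA kvec_mono scN1 kvec_kirW mulmx_suml.
  transitivity (\sum_(z : kx) (\sum_(y : kx) (omega (val y))^-1 * J (val x * val y) *
      J (val y * val z)) *: ((omega (val z))^-1 *: @kvec R _ z)).
    under eq_bigr do rewrite -scalemxAl kvec_kirW scaler_sumr.
    rewrite exchange_big /=; apply: eq_bigr => z _; rewrite scaler_suml.
    by apply: eq_bigr => y _; rewrite !scalerA; congr (_ *: _); ring.
  under eq_bigr do rewrite Sww.
  rewrite (bigD1 x) //= eqxx big1 ?addr0 => [|z zx].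
    by rewrite scalerA mulfK ?om0.
  by rewrite (inj_eq val_inj) eq_sym (negPf zx) scale0r.
- apply: kvec_inj => x; rewrite !mulmxA.
  have UW y : kvec y *m kirU 1 = psi (val y) *: kvec y by rewrite kvec_mono mul1r.
  rewrite kvec_mono -scalemxAl kvec_mono -!scalemxAl !kvec_kirW scN1 !mulmx_suml.
  rewrite !scaler_sumr.
  transitivity (\sum_(z : kx) (\sum_(y : kx) (omega (val y))^-1 * psi (val y) * J (val x * val y) *
      J (val y * val z)) *: ((omega (val z))^-1 *: @kvec R _ z)).
    under eq_bigr do rewrite -scalemxAl UW -!scalemxAl kvec_kirW 2!scaler_sumr.
    rewrite exchange_big /=; apply: eq_bigr => z _; rewrite scaler_suml.
    by apply: eq_bigr => y _; rewrite !scalerA; congr (_ *: _); ring.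
  under eq_bigr do rewrite Swuw.
  apply: eq_bigr => z _; rewrite -scalemxAl kvec_mono !scalerA; congr (_ *: _).
  by rewrite !mulN1r (acharD ac); ring.
Qed.

End Kirillov.

(** * Whittaker vectors *)

Lemma stable_eigenvector (F : closedFieldType) n (A V : 'M[F]_n) :
  V != 0 -> (V *m A <= V)%MS ->
  exists a, (V :&: kermx (A - a%:M))%MS != 0.
Proof.
move=> V0 sV; pose N := row_base V.
have sN : (N *m A <= N)%MS by rewrite eq_row_base (submx_trans _ sV) // submxMr ?eq_row_base.
have [Y EY] := submxP sN.
have r0 : (0 < \rank V)%N by rewrite lt0n mxrank_eq0.
have /closed_rootP [a ra] : size (char_poly Y) != 1 by rewrite size_char_poly eqSS -lt0n.
rewrite -eigenvalue_root_char in ra; have /eigenvalueP [u Eu u0] := ra.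
exists a; apply/rowV0Pn; exists (u *m N).
  rewrite sub_capmx; apply/andP; split.
    by rewrite (submx_trans (submxMl _ _)) ?eq_row_base.
  apply/sub_kermxP; rewrite mulmxBr -mulmxA EY mulmxA Eu -scalemxAl.
  by rewrite mul_mx_scalar subrr.
by rewrite mulmx_free_eq0 ?row_base_free.
Qed.

Lemma commuting_eigenvector (F : closedFieldType) n (I : finType) (A : I -> 'M[F]_n) (V : 'M_n) :
  V != 0 -> (forall i, (V *m A i <= V)%MS) -> (forall i j, A i *m A j = A j *m A i) ->
  exists2 v : 'rV_n, v != 0 & (v <= V)%MS /\ forall i, exists a, v *m A i = a *: v.
Proof.
move=> V0 sV cA.
suff [V' [V'0 V'V _ hV']] : exists V' : 'M_n, [/\ V' != 0, (V' <= V)%MS,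
    forall i, (V' *m A i <= V')%MS & forall i, i \in enum I -> exists a, V' *m A i = a *: V'].
  exists (nz_row V'); first by rewrite nz_row_eq0.
  have sub := nz_row_sub V'; split; first exact: submx_trans sub V'V.
  move=> i; have [a Ea] := hV' i (mem_enum _ _); exists a.
  by have /submxP [w ->] := sub; rewrite -mulmxA Ea -scalemxAr.
elim: (enum I) => [|i s [V1 [V10 V1V sV1 hV1]]]; first by exists V; split=> //.
have [a Na] := stable_eigenvector V10 (sV1 i).
have sub1 := capmxSl V1 (kermx (A i - a%:M)); have sub2 := capmxSr V1 (kermx (A i - a%:M)).
exists (V1 :&: kermx (A i - a%:M))%MS; split=> //.
- exact: submx_trans sub1 V1V.
- move=> j; rewrite sub_capmx (submx_trans _ (sV1 j)) ?submxMr //=.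
  apply/sub_kermxP; rewrite -mulmxA.
  have -> : A j *m (A i - a%:M) = (A i - a%:M) *m A j.
    by rewrite mulmxBl mulmxBr cA scalar_mxC.
  by rewrite mulmxA (sub_kermxP sub2) mul0mx.
- move=> j /predU1P [-> | /hV1 [b Eb]].
    exists a; apply/eqP; rewrite -subr_eq0 -mul_mx_scalar -mulmxBr.
    exact/eqP/sub_kermxP.
  exists b; have /submxP [w ->] := sub1.
  by rewrite -mulmxA Eb -scalemxAr.
Qed.

Section Weights.
Variables (k : finFieldType) (F : closedFieldType) (m : nat).
Variable sg : mx_representation F (GL2 k) m.
Hypothesis irr : mx_irreducible sg.
Variable psi : k -> F.
Hypothesis ac : additive_char psi.
Hypothesis q0 : (#|k|)%:R != 0 :> F.
Implicit Types (a b c d x y : k).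

Let S := repr_system sg.
Local Notation U b := (sg (gu b)).
Local Notation D a d := (sg (gd a d)).
Local Notation W := (sg (gw k)).

(** Fourier projector onto the vectors on which [gu b] acts by [psi (b * x)]: weight 0 gives the
    vectors fixed by the unipotent group, weight 1 the Whittaker vectors. The torus permutes the
    nonzero weights transitively. *)
Definition wproj x : 'M[F]_m := (#|k|)%:R^-1 *: \sum_b psi (- (b * x)) *: U b.

Definition has_weight x n (v : 'M[F]_(n, m)) := forall b, v *m U b = psi (b * x) *: v.

Lemma wprojU x : has_weight x (wproj x).
Proof.
move=> b; rewrite /wproj -scalemxAl scalerA mulrC -scalerA; congr (_ *: _).
rewrite mulmx_suml scaler_sumr [RHS](reindex_inj (addIr b)) /=; apply: eq_bigr => c _.
rewrite -scalemxAl (sysUM S) scalerA -(acharD ac); congr (psi _ *: _).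
by ring.
Qed.

Lemma wproj_weight x n (v : 'M_(n, m)) : has_weight x v -> v *m wproj x = v.
Proof.
move=> hv; rewrite /wproj -scalemxAr mulmx_sumr.
rewrite (eq_bigr (fun=> v)) => [|b _].
  by rewrite sumr_const -scaler_nat scalerA mulVf ?scale1r.
by rewrite -scalemxAr hv scalerA -(acharD ac) addNr achar0 ?scale1r.
Qed.

Lemma wproj_weight0 x y n (v : 'M_(n, m)) : x != y -> has_weight x v -> v *m wproj y = 0.
Proof.
move=> xy hv; rewrite /wproj -scalemxAr mulmx_sumr.
rewrite (eq_bigr (fun b => psi ((x - y) * b) *: v)) => [|b _].
  by rewrite -scaler_suml (sum_achar ac) subr_eq0 (negPf xy) scale0r scaler0.
by rewrite -scalemxAr hv scalerA -(acharD ac); congr (psi _ *: _); ring.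
Qed.

Lemma has_weightM x n p (A : 'M_(p, n)) (v : 'M_(n, m)) : has_weight x v -> has_weight x (A *m v).
Proof. by move=> hv b; rewrite -mulmxA hv -scalemxAr. Qed.

Lemma has_weight_mul x n (A : 'M_(n, m)) : has_weight x (A *m wproj x).
Proof. exact/has_weightM/wprojU. Qed.

Lemma wproj_sum : \sum_x wproj x = 1%:M.
Proof.
rewrite /wproj -scaler_sumr exchange_big /= (bigD1 0) //= [X in _ + X]big1 => [|b b0].
  rewrite addr0 -scaler_suml (eq_bigr (fun=> 1)) => [|x _]; last by rewrite mul0r oppr0 achar0.
  by rewrite sumr_const scalerA mulVf // scale1r (sysU0 S).
rewrite -scaler_suml (eq_bigr (fun x => psi (- b * x))) => [|x _]; last by rewrite mulNr.
by rewrite (sum_achar ac) oppr_eq0 (negPf b0) scale0r.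
Qed.

Lemma weight_decomp n (A : 'M_(n, m)) : A = \sum_x A *m wproj x.
Proof. by rewrite -mulmx_sumr wproj_sum mulmx1. Qed.

Lemma weight_D x a d n (v : 'M_(n, m)) : a != 0 -> d != 0 -> has_weight x v ->
  has_weight (x * a / d) (v *m D a d).
Proof.
move=> a0 d0 hv b; rewrite -mulmxA (sysDU S) // mulmxA hv -scalemxAl.
by congr (psi _ *: _); field; rewrite d0.
Qed.

Lemma D_inv a d : a != 0 -> d != 0 -> D a d *m D a^-1 d^-1 = 1%:M.
Proof. by move=> a0 d0; rewrite (sysDM S) ?invr_eq0 // !mulfV // (sysD1 S). Qed.

Lemma D_neq0 a d n (v : 'M_(n, m)) : a != 0 -> d != 0 -> v != 0 -> v *m D a d != 0.
Proof.
move=> a0 d0; apply: contra_neq => e.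
by rewrite -[v]mulmx1 -(D_inv a0 d0) mulmxA e mul0mx.
Qed.

Lemma omega_exists : exists omega : k -> F, multiplicative_char omega /\
  forall a, a != 0 -> D a a = (omega a)%:M.
Proof.
have [m0 _] := (mx_irrP sg).1 irr; pose i0 := Ordinal m0.
pose omega a := D a a i0 i0.
have oE a : a != 0 -> D a a = (omega a)%:M.
  move=> a0; have [c Ec] := central_scalar irr a0.
  by rewrite /omega Ec mxE eqxx.
exists omega; split=> //; split=> [|x y x0 y0].
  by rewrite /omega (sysD1 S) mxE eqxx.
by rewrite {1}/omega -(sysDM S) // !oE // -scalar_mxM mxE eqxx.
Qed.

Section Hecke.

(** Transposition followed by conjugation with the antidiagonal matrix of ones; an anti-involution,
    not inversion. *)
Definition ginv (g : {'GL_2[k]}) := gl (GLval g 1 1) (GLval g 0 1) (GLval g 1 0) (GLval g 0 0).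

Lemma ginv_gl a b c d : a * d - b * c != 0 -> ginv (gl a b c d) = gl d b c a.
Proof. by move=> h; rewrite /ginv glval // !mxE. Qed.

Lemma ginvM g h : ginv (g * h)%g = (ginv h * ginv g)%g.
Proof.
rewrite (gl_eta g) (gl_eta h); move: (GL_det2 g) (GL_det2 h).
move: (GLval g 0 0) (GLval g 0 1) (GLval g 1 0) (GLval g 1 1) => a b c d.
move: (GLval h 0 0) (GLval h 0 1) (GLval h 1 0) (GLval h 1 1) => a' b' c' d' h1 h2.
have h1' : d * a - b * c != 0 by rewrite mulrC.
have h2' : d' * a' - b' * c' != 0 by rewrite mulrC.
rewrite glM // !ginv_gl // ?glM //; first by congr gl; ring.
by apply: contra_neq (mulf_neq0 h1 h2) => e; rewrite -[RHS]e; ring.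
Qed.

Lemma ginv_gu b : ginv (gu b) = gu b.
Proof. by rewrite ginv_gl ?mulr0 ?subr0 ?mulr1 ?oner_neq0. Qed.

Definition hecke g := wproj 1 *m sg g *m wproj 1.

Lemma U_wproj b : U b *m wproj 1 = psi b *: wproj 1.
Proof.
rewrite /wproj -scalemxAr scalerA mulrC -scalerA; congr (_ *: _).
rewrite mulmx_sumr scaler_sumr [RHS](reindex_inj (addrI b)) /=; apply: eq_bigr => c _.
rewrite -scalemxAr (sysUM S) scalerA -(acharD ac); congr (psi _ *: _).
by ring.
Qed.

(** For a Borel element with [a != d] both sides vanish, since the torus moves weight 1 away. On the
    big cell [a] and [d] enter only through the determinant and [psi (a / c) * psi (d / c)], which
    are symmetric. *)
Lemma hecke_ginv g : hecke (ginv g) = hecke g.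
Proof.
rewrite (gl_eta g); move: (GL_det2 g).
move: (GLval g 0 0) (GLval g 0 1) (GLval g 1 0) (GLval g 1 1) => a b c d h.
have h' : d * a - b * c != 0 by rewrite mulrC.
rewrite ginv_gl // /hecke.
have [c0 | c0] := eqVneq c 0.
  move: h; rewrite c0 mulr0 subr0 mulf_eq0 => /norP [a0 d0].
  rewrite !gl_borel // !GL2_reprM.
  have [-> // | ad] := eqVneq a d.
  have vanish a' d' (b' : k) : a' != 0 -> d' != 0 -> a' != d' ->
      wproj 1 *m (D a' d' *m U b') *m wproj 1 = 0.
    move=> a0' d0' ad'; rewrite -!mulmxA U_wproj -2!(scalemxAr (psi b')) mulmxA.
    rewrite (wproj_weight0 (x := 1 * a' / d')) ?scaler0 //.
      rewrite mul1r; apply: contra_neq ad' => e.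
      by apply: (mulIf (invr_neq0 d0')); rewrite e mulfV.
    by apply: weight_D => //; exact: wprojU.
  by rewrite !vanish // eq_sym.
rewrite (gl_cell c0 h) (gl_cell c0 h').
have cell (x y t1 t2 : k) : wproj 1 *m sg (gu x * gd t1 t2 * gw k * gu y)%g *m wproj 1 =
    (psi x * psi y) *: (wproj 1 *m D t1 t2 *m W *m wproj 1).
  rewrite !GL2_reprM !mulmxA wprojU mulr1 -!mulmxA U_wproj.
  by rewrite -2!(scalemxAr (psi y)) -!(scalemxAl (psi x)) -(scalemxAr (psi y)) scalerA.
by rewrite !cell mulrC [a * d]mulrC.
Qed.

(* Gelfand's trick: the anti-involution [ginv] fixes every [hecke g]. *)
Lemma hecke_comm g h : hecke g *m hecke h = hecke h *m hecke g.
Proof.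
have prod (x y : {'GL_2[k]}) : hecke x *m hecke y =
    (#|k|)%:R^-1 *: \sum_b psi (- b) *: hecke (x * gu b * y)%g.
  have ee : wproj 1 *m wproj 1 = wproj 1 by apply: wproj_weight; exact: wprojU.
  rewrite /hecke !mulmxA -[_ *m wproj 1 *m wproj 1]mulmxA ee.
  have mid (A B : 'M[F]_m) : A *m wproj 1 *m B =
      (#|k|)%:R^-1 *: \sum_b psi (- b) *: (A *m U b *m B).
    rewrite /wproj -scalemxAr -scalemxAl mulmx_sumr mulmx_suml; congr (_ *: _).
    by apply: eq_bigr => b _; rewrite mulr1 -scalemxAr -scalemxAl.
  rewrite -(mulmxA _ (sg y)) mid; congr (_ *: _); apply: eq_bigr => b _.
  by rewrite !GL2_reprM !mulmxA.
rewrite prod -(hecke_ginv h) -(hecke_ginv g) prod; congr (_ *: _).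
apply: eq_bigr => b _; rewrite -hecke_ginv !ginvM ginv_gu.
by rewrite mulgA.
Qed.

End Hecke.

(** Multiplicity one: a common eigenvector [v] of the commuting Hecke operators generates [sg], so a
    weight 1 vector is a combination of the [v *m sg g]. Projecting to weight 1 replaces these by
    [v *m hecke g], all multiples of [v]. *)
Lemma whittaker_line : wproj 1 != 0 ->
  exists2 v : 'rV_m, v != 0 & has_weight 1 v /\
    forall u : 'rV_m, has_weight 1 u -> exists c : F, u = c *: v.
Proof.
move=> e0.
have ee : wproj 1 *m wproj 1 = wproj 1 by apply: wproj_weight; exact: wprojU.
have stab g : (wproj 1 *m hecke g <= wproj 1)%MS by rewrite /hecke !mulmxA submxMl.
have [v v0 [vV hv]] := commuting_eigenvector e0 stab hecke_comm.
have wv : has_weight 1 v.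
  by have /submxP [w ->] := vV; exact: has_weight_mul.
exists v => //; split=> // u wu.
have : (u <= cyclic_mx sg v)%MS.
  apply: submx_trans (submx1 _) _; have [_ h] := (mx_irrP sg).1 irr.
  by rewrite sub1mx h ?cyclic_mx_module ?cyclic_mx_eq0.
case/cyclic_mxP => A /envelop_mxP [al EA] Eu.
have Euv : u = \sum_(g in GL2 k) al g *: (v *m hecke g).
  rewrite -(wproj_weight wu) Eu EA mulmx_sumr mulmx_suml; apply: eq_bigr => g _.
  by rewrite -(scalemxAr (al g)) -(scalemxAl (al g)) /hecke -mulmxA !mulmxA (wproj_weight wv).
rewrite Euv; elim/big_ind: _ => [|x y [cx ->] [cy ->]|g _].
- by exists 0; rewrite scale0r.
- by exists (cx + cy); rewrite scalerDl.
- by have [a ->] := hv g; exists (al g * a); rewrite scalerA.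
Qed.

Definition kirillov_data (omega J : k -> F) (P : 'M[F]_(#|kx k|, m)) :=
  [/\ row_free P, row_full P, forall b, kirU psi b *m P = P *m U b,
     forall a d, a != 0 -> d != 0 -> kirD omega a d *m P = P *m D a d &
     kirW omega J *m P = P *m W].

Lemma kirillov_model : wproj 0 = 0 ->
  exists omega J P, multiplicative_char omega /\ kirillov_data omega J P.
Proof.
move=> cusp; have [m0 _] := (mx_irrP sg).1 irr.
have e1 : wproj 1 != 0.
  apply: contraTneq m0 => e1.
  suff : 1%:M == 0 :> 'M[F]_m by rewrite -mxrank_eq0 mxrank1 lt0n => /eqP ->.
  rewrite -wproj_sum big1 // => x _; have [-> // | x0] := eqVneq x 0.
  have w1 : has_weight 1 (wproj x *m D x^-1 1).
    have := weight_D (invr_neq0 x0) (oner_neq0 k) (wprojU x).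
    by rewrite mulfV // divr1.
  have : wproj x *m D x^-1 1 = 0 by rewrite -(wproj_weight w1) e1 mulmx0.
  apply: contra_eq => nz; exact: D_neq0 (invr_neq0 x0) (oner_neq0 k) nz.
have [v v0 [wv line]] := whittaker_line e1.
have [omega [mo oE]] := omega_exists.
pose vx (x : kx k) := v *m D (val x) 1.
have wvx (x : kx k) : has_weight (val x) (vx x).
  by have := weight_D (kx_neq0 x) (oner_neq0 k) wv; rewrite mul1r divr1.
have vx0 (x : kx k) : vx x != 0 by apply: D_neq0 => //; [exact: kx_neq0 | exact: oner_neq0].
have linex (x : kx k) (u : 'rV_m) : has_weight (val x) u -> exists c : F, u = c *: vx x.
  move=> wu; have w1 : has_weight 1 (u *m D (val x)^-1 1).
    have := weight_D (invr_neq0 (kx_neq0 x)) (oner_neq0 k) wu.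
    by rewrite mulfV ?kx_neq0 // divr1.
  have [c Ec] := line _ w1; exists c.
  rewrite /vx scalemxAl -Ec -mulmxA (sysDM S) ?invr_eq0 ?kx_neq0 ?oner_neq0 //.
  by rewrite mulVf ?kx_neq0 // mulr1 (sysD1 S) mulmx1.
pose P := rows_mx vx.
have proj (w : 'rV_#|kx k|) (y : kx k) : w *m P *m wproj (val y) = w 0 (enum_rank y) *: vx y.
  have -> : w *m P = \sum_x w 0 (enum_rank x) *: vx x.
    rewrite mulmx_sum_row (reindex (@enum_rank (kx k))) /=; last exact: onW_bij (@enum_rank_bij _).
    by apply: eq_bigr => x _; rewrite rowK enum_rankK.
  rewrite mulmx_suml (bigD1 y) //= -scalemxAl (wproj_weight (wvx y)).
  rewrite big1 ?addr0 // => x xy; rewrite -scalemxAl (wproj_weight0 _ (wvx x)) ?scaler0 //.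

have fP : row_free P.
  rewrite -kermx_eq0; apply/rowV0P => u /sub_kermxP uP.
  apply/rowP => j; rewrite mxE -[j]enum_valK; apply/eqP.
  have /eqP := proj u (enum_val j); rewrite uP mul0mx eq_sym scaler_eq0 (negPf (vx0 _)) orbF.
  by [].
have span (u : 'rV_m) : (u <= P)%MS.
  rewrite (weight_decomp u) summx_sub // => x _; have [-> | x0] := eqVneq x 0.
    by rewrite cusp mulmx0 sub0mx.
  have x0' : x \in predC1 0 by rewrite inE.
  have [c ->] := linex (Sub x x0') _ (has_weight_mul x u).
  by apply: scalemx_sub; rewrite -kvec_rows submxMl.
pose j0 (u : 'rV_m) (y : kx k) := (u *m pinvmx P) 0 (enum_rank y).
have j0E u : u = \sum_y j0 u y *: vx y.
  rewrite [LHS](weight_decomp u) (bigD1 0) //= cusp mulmx0 add0r -(sum_kx (fun x => u *m wproj x)).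
  by apply: eq_bigr => y _; rewrite -proj mulmxKpV.
(* In [kirW] the row at 1 has entry [J y / omega y] at [y]; this reads [J] off the coordinates of
   [v *m W]. *)
pose J (x : k) := omega x * if insub x is Some y then j0 (v *m W) y else 0.
exists omega, J, P; split=> //; split=> //.
- by rewrite -sub1mx; apply/row_subP => i; exact: span.
- move=> b; apply: kmx_rows => x; rewrite wvx (bigD1 x) //= eqxx big1 ?addr0 // => y yx.
  by rewrite (negPf yx) scale0r.
- have DD (x : kx k) a d : a != 0 -> d != 0 -> vx x *m D a d = omega d *: vx (kx_scale a d x).
    move=> a0 d0; rewrite /vx val_kx_scale // -mulmxA (sysDM S) ?kx_neq0 ?oner_neq0 //.
    have -> : D (val x * a) (1 * d) = D (val x * a / d) 1 *m D d d.
      by rewrite (sysDM S) ?mulf_neq0 ?invr_eq0 ?kx_neq0 ?oner_neq0 // divfK.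
    by rewrite oE // mul_mx_scalar -scalemxAr.
  move=> a d a0 d0; apply: kmx_rows => x; rewrite DD // (bigD1 (kx_scale a d x)) //= eqxx.
  by rewrite big1 ?addr0 // => y yx; rewrite (negPf yx) scale0r.
(* All of [W] is determined by [v *m W]: moving a torus element across [W] rescales the coordinates
   by [x]. *)
apply: kmx_rows => x; rewrite /vx -mulmxA -(sysWD S) ?oner_neq0 ?kx_neq0 // mulmxA.
rewrite [v *m W]j0E mulmx_suml.
rewrite (reindex_inj (h := kx_scale (val x) 1)) /=; last first.
  move=> y z /(congr1 val); rewrite !val_kx_scale ?kx_neq0 ?oner_neq0 // !divr1.
  by move/(mulIf (kx_neq0 x)) => /val_inj.
apply: eq_bigr => y _; have vs := val_kx_scale y (kx_neq0 x) (oner_neq0 k).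
rewrite -scalemxAl /vx -mulmxA (sysDM S) ?oner_neq0 ?kx_neq0 // vs divr1.
have -> : D (val y * val x * 1) (1 * val x) = D (val y) 1 *m D (val x) (val x).
  by rewrite (sysDM S) ?oner_neq0 ?kx_neq0 // mulr1.
rewrite oE ?kx_neq0 // mul_mx_scalar -scalemxAr scalerA; congr (_ *: _).
have -> : J (val x * val y) = omega (val x * val y) * j0 (v *m W) (kx_scale (val x) 1 y).
  rewrite /J; have -> : val x * val y = val (kx_scale (val x) 1 y) by rewrite vs divr1 mulrC.
  by rewrite valK.
rewrite (mcharM mo) ?kx_neq0 //.
by field; rewrite (mchar_neq0 mo) ?kx_neq0.
Qed.

End Weights.

(** * Class sums *)

Lemma mxtrace_intertwine (R : fieldType) n m (P : 'M[R]_(n, m)) (A : 'M_m) (B : 'M_n) :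
  row_free P -> row_full P -> B *m P = P *m A -> \tr A = \tr B.
Proof.
move=> /row_freeP [Q PQ] /row_fullP [Q' QP] E.
have eQ : Q' = Q by rewrite -[Q']mulmx1 -PQ mulmxA QP mul1mx.
by rewrite -[A]mul1mx -QP eQ -mulmxA -E mulmxA mxtrace_mulC mulmxA PQ mul1mx.
Qed.

Lemma tr_mx2 (R : nmodType) (M : 'M[R]_2) : \tr M = M 0 0 + M 1 1.
Proof.
by rewrite /mxtrace !big_ord_recl big_ord0 addr0; congr (_ + M _ _); apply: val_inj.
Qed.

(** When the characteristic polynomial has no root, the lower left entry cannot vanish, so [c] and
    [d] are free coordinates on the class. *)
Lemma sum_GL2_charpoly (k : finFieldType) (V : nmodType) (f : {'GL_2[k]} -> V) (s n : k) :
  (forall a d, a + d = s -> a * d <> n) ->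
  \sum_(g | (\tr (GLval g) == s) && (\det (GLval g) == n)) f g =
  \sum_(c | c != 0) \sum_d f (gl (s - d) (((s - d) * d - n) / c) c d).
Proof.
move=> nsplit; rewrite pair_big_dep /=.
have n0 : n != 0 by apply/eqP => e; apply: (nsplit s 0); rewrite ?addr0 // mulr0.
pose h (p : k * k) := gl (s - p.2) (((s - p.2) * p.2 - n) / p.1) p.1 p.2.
have hd (p : k * k) : p.1 != 0 -> (s - p.2) * p.2 - ((s - p.2) * p.2 - n) / p.1 * p.1 = n.
  by move=> c0; field.
rewrite (reindex_onto h (fun g => (GLval g 1 0, GLval g 1 1))) /=.
  apply: eq_bigl => -[c d]; rewrite andbT; apply/idP/idP => [/andP [/andP [/eqP Ht /eqP Hd] _] | /= c0].
    apply/eqP => /= c0; rewrite /h /= c0 invr0 mulr0 in Ht Hd.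
    (* For [c = 0] with zero determinant [gl] is the default [1], whose trace and determinant split
       as [1 + 1] and [1 * 1]. *)
    have [D0 | D0] := eqVneq ((s - d) * d - 0 * 0) 0.
      have e1 : gl (s - d) 0 0 d = 1%g.
        rewrite /gl /insubd insubN // -[_ \is a _]/(_ \in unitmx) unitmxE unitfE det_mx2 !mxE /=.
        by rewrite D0 eqxx.
      rewrite e1 GL_1E mxtrace1 in Ht; rewrite e1 GL_1E det1 in Hd.
      by apply: (nsplit 1 1); rewrite -?Ht -?Hd ?mulr1.
    apply: (nsplit (s - d) d); first by rewrite subrK.
    by rewrite -Hd glval // det_mx2 !mxE /= mul0r subr0.
  have hd' := hd (c, d) c0; rewrite /= in hd'.
  by rewrite /h glval /= ?hd' // tr_mx2 det_mx2 !mxE /= subrK hd' !eqxx.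
move=> g /andP [/eqP Ht /eqP Hd]; rewrite /h /=.
rewrite tr_mx2 in Ht; rewrite det_mx2 in Hd.
have c0 : GLval g 1 0 != 0.
  apply/eqP => e; apply: (nsplit (GLval g 0 0) (GLval g 1 1)) => //.
  by rewrite -Hd e mulr0 subr0.
rewrite [RHS](gl_eta g); congr gl; first by rewrite -Ht addrK.
by rewrite -Ht -Hd; field.
Qed.

Section TraceFunction.
Variables (k : finFieldType) (F : closedFieldType) (m : nat).
Variable sg : mx_representation F (GL2 k) m.
Hypothesis irr : mx_irreducible sg.
Variables (psi omega J : k -> F) (P : 'M[F]_(#|kx k|, m)).
Hypothesis ac : additive_char psi.
Hypothesis q0 : (#|k|)%:R != 0 :> F.
Hypothesis mo : multiplicative_char omega.
Hypothesis KD : kirillov_data sg psi omega J P.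
Implicit Types (a b c d s n u : k).
Local Notation q := ((#|k|)%:R : F).

Let fP : row_free P. Proof. by case: KD. Qed.
Let fuP : row_full P. Proof. by case: KD. Qed.
Let hU b : kirU psi b *m P = P *m sg (gu b). Proof. by case: KD. Qed.
Let hD a d : a != 0 -> d != 0 -> kirD omega a d *m P = P *m sg (gd a d).
Proof. by case: KD => _ _ _ h _; exact: h. Qed.
Let hW : kirW omega J *m P = P *m sg (gw k). Proof. by case: KD. Qed.

Definition Tfun s n := \sum_(x | x != 0) (omega x)^-1 * J (n * x ^+ 2) * psi (- (s * x)).

Definition cell_kmx b1 a d b2 : 'M[F]_#|kx k| := kmx (fun x y : kx k =>
  psi (b1 * val x) * omega d * (omega (val y))^-1 * J (val x * a / d * val y) * psi (b2 * val y)).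

Lemma cell_kmxE b1 a d b2 : a != 0 -> d != 0 ->
  cell_kmx b1 a d b2 *m P = P *m sg (gu b1 * gd a d * gw k * gu b2)%g.
Proof.
move=> a0 d0; rewrite !GL2_reprM !mulmxA -hU -(mulmxA _ P) -hD // -(mulmxA _ (_ *m P)).
rewrite -(mulmxA _ P) -hW !mulmxA -(mulmxA _ P) -hU !mulmxA; congr (_ *m P).
apply: kvec_inj => x; rewrite !mulmxA kvec_kmx kvec_mono -!scalemxAl kvec_mono -!scalemxAl.
rewrite kvec_kmx mulmx_suml !scaler_sumr; apply: eq_bigr => y _.
rewrite -scalemxAl kvec_mono !scalerA val_kx_scale //; congr (_ *: _); ring.
Qed.

Lemma trace_cell a b c d : c != 0 -> a * d - b * c != 0 ->
  \tr (sg (gl a b c d)) = Tfun (a + d) (a * d - b * c).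
Proof.
move=> c0 D0; rewrite gl_cell //.
have Nc0 : - c != 0 by rewrite oppr_eq0.
have al0 : - (a * d - b * c) / c != 0 by rewrite mulf_neq0 ?oppr_eq0 ?invr_eq0.
rewrite (mxtrace_intertwine fP fuP (cell_kmxE (a / c) (d / c) al0 Nc0)) mxtrace_kmx.
rewrite (sum_kx (fun x => psi (a / c * x) * omega (- c) * (omega x)^-1 *
  J (x * (- (a * d - b * c) / c) / - c * x) * psi (d / c * x))).
(* The substitution by [- c] removes [c], so that only trace and determinant remain. *)
rewrite (reindex_inj (mulfI Nc0)) /=; apply: eq_big => [x | x].
  by rewrite mulf_eq0 negb_or Nc0.
rewrite mulf_eq0 negb_or Nc0 => /= x0.
have -> : - c * x * (- (a * d - b * c) / c) / - c * (- c * x) = (a * d - b * c) * x ^+ 2.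
  by fld.
have -> : psi (- ((a + d) * x)) = psi (a / c * (- c * x)) * psi (d / c * (- c * x)).
  by rewrite -acharD //; congr psi; field; rewrite c0.
rewrite (mcharM mo) //; field.
by rewrite !(mchar_neq0 mo).
Qed.

Lemma trace_borel a b d : a != 0 -> d != 0 ->
  \tr (sg (gl a b 0 d)) = if a == d then omega a * (if b == 0 then q - 1 else -1) else 0.
Proof.
move=> a0 d0; rewrite gl_borel // GL2_reprM.
have E : (kirD omega a d *m kirU psi (b / a)) *m P = P *m (sg (gd a d) *m sg (gu (b / a))).
  by rewrite -mulmxA hU mulmxA hD // mulmxA.
rewrite (mxtrace_intertwine fP fuP E).
have -> : kirD omega a d *m kirU psi (b / a) =
    mono (fun x : kx k => omega d * psi (b / a * (val x * a / d))) (kx_scale a d).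
  by apply: kvec_inj => x; rewrite mulmxA !kvec_mono -scalemxAl kvec_mono scalerA val_kx_scale.
rewrite mxtrace_kmx; case: eqP => [<- | /eqP ad]; last first.
  rewrite big1 // => x _; case: eqP => // /(congr1 val); rewrite val_kx_scale // => e.
  case/eqP: ad; apply: (mulIf (invr_neq0 d0)); apply: (mulfI (kx_neq0 x)).
  by rewrite mulrA -e divff // mulr1.
have sc (x : kx k) : kx_scale a a x = x by apply: val_inj; rewrite val_kx_scale // mulfK.
under eq_bigr do rewrite sc eqxx mulfK //.
rewrite -mulr_sumr (sum_kx (fun x => psi (b / a * x))); congr (_ * _).
have := sum_achar ac (b / a); rewrite (bigD1 0) //= mulr0 (achar0 ac) mulf_eq0 invr_eq0 (negPf a0) orbF.
case: ifP => _ e; first by apply: (addrI 1); rewrite e addrC subrK.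
by apply/eqP; rewrite -addr_eq0 addrC e.
Qed.

(** A lower triangular element is conjugate, by swapping the coordinates, to an upper triangular
    one, whose trace is known from [trace_borel]. *)
Lemma Tfun_split a d : a != 0 -> d != 0 ->
  Tfun (a + d) (a * d) = if a == d then - omega a else 0.
Proof.
move=> a0 d0; have Dn : d * a - 0 * 1 != 0 by rewrite mul0r subr0 mulf_neq0.
have := trace_cell (oner_neq0 k) Dn; rewrite mul0r subr0 addrC [d * a]mulrC => <-.
have J0 : 0 * 0 - 1 * 1 != 0 :> k by rewrite mul0r sub0r oppr_eq0 mulr1 oner_eq0.
have D2 : a * d - 1 * 0 != 0 by rewrite mulr0 subr0 mulf_neq0.
pose w0 : {'GL_2[k]} := gl 0 1 1 0; pose g0 := gl a 1 0 d.
have conj : (w0 * g0)%g = (gl d 0%R 1%R a * w0)%g.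
  by rewrite /w0 /g0 glM // glM //; congr gl; ring.
have JJ : (w0 * w0)%g = 1%g by rewrite glM // gl1; congr gl; ring.
have -> : gl d 0 1 a = (w0 * g0 * w0)%g by rewrite conj -mulgA JJ mulg1.
rewrite GL2_reprM mxtrace_mulC -GL2_reprM mulgA JJ mul1g trace_borel // oner_eq0.
by rewrite mulrN1.
Qed.

Lemma Tfun_sum n : \sum_s Tfun s n = 0.
Proof.
rewrite exchange_big big1 // => x x0; rewrite -mulr_sumr.
rewrite (eq_bigr (fun s => psi (- x * s))) => [|s _]; last by congr psi; ring.
by rewrite (sum_achar ac) oppr_eq0 (negPf x0) mulr0.
Qed.

(** Summing against [psi s] isolates the term [x = 1] of [Tfun]; this is how the model is recovered
    from traces alone. *)
Lemma Tfun_fourier u : J u = q^-1 * \sum_s psi s * Tfun s u.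
Proof.
under eq_bigr do rewrite mulr_sumr.
rewrite exchange_big (bigD1 1) ?oner_neq0 //= [X in _ + X]big1 => [|x /andP [x0 x1]].
  rewrite addr0 (eq_bigr (fun=> J u)) => [|s _].
    by rewrite sumr_const -[J u *+ _]mulr_natl mulKf.
  rewrite expr1n !mulr1 (mchar1 mo) invr1 mul1r mulrCA mulrA -mulrA -acharD // subrr.
  by rewrite achar0 // mulr1.
rewrite (eq_bigr (fun s => (omega x)^-1 * J (u * x ^+ 2) * psi ((1 - x) * s))) => [|s _].
  by rewrite -mulr_sumr (sum_achar ac) subr_eq0 eq_sym (negPf x1) mulr0.
by rewrite mulrCA -acharD //; congr (_ * psi _); ring.
Qed.

Lemma Tfun_scale a s n : a != 0 -> Tfun (a * s) (a ^+ 2 * n) = omega a * Tfun s n.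
Proof.
move=> a0; rewrite /Tfun mulr_sumr [LHS](reindex_inj (mulfI (invr_neq0 a0))) /=.
apply: eq_big => [x | x]; rewrite mulf_eq0 negb_or invr_neq0 //= => x0.
rewrite (mcharM mo) ?invr_eq0 // (mcharV mo) // invfM invrK -!mulrA; congr (_ * (_ * _)).
by congr (J _ * psi _); field; rewrite a0.
Qed.

(** Schur makes the class sum a scalar, so one diagonal entry of its kernel determines it. At index
    1 the summand does not depend on [d], whence the factor [q], and the substitution [c = - x^-1]
    produces [Tfun]. *)
Lemma class_sum s n : (forall a d, a + d = s -> a * d <> n) ->
  \sum_(g | (\tr (GLval g) == s) && (\det (GLval g) == n)) sg g = (q * Tfun s n)%:M.
Proof.
move=> nsplit; set C := \sum_(g | _) _.
have n0 : n != 0 by apply/eqP => e; apply: (nsplit s 0); rewrite ?addr0 // mulr0.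
have [kap EC] : exists kap, C = kap%:M.
  apply: (closed_Schur irr) => h _; rewrite mulmx_suml mulmx_sumr.
  rewrite [RHS](reindex_inj (conjg_inj h)) /=; apply: eq_big => [g | g _].
    have uh : FinRing.uval h \is a GRing.unit := valP h.
    rewrite -mulmxE mxtrace_mulC mulmxE -mulrA divrr // mulr1.
    by rewrite -mulmxE det_mulmx mulrC -det_mulmx mulmxE -mulrA divrr // mulr1.
  by rewrite -!GL2_reprM conjgE !mulgA mulgV mul1g.
rewrite EC; congr (_%:M).
have hd c d : c != 0 -> (s - d) * d - ((s - d) * d - n) / c * c = n by move=> c0; field.
pose B := \sum_(c | c != 0) \sum_d cell_kmx ((s - d) / c) (- n / c) (- c) (d / c).
have EB : B *m P = kap *: P.
  rewrite -mul_mx_scalar -EC /C sum_GL2_charpoly // mulmx_sumr mulmx_suml.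
  apply: eq_bigr => c c0; rewrite mulmx_sumr mulmx_suml; apply: eq_bigr => d _.
  rewrite gl_cell ?hd // cell_kmxE ?oppr_eq0 // mulf_neq0 ?oppr_eq0 ?invr_eq0 //.
have EB' : B = kap%:M.
  by apply: (row_free_inj fP); rewrite EB mul_scalar_mx.
have o1 : (1 : k) \in predC1 0 by rewrite inE oner_neq0.
pose i1 := enum_rank (Sub 1 o1 : kx k).
have := congr1 (fun A : 'M_#|kx k| => A i1 i1) EB'; rewrite /= [RHS]mxE eqxx mulr1n => <-.
rewrite /B summxE /Tfun mulr_sumr.
have N1 : -1 != 0 :> k by rewrite oppr_eq0 oner_eq0.
rewrite (reindex_onto (fun x => - x^-1) (fun x => - x^-1)) => [|x x0]; last first.
  by rewrite invrN invrK opprK.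
apply: eq_big => [x | x]; first by rewrite oppr_eq0 invr_eq0 invrN invrK opprK eqxx andbT.
rewrite oppr_eq0 invr_eq0 => /andP [x0 _]; rewrite summxE.
rewrite (eq_bigr (fun=> (omega x)^-1 * J (n * x ^+ 2) * psi (- (s * x)))) => [|d _].
  by rewrite sumr_const mulr_natl.
rewrite mxE enum_rankK /= !mulr1 (mchar1 mo) invr1 mulr1.
have -> : 1 * (- n / - x^-1) / - - x^-1 = n * x ^+ 2 by fld.
have -> : psi (- (s * x)) = psi ((s - d) / - x^-1) * psi (d / - x^-1).
  by rewrite -acharD //; congr psi; fld.
by rewrite opprK (mcharV mo) //; ring.
Qed.

End TraceFunction.

(** * Counting points of a conic through norm fibres *)

Section ConicCount.
Variables (k L : finFieldType) (iota : {rmorphism k -> L}).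
Hypothesis cardL : #|L| = (#|k| ^ 2)%N.
Local Notation Nm := (Nm iota).
Local Notation Tr := (Tr iota).
Local Notation fconj := (fconj k).
Implicit Types (a b c d x : k) (t u y : L).

Lemma fconj_iotaP t : fconj t = t -> exists a, t = iota a.
Proof. by move=> /(fconj_fix iota) [a ->]; exists a. Qed.

Variables t t' : L.
Hypotheses (nt : fconj t != t) (nt' : fconj t' != t').
Let s := Tr t.
Let n := Nm t.
Let s' := Tr t'.
Let n' := Nm t'.

Lemma nonsplit_charpoly a d : a + d = Tr t -> a * d <> Nm t.
Proof.
move=> Es En; have : (iota a - t) * (iota a - fconj t) = 0.
  by rewrite -sub_charpoly // -Es -En -(rmorph0 iota); congr (iota _); ring.
move/eqP; rewrite mulf_eq0 !subr_eq0 => /orP [] /eqP e; move: nt; rewrite -e.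
  by rewrite fconj_iota eqxx.
by rewrite -{1}[t](fconjK cardL) -e fconj_iota eqxx.
Qed.

Lemma mul_conj_neq : t * t' != t * fconj t'.
Proof.
have t0 : t != 0 by apply: contraNneq nt => ->; rewrite fconj_eq0.
by apply: contra_neq nt' => /(mulfI t0)/esym.
Qed.

(** The point [iota d - iota c * t'] identifies the pairs [(c, d)] with [L]. After a shift,
    requiring the argument of [f] to equal [S] prescribes the norm as [Nm (gam S) - n]. There are
    [q + 1] solutions, or one if this value is 0, which happens for exactly two [S]. *)
Lemma sum_conic (R : fieldType) (f : k -> R) :
  \sum_(c | c != 0) \sum_d f (((s - d) * d - n) / c - c * n' + d * s') =
  (\sum_S f S) *+ #|k|.+1 - f (Tr (t * t')) *+ #|k| - f (Tr (t * fconj t')) *+ #|k|.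
Proof.
pose Sf c d := ((s - d) * d - n) / c - c * n' + d * s'.
pose y (p : k * k) := iota p.2 - iota p.1 * t'.
have dt' : t' - fconj t' != 0 by rewrite subr_eq0 eq_sym.
have yinj : injective y.
  move=> [c d] [c2 d2]; rewrite /y /= => e.
  have cc : c = c2.
    apply/eqP; apply: contraNT nt' => ne.
    have ne' : iota (c - c2) != 0 by rewrite fmorph_eq0 subr_eq0.
    have -> : t' = iota ((d - d2) / (c - c2)).
      rewrite fmorph_div; apply: (mulfI ne'); rewrite mulrCA divff // mulr1 !rmorphB /=.
      apply/eqP; rewrite -subr_eq0; apply/eqP.
      transitivity (- ((iota d - iota c * t') - (iota d2 - iota c2 * t'))); first by ring.
      by rewrite e; ring.
    by rewrite fconj_iota.
  by move: e; rewrite cc => /(addIr _)/(fmorph_inj iota) ->.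
have ybij : bijective y by apply: inj_card_bij => //; rewrite card_prod cardL expnS expn1.
(* Chosen so that [Tr (gam S) = - s] and [Tr (t' * gam S) = - S]: the linear part of the conic
   becomes [Tr (y (c, d) * gam S)]. *)
pose gam S := (- iota S + iota s * fconj t') / (t' - fconj t').
have cgam S : fconj (gam S) = (iota S - iota s * t') / (t' - fconj t').
  have inv u : fconj u^-1 = (fconj u)^-1 by exact: fconjV.
  rewrite /gam fconjM // fconjD // inv fconjB // fconjN // fconjM // !fconj_iota fconjK //.
  rewrite -[fconj t' - t']opprB invrN; ring.
have Tgam S : Tr (gam S) = - s.
  apply: (fmorph_inj iota); rewrite TrE // cgam /gam rmorphN; by field.
have Tgam' S : Tr (t' * gam S) = - S.
  apply: (fmorph_inj iota); rewrite TrE // fconjM cgam /gam rmorphN; by field.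
have norm_eq S c d : Nm (y (c, d) + fconj (gam S)) - (Nm (gam S) - n) =
    if c == 0 then d ^+ 2 - s * d + n else c * (S - Sf c d).
  have -> : Nm (y (c, d) + fconj (gam S)) - (Nm (gam S) - n) = Nm (y (c, d)) + Tr (y (c, d) * gam S) + n.
    by rewrite NmD // fconjK // Nm_conj //; ring.
  have -> : Nm (y (c, d)) = d ^+ 2 - s' * (c * d) + c ^+ 2 * n'.
    rewrite /y /= NmD // Nm_iota // NmN // NmM // Nm_iota // fconjN // fconjM fconj_iota //.
    have -> : iota d * - (iota c * fconj t') = iota (- (c * d)) * fconj t'.
      by rewrite rmorphN rmorphM; ring.
    by rewrite TrZ // Tr_conj // -/s' -/n'; ring.
  have -> : Tr (y (c, d) * gam S) = - (s * d) + c * S.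
    rewrite /y /= mulrBl TrD // TrN // TrZ // -mulrA TrZ // Tgam Tgam'; ring.
  by case: eqP => [-> | /eqP c0]; rewrite /Sf; [ring | field].
have cnt (S : k) : (\sum_(p : k * k | (p.1 != 0%R) && (Sf p.1 p.2 == S)) 1)%N =
    if (S == Tr (t * t')) || (S == Tr (t * fconj t')) then 1%N else #|k|.+1.
  transitivity #|[pred u | Nm u == Nm (gam S) - n]|.
    rewrite -[RHS]sum1_card (reindex_inj (addIr (fconj (gam S)))) /=.
    rewrite [RHS](reindex y) /=; last exact: onW_bij.
    apply: eq_bigl => -[c d] /=; rewrite inE -[X in _ = X]subr_eq0 norm_eq.
    case: eqP => [_ | /eqP c0] /=; last by rewrite mulf_eq0 (negPf c0) subr_eq0 eq_sym.
    apply/esym/eqP => e; apply: (@nonsplit_charpoly (s - d) d); first by rewrite subrK.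
    by apply/eqP; rewrite -subr_eq0 -oppr_eq0 -[X in _ == X]e; apply/eqP; rewrite /s /n; ring.
  have eqn : (Nm (gam S) - n == 0) = (S == Tr (t * t')) || (S == Tr (t * fconj t')).
    have fact : iota (Nm (gam S) - n) = - ((gam S + t) * (gam S + fconj t)).
      rewrite rmorphB NmE // NmE //; have := congr1 iota (Tgam S); rewrite TrE // rmorphN TrE // => e.
      have -> : (gam S + t) * (gam S + fconj t) = gam S * (gam S + (t + fconj t)) + t * fconj t by ring.
      have -> : t + fconj t = - (gam S + fconj (gam S)) by rewrite e opprK.
      by ring.
    rewrite -(fmorph_eq0 iota) fact oppr_eq0 mulf_eq0 !addr_eq0.
    have h u : Tr u = s -> (gam S == - u) = (S == Tr (u * t')).
      move=> Eu; apply/eqP/eqP => [e | ->].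
        by rewrite mulrC -[RHS]opprK -TrN // -mulrN -e Tgam' opprK.
      apply: (mulIf dt'); rewrite divfK // TrE // -Eu TrE // fconjM; ring.
    rewrite h // h ?Tr_conj //; congr (_ || (_ == _)).
    by rewrite -(Tr_conj iota cardL) fconjM fconjK.
  case: ifP eqn => [_ /eqP -> | _ /negbT nz]; first exact: card_Nm0.
  exact: card_Nm.
rewrite pair_big_dep /= (partition_big (fun p => Sf p.1 p.2) xpredT) //=.
pose S1 := Tr (t * t'); pose S2 := Tr (t * fconj t').
have S12 : S1 != S2.
  apply: contra_neq mul_conj_neq => e.
  have : (t - fconj t) * (t' - fconj t') = 0.
    have := congr1 iota e; rewrite !TrE // !fconjM fconjK // => e'.
    have -> : (t - fconj t) * (t' - fconj t') = t * t' + fconj t * fconj t' - (t * fconj t' + fconj t * t') by ring.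
    by rewrite e' subrr.
  by move/eqP; rewrite mulf_eq0 (negPf dt') orbF subr_eq0 eq_sym (negPf nt).
transitivity (\sum_S f S *+ (if (S == S1) || (S == S2) then 1 else #|k|.+1)).
  apply: eq_bigr => S _; rewrite -/S1 -/S2 -cnt -sumrMnr.
  apply: eq_big => [p | p /andP [_ /eqP <-]]; first by rewrite andbT.
  by rewrite mulr1n.
rewrite (bigD1 S1) // (bigD1 S2) /= ?eqxx ?orbT 1?eq_sym // !mulr1n.
rewrite (eq_bigr (fun S => f S *+ #|k|.+1)) => [|S /andP [/negPf -> /negPf ->] //].
rewrite [X in _ = X *+ _ - _ - _](bigD1 S1) // [X in _ = (_ + X) *+ _ - _ - _](bigD1 S2) /= 1?eq_sym //.
rewrite sumrMnl -/S1 -/S2; move: (\sum_(i | _) _) (f S1) (f S2) => A B C.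
rewrite !mulrSr !mulrnDl; move: (A *+ _) (B *+ _) (C *+ _) => A' B' C'; ring.
Qed.

End ConicCount.

(** * The character of a cuspidal representation *)

Section Classification.
Variables (k : finFieldType) (F : closedFieldType) (m : nat).
Variable sg : mx_representation F (GL2 k) m.
Hypothesis irr : mx_irreducible sg.
Variables (psi omega J : k -> F) (P : 'M[F]_(#|kx k|, m)).
Hypothesis ac : additive_char psi.
Hypothesis q0 : (#|k|)%:R != 0 :> F.
Hypothesis mo : multiplicative_char omega.
Hypothesis KD : kirillov_data sg psi omega J P.
Variables (L : finFieldType) (iota : {rmorphism k -> L}).
Hypothesis cardL : #|L| = (#|k| ^ 2)%N.
Implicit Types (a b c d s n u : k) (t v : L).
Local Notation q := ((#|k|)%:R : F).
Local Notation Nm := (Nm iota).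
Local Notation Tr := (Tr iota).
Local Notation fconj := (fconj k).
Local Notation T := (Tfun psi omega J).

(** [omega] moved to the nonzero elements of [iota k] and extended by 0; it accounts for scalar
    matrices, whose trace is not given by [Tfun]. *)
Definition omega_ext t := \sum_(a | (a != 0) && (iota a == t)) omega a.

Lemma omega_ext_iota a : a != 0 -> omega_ext (iota a) = omega a.
Proof.
move=> a0; rewrite /omega_ext (bigD1 a) /= ?a0 ?eqxx // big1 ?addr0 // => b.
by rewrite (inj_eq (fmorph_inj iota)) => /andP [/andP [_ /eqP ->]]; rewrite eqxx.
Qed.

Lemma omega_ext_nonsplit t : fconj t != t -> omega_ext t = 0.
Proof.
move=> nt; rewrite /omega_ext big_pred0 // => a; apply/andP => -[_ /eqP e].
by move: nt; rewrite -e fconj_iota eqxx.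
Qed.

(** Multiply the class sum of [t] by an element [h] with the characteristic polynomial of [t']:
    since the class sum is a scalar, the trace is [q] times the left side. Term by term, all
    products have determinant [n * n'] and their traces are distributed by [sum_conic], whose full
    sum dies by [Tfun_sum]. *)
Lemma Tfun_mul t t' : fconj t != t -> fconj t' != t' ->
  T (Tr t) (Nm t) * T (Tr t') (Nm t') =
  - T (Tr (t * t')) (Nm (t * t')) - T (Tr (t * fconj t')) (Nm (t * fconj t'))
  + omega_ext (t * t') + omega_ext (t * fconj t').
Proof.
move=> nt nt'.
set s := Tr t; set n := Nm t; set s' := Tr t'; set n' := Nm t'.
have t0 : t != 0 by apply: contraNneq nt => ->; rewrite fconj_eq0.
have t0' : t' != 0 by apply: contraNneq nt' => ->; rewrite fconj_eq0.
have n0 : n != 0 by rewrite Nm_eq0.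
have n0' : n' != 0 by rewrite Nm_eq0.
have hn : 0 * s' - - n' * 1 != 0 by rewrite mul0r sub0r mulr1 opprK.
pose h : {'GL_2[k]} := gl 0 (- n') 1 s'.
have trh : \tr (sg h) = T s' n'.
  by rewrite (trace_cell ac mo KD) ?oner_neq0 //; congr (T _ _); ring.
have nsplit a d : a + d = s -> a * d <> n by exact: (nonsplit_charpoly cardL nt).
have E : \sum_(g | (\tr (GLval g) == s) && (\det (GLval g) == n)) \tr (sg (g * h)%g) =
   q * T s n * T s' n'.
  transitivity (\tr ((\sum_(g | (\tr (GLval g) == s) && (\det (GLval g) == n)) sg g) *m sg h)).
    rewrite mulmx_suml raddf_sum; apply: eq_bigr => g _.
    by rewrite GL2_reprM.
  by rewrite (class_sum irr ac mo KD nsplit) mul_scalar_mx mxtraceZ trh.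
rewrite sum_GL2_charpoly // in E.
have hd c d : c != 0 -> (s - d) * d - ((s - d) * d - n) / c * c = n by move=> c0; field.
pose Sf c d := ((s - d) * d - n) / c - c * n' + d * s'.
(* At a scalar the trace is [q - 1] times [omega], while [Tfun] gives [- omega], hence the excess
   [q] times [omega]. The scalar in question is [- n / c]. *)
pose corr c d := if (d == 0) && ((n == n' * c ^+ 2) && (s * n' * c == - (n * s')))
  then q * omega (- n / c) else 0.
have term c d : c != 0 -> \tr (sg (gl (s - d)%R (((s - d) * d - n) / c)%R c d * h)%g) =
    T (Sf c d) (n * n') + corr c d.
  move=> c0; rewrite glM ?hd //.
  have [d0 | d0] := eqVneq d 0.
    rewrite /corr /Sf d0 eqxx /=.
    have e1 : c * 0 + 0 * 1 = 0 :> k by ring.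
    rewrite e1.
    set A := _ * 0 + _; set B := _ * - n' + _; set D := c * _ + _.
    have A0 : A = - n / c by rewrite /A; ring.
    have B0 : B = - (s * n' * c + n * s') / c by rewrite /B; field.
    have D0 : D = - (c * n') by rewrite /D; ring.
    have Anz : A != 0 by rewrite A0 mulf_neq0 ?oppr_eq0 ?invr_eq0.
    have Dnz : D != 0 by rewrite D0 oppr_eq0 mulf_neq0.
    rewrite (trace_borel ac KD) //.
    have -> : ((s - 0) * 0 - n) / c - c * n' + 0 * s' = A + D by rewrite A0 D0; ring.
    have -> : n * n' = A * D by rewrite A0 D0; field.
    rewrite (Tfun_split ac mo KD) //.
    have -> : (A == D) = (n == n' * c ^+ 2).
      rewrite A0 D0 -(inj_eq (mulIf c0)) divfK // mulNr eqr_opp; congr (_ == _); ring.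
    have -> : (B == 0) = (s * n' * c == - (n * s')).
      by rewrite B0 mulf_eq0 invr_eq0 (negPf c0) orbF oppr_eq0 addr_eq0.
    case: (n == _) => /=; last by rewrite addr0.
    by case: ifP => _; rewrite -?A0; ring.
  rewrite (trace_cell ac mo KD).
  - rewrite /corr (negPf d0) addr0; congr (T _ _); rewrite /Sf; first by ring.
    by field.
  - by rewrite mulr0 add0r mulr1.
  - by apply: contra_neq (mulf_neq0 n0 n0') => e; rewrite -[RHS]e; field.
have {}E : \sum_(c | c != 0) \sum_d T (Sf c d) (n * n') + \sum_(c | c != 0) \sum_d corr c d =
   q * T s n * T s' n'.
  rewrite -E -big_split; apply: eq_bigr => c c0 /=; rewrite -big_split /=.
  by apply: eq_bigr => d _; rewrite term.
rewrite (sum_conic iota cardL nt nt' (fun S => T S (n * n'))) Tfun_sum // mul0rn sub0r in E.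
(* The scalar [a] arises exactly when [iota a / t'] has the characteristic polynomial of [t], that
   is, equals [t] or its conjugate. *)
have Ecorr : \sum_(c | c != 0) \sum_d corr c d = q * (omega_ext (t * t') + omega_ext (t * fconj t')).
  transitivity (\sum_(c | c != 0) corr c 0).
    apply: eq_bigr => c _; rewrite (bigD1 0) //= big1 ?addr0 // => d d0.
    by rewrite /corr (negPf d0).
  transitivity (q * \sum_(a | (a != 0) && ((iota a == t * t') || (iota a == t * fconj t'))) omega a).
    rewrite (reindex_onto (fun a => - n / a) (fun c => - n / c)) => [|c c0]; last first.
      fld.
    rewrite mulr_sumr /corr eqxx /= big_mkcond [RHS]big_mkcond /=; apply: eq_bigr => a _.
    have [a0 | a0] := eqVneq a 0.
      by rewrite a0 invr0 mulr0 eqxx.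
    rewrite mulf_neq0 ?oppr_eq0 ?invr_eq0 //.
    have -> : - n / (- n / a) = a by fld.
    rewrite eqxx /=; congr (if _ then _ else _).
    have ia0 : iota a != 0 by rewrite fmorph_eq0.
    have c1 : (n == n' * (- n / a) ^+ 2) = (a ^+ 2 == n * n').
      apply/eqP/eqP => [e | e].
        apply: (mulfI n0); rewrite {1}e; fld.
      by rewrite expr_div_n e sqrrN; field; rewrite n0 n0'.
    have c2 : (s * n' * (- n / a) == - (n * s')) = (s * n' == a * s').
      apply/eqP/eqP => [e | e].
        apply: (mulfI n0); have := congr1 (fun z => - (z * a)) e.
        by rewrite -mulrA divfK // => e'; rewrite mulrC -[LHS]opprK -mulrN e'; ring.
      by rewrite e; field.
    rewrite c1 c2; apply/andP/orP => [[/eqP e1 /eqP e2] | e].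
      have Nu : Nm (iota a / t') = n.
        by rewrite NmM // NmV // Nm_iota // -/n' e1 mulfK.
      have Tu : Tr (iota a / t') = s.
        have -> : iota a / t' = iota (a / n') * fconj t'.
          by rewrite fmorph_div /n' NmE //; field; rewrite ?fconj_eq0 ?t0'.
        rewrite TrZ // Tr_conj // -/s'; apply: (mulIf n0'); rewrite e2.
        by field.
      have [e|e] := same_charpoly cardL Tu Nu.
        by left; apply/eqP; rewrite -e divfK.
      right; apply/eqP; have Et : t = fconj (iota a / t') by rewrite e fconjK.
      rewrite [in RHS]Et fconjM fconj_iota fconjV divfK //.
      by rewrite expf_neq0.
    have sym v v' : v != 0 -> iota a = v * v' -> a ^+ 2 = Nm v * Nm v' /\ Tr v * Nm v' = a * Tr v'.
      move=> v0 e1; split; first by rewrite -(Nm_iota iota cardL) e1 NmM.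
      apply: (fmorph_inj iota); rewrite !rmorphM !TrE // NmE // e1.
      have := fconj_iota iota a; rewrite e1 fconjM => e2.
      transitivity (v * v' * fconj v' + (fconj v * fconj v') * v'); first by ring.
      by rewrite e2; ring.
    have [|] := orP (introT orP e) => /eqP e'.
      by have [-> ->] := sym _ _ t0 e'.
    by have := sym _ _ t0 e'; rewrite Nm_conj // Tr_conj // => -[-> ->].
  congr (_ * _); rewrite /omega_ext.
  rewrite (bigID (fun a => iota a == t * t')) /=; congr (_ + _); apply: eq_bigl => a.
    by rewrite -andbA; case: (iota a == t * t'); rewrite ?orbT ?andbT ?andbF.
  rewrite -andbA; congr (_ && _); case: eqP => [-> /= | _]; last by rewrite andbT.
  by rewrite (negPf (mul_conj_neq nt nt')).

rewrite Ecorr in E.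
have mm : Nm (t * t') = n * n' by rewrite NmM.
have mm' : Nm (t * fconj t') = n * n' by rewrite NmM // Nm_conj.
rewrite mm mm'; apply: (mulfI q0); rewrite mulrA -E; ring.
Qed.

(* Turns out to be [theta t + theta (fconj t)]. *)
Definition D2 t := omega_ext t - T (Tr t) (Nm t).

Lemma D2_iota a : a != 0 -> D2 (iota a) = omega a + omega a.
Proof.
move=> a0; rewrite /D2 omega_ext_iota // Tr_iota // Nm_iota // expr2.
by rewrite (Tfun_split ac mo KD) // eqxx opprK.
Qed.

Lemma D2_scale a t : a != 0 -> D2 (iota a * t) = omega a * D2 t.
Proof.
move=> a0; rewrite /D2 TrZ // NmM // Nm_iota // Tfun_scale // mulrBr; congr (_ - _).
case: (eqVneq (fconj t) t) => [/(fconj_iotaP iota) [b ->] | nt]; last first.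
  rewrite !omega_ext_nonsplit ?mulr0 // fconjM fconj_iota.
  by apply: contra_neq nt; apply: mulfI; rewrite fmorph_eq0.
have [-> | b0] := eqVneq b 0; last first.
  by rewrite -rmorphM !omega_ext_iota ?mulf_neq0 // (mcharM mo).
rewrite rmorph0 mulr0 /omega_ext big_pred0 ?mulr0 // => c.
by rewrite fmorph_eq0; case: eqP.
Qed.

Lemma D2_conj t : D2 (fconj t) = D2 t.
Proof.
rewrite /D2 Tr_conj // Nm_conj //; congr (_ - _); apply: eq_bigl => a; congr (_ && _).
by apply/eqP/eqP => [e | <-]; rewrite ?fconj_iota // -[t](fconjK cardL) -e fconj_iota.
Qed.

Lemma D2_mul t t' : t != 0 -> fconj t' != t' ->
  D2 t * D2 t' = D2 (t * t') + D2 (t * fconj t').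
Proof.
move=> t0 nt'; case: (eqVneq (fconj t) t) => [/(fconj_iotaP iota) [a Ea] | nt].
  have a0 : a != 0 by rewrite -(fmorph_eq0 iota) -Ea.
  by rewrite Ea !D2_scale // D2_conj D2_iota // mulrDl.
rewrite /D2 !(omega_ext_nonsplit nt) !(omega_ext_nonsplit nt') !sub0r mulrNN Tfun_mul //.
by ring.
Qed.

Variable zeta : L.
Hypotheses (zeta0 : zeta != 0) (zetaP : forall t, t != 0 -> exists i, t = zeta ^+ i).

Lemma zeta_nonsplit : fconj zeta != zeta.
Proof.
apply/eqP => /(fconj_iotaP iota) [a Ea].
have : (#|L| <= #|k|)%N.
  apply: (leq_trans _ (leq_image_card iota k)); apply/subset_leq_card/subsetP => t _.
  have [-> | /zetaP [i ->]] := eqVneq t 0; first by rewrite -(rmorph0 iota) codom_f.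
  by rewrite Ea -rmorphXn codom_f.
by rewrite cardL leqNgt -{1}(expn1 #|k|) ltn_exp2l ?finNzRing_gt1.
Qed.

(* D2 satisfies d'Alembert's functional equation, hence on powers of the
   generator it is a sum of two geometric progressions. *)
Lemma cuspidal_theta : exists theta : L -> F,
  [/\ multiplicative_char theta,
      forall a, a != 0 -> theta (iota a) = omega a,
      forall s n, n != 0 -> T s n = - \sum_(t | (Tr t == s) && (Nm t == n)) theta t,
      forall u, u != 0 -> J u = - q^-1 * \sum_(t | Nm t == u) psi (Tr t) * theta t &
      forall u, u != 0 -> \sum_(t | Nm t == u) theta t = 0].
Proof.
pose g := Nm zeta; have g0 : g != 0 by rewrite Nm_eq0.
pose w := omega g; have w0 : w != 0 := mchar_neq0 mo g0.
(* The roots are to be [theta zeta] and [theta (fconj zeta)]: their sum is [D2 zeta] and their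
   product [omega (Nm zeta)]. *)
pose p : {poly F} := 'X^2 - D2 zeta *: 'X + w%:P.
have sp : size p = 3.
  rewrite /p -addrA size_polyDl size_polyXn // (leq_ltn_trans (size_polyD _ _)) // gtn_max size_polyN.
  rewrite (leq_ltn_trans (size_scale_leq _ _)) ?size_polyX //=.
  by rewrite (leq_ltn_trans (size_polyC_leq1 _)).
have [|z /eqP rz] := closed_rootP p _; first by rewrite sp.
rewrite !hornerE in rz.
pose z' := D2 zeta - z.
have zz : z + z' = D2 zeta by rewrite addrC subrK.
have zw : z * z' = w.
  by apply/eqP; rewrite -subr_eq0 -oppr_eq0 -[X in _ == X]rz; apply/eqP; rewrite /z'; ring.
have z0 : z != 0 by apply: contraNneq w0 => e; rewrite -zw e mul0r.
have pow i : D2 (zeta ^+ i) = z ^+ i + z' ^+ i /\ D2 (zeta ^+ i.+1) = z ^+ i.+1 + z' ^+ i.+1.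
  elim: i => [|i [IH1 IH2]].
    by rewrite !expr0 !expr1 zz -(rmorph1 iota) D2_iota ?oner_neq0 // (mchar1 mo).
  split=> //; have := D2_mul (expf_neq0 i.+1 zeta0) zeta_nonsplit.
  have -> : zeta ^+ i.+1 * fconj zeta = iota g * zeta ^+ i.
    by rewrite NmE // exprSr; ring.
  rewrite D2_scale // -exprSr IH1 IH2 -zz -/w -zw => e.
  apply: (addIr (z * z' * (z ^+ i + z' ^+ i))); rewrite -e !exprS; ring.
have powE i : D2 (zeta ^+ i) = z ^+ i + z' ^+ i by have [] := pow i.
have wq : w ^+ #|k| = w by rewrite /w -(mcharX mo) // expf_card.
have sumq : z ^+ #|k| + z' ^+ #|k| = z + z'.
  by rewrite -powE -/(fconj zeta) D2_conj zz.
have prodq : z ^+ #|k| * z' ^+ #|k| = z * z' by rewrite -exprMn zw wq.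
have dbl : z ^+ #|k| * z + z' ^+ #|k| * z' = z * z' + z * z'.
  rewrite -!exprSr -powE.
  have -> : zeta ^+ #|k|.+1 = iota g by rewrite /g NmExp.
  by rewrite D2_iota // -/w zw.
(* The [q]-th power preserves the sum and product of the two roots, so it fixes or swaps them; if it
   fixes them, [dbl], which is the value at [zeta ^+ #|k|.+1], forces [z = z']. *)
have zq : z ^+ #|k| = z'.
  have : (z ^+ #|k| - z) * (z ^+ #|k| - z') = 0.
    have -> : (z ^+ #|k| - z) * (z ^+ #|k| - z') = z ^+ #|k| * (z ^+ #|k| - (z + z')) + z * z' by ring.
    by rewrite -sumq -prodq; ring.
  move/eqP; rewrite mulf_eq0 !subr_eq0 => /orP [/eqP e1 | /eqP //].
  have e2 : z' ^+ #|k| = z' by apply: (addrI z); rewrite -{1}e1.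
  rewrite e1 e2 in dbl; rewrite e1; apply/eqP; rewrite -subr_eq0 -sqrf_eq0.
  have -> : (z - z') ^+ 2 = (z * z + z' * z') - (z * z' + z * z') by ring.
  by rewrite dbl subrr.
have zq' : z' ^+ #|k| = z by move: sumq; rewrite zq addrC => /addIr.
have zN : z ^+ #|L|.-1 = 1.
  apply: (mulfI z0); rewrite -exprS prednK; last by rewrite (leq_trans _ (finNzRing_gt1 L)).
  by rewrite cardL expnS expn1 exprM zq zq' mulr1.
have [theta [mt tE]] := mul_char_exists zeta0 zetaP zN.
have tconj t : t != 0 -> D2 t = theta t + theta (fconj t).
  move=> /zetaP [i ->]; rewrite powE tE; congr (_ + _).
  have -> : fconj (zeta ^+ i) = zeta ^+ (i * #|k|) by rewrite [RHS]exprM.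
  by rewrite tE mulnC exprM zq.
have tio a : a != 0 -> theta (iota a) = omega a.
  move=> a0; have [i ->] := Nm_generator iota cardL zeta0 zetaP a0.
  rewrite rmorphXn NmExp // -exprM tE exprM (mcharX mo) // exprSr zq mulrC zw.
  by [].
have Tsum s n : n != 0 -> T s n = - \sum_(t | (Tr t == s) && (Nm t == n)) theta t.
  move=> n0.
  case: (pickP (fun p : k * k => (p.1 + p.2 == s) && (p.1 * p.2 == n))) => [[a d] /= /andP [/eqP Es /eqP En] | no].
    have [a0 d0] : a != 0 /\ d != 0 by apply/andP; rewrite -negb_or -mulf_eq0 En.
    rewrite -Es -En (Tfun_split ac mo KD) //.
    have root t : (Tr t == a + d) && (Nm t == a * d) -> t = iota a.
      move=> /andP [/eqP Et /eqP Ent].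
      have : (iota a - t) * (iota a - fconj t) = 0.
        by rewrite -sub_charpoly // Et Ent -(rmorph0 iota); congr (iota _); ring.
      move=> /eqP; rewrite mulf_eq0 !subr_eq0 => /orP [] /eqP e //.
      by rewrite -{1}[t](fconjK cardL) -e fconj_iota.
    case: eqP => [ad | /eqP ad].
      rewrite (bigD1 (iota a)) /=; last by rewrite Tr_iota // Nm_iota // expr2 -ad !eqxx.
      by rewrite tio // big1 ?addr0 // => t /andP [/root ->]; rewrite eqxx.
    rewrite big_pred0 ?oppr0 // => t; apply/negP => /[dup] /root ->; rewrite Tr_iota //.
    by case/andP => /eqP /addrI e; rewrite e eqxx in ad.
  have [|t0 [Et En]] := charpoly_split iota cardL (s := s) (n := n).
    by move=> a d Es En; have := no (a, d); rewrite /= Es En !eqxx.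
  have nt0 : fconj t0 != t0.
    apply/eqP => /(fconj_iotaP iota) [b Eb]; have := no (b, b).
    by rewrite /= -Et -En Eb Tr_iota // Nm_iota // expr2 !eqxx.
  have t00 : t0 != 0 by apply: contraNneq nt0 => ->; rewrite fconj_eq0.
  have := tconj t0 t00; rewrite /D2 omega_ext_nonsplit // sub0r Et En => e.
  rewrite -[LHS]opprK e (bigD1 t0) /= ?Et ?En ?eqxx //.
  rewrite (bigD1 (fconj t0)) /= ?Tr_conj ?Nm_conj ?Et ?En ?eqxx //.
  rewrite big1 ?addr0 // => t /andP [/andP [/andP [/eqP Et' /eqP En'] n1] n2].
  have [|| e1 | e1] := @same_charpoly _ _ iota cardL t0 t; rewrite ?Et ?En //.
    by rewrite e1 eqxx in n1.
  by rewrite e1 eqxx in n2.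
(* The [T s u] with [u] fixed add up to 0 by [Tfun_sum]; this is the form in which the regularity of
   [theta] survives over [F]. *)
have sum0 u : u != 0 -> \sum_(t | Nm t == u) theta t = 0.
  move=> u0; have := Tfun_sum omega J ac u; rewrite (eq_bigr _ (fun s _ => Tsum s u u0)) sumrN => /eqP.
  rewrite oppr_eq0 => /eqP e; rewrite -[RHS]e (partition_big Tr xpredT) //=.
  by apply: eq_bigr => s _; apply: eq_bigl => t; rewrite andbC.
exists theta; split=> // u u0.
rewrite (Tfun_fourier J ac q0 mo) mulNr -mulrN; congr (_ * _).
rewrite (partition_big Tr xpredT) //= -sumrN; apply: eq_bigr => s _.
rewrite Tsum // mulrN mulr_sumr; congr (- _); apply: eq_big => t; first by rewrite andbC.
by case/andP => /eqP ->.
Qed.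

End Classification.

(** * Lifting cuspidal representations *)

(** A proper simple [SL2]-submodule is a sum of weight lines, and [gd c c^-1] multiplies weights by
    squares, so its weights form one class modulo squares. As [W] preserves it, the kernel vanishes
    between its class and [g] times its class. *)
Lemma reducible_J (k : finFieldType) (F : closedFieldType) m
    (sg : mx_representation F (GL2 k) m) (psi omega J : k -> F) (P : 'M[F]_(#|kx k|, m)) (g : k) :
  mx_irreducible sg -> additive_char psi -> (#|k|)%:R != 0 :> F ->
  multiplicative_char omega -> kirillov_data sg psi omega J P ->
  wproj sg psi 0 = 0 -> g != 0 -> (forall x, x != 0 -> exists i, x = g ^+ i) ->
  ~ mx_irreducible (subg_repr sg (normal_sub (SL2_normal k))) ->
  forall x, x != 0 -> J (g * x ^+ 2) = 0.
Proof.
move=> irr ac q0 mo [fP fuP hU hD hW] cusp g0 gP red.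
set sS := normal_sub _ in red.
pose v (x : kx k) := kvec x *m P.
have wv x : has_weight sg psi (val x) (v x).
  by move=> b; rewrite /v -mulmxA -hU mulmxA kvec_mono -scalemxAl.
have vsum (w : 'rV_#|kx k|) : w *m P = \sum_x w 0 (enum_rank x) *: v x.
  rewrite mulmx_sum_row (reindex (@enum_rank (kx k))) /=; last exact: onW_bij (@enum_rank_bij _).
  by apply: eq_bigr => x _; rewrite /v -rowE.
have vproj (w : 'rV_#|kx k|) (y : kx k) : w *m P *m wproj sg psi (val y) = w 0 (enum_rank y) *: v y.
  rewrite vsum mulmx_suml (bigD1 y) //= -scalemxAl (wproj_weight ac q0 (wv y)).
  by rewrite big1 ?addr0 // => x xy; rewrite -scalemxAl (wproj_weight0 ac _ (wv x)) ?scaler0.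
have [_ nz1 _] := irr.
have [M sM _] := classicallyP (mxsimple_exists (mxmodule1 (subg_repr sg sS)) nz1).
have [modM M0 minM] := sM.
have MS h : h \in SL2 k -> (M *m sg h <= M)%MS by move=> Sh; exact: (mxmoduleP modM h Sh).
have Mproj (u : 'rV_m) x : (u <= M)%MS -> (u *m wproj sg psi x <= M)%MS.
  move=> uM; rewrite /wproj -scalemxAr scalemx_sub // mulmx_sumr summx_sub // => b _.
  rewrite -scalemxAr scalemx_sub //; apply: submx_trans (MS _ (gu_in_SL b)).
  exact: submxMr.
have vM c (y : kx k) : c != 0 -> (c *: v y <= M)%MS = (v y <= M)%MS.
  by move=> c0; rewrite (eqmx_scale _ c0).
have [a va] : exists a, (v a <= M)%MS.
  have /rowV0Pn [u uM u0] := M0.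
  have /submxP [w Ew] : (u <= P)%MS by apply: submx_trans (submx1 _) _; rewrite sub1mx.
  have [y wy] : exists y, w 0 (enum_rank y) != 0.
    apply/existsP; apply: contraNT u0; rewrite negb_exists => /forallP no.
    by rewrite Ew vsum big1 // => x _; have := no x; rewrite negbK => /eqP ->; rewrite scale0r.
  by exists y; rewrite -(vM _ y wy) -vproj -Ew Mproj.
have Dsq (y : kx k) c : c != 0 -> (v y <= M)%MS -> (v (kx_scale c c^-1 y) <= M)%MS.
  move=> c0 vy; have Vc0 : c^-1 != 0 by rewrite invr_eq0.
  have : (v y *m sg (gd c c^-1) <= M)%MS.
    by apply: submx_trans (MS _ (gd_in_SL c0)); exact: submxMr.
  by rewrite /v -mulmxA -hD // mulmxA kvec_mono -scalemxAl vM // (mchar_neq0 mo).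
have full : ~ (forall y, (v y <= M)%MS).
  move=> all; apply: red; have M1 : (M :=: 1%:M)%MS.
    apply/eqmxP; rewrite submx1 /=; rewrite -sub1mx in fuP; apply: submx_trans fuP _.
    by apply/row_subP => i; rewrite rowE -[i]enum_valK all.
  split; [exact: mxmodule1 | exact: nz1 | move=> N modN _ N0].
  by rewrite -M1; apply: minM => //; rewrite M1 submx1.
have gns (y : kx k) x : x != 0 -> val y = val a * g * x ^+ 2 -> ~~ (v y <= M)%MS.
  move=> x0 Ey; apply/negP => vy; apply: full => z.
  have [i Ei] := gP (val z / val a) (mulf_neq0 (kx_neq0 z) (invr_neq0 (kx_neq0 a))).
  have g20 : g ^+ i./2 != 0 by rewrite expf_neq0.
  have Ez : val z = val a * (g ^+ odd i * g ^+ i./2 * g ^+ i./2).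
    by rewrite -mulrA -exprD addnn -exprD odd_double_half -Ei mulrC divfK ?kx_neq0.
  case: (odd i) Ez => Ez; rewrite ?expr1 ?expr0 in Ez.
    have c0 : g ^+ i./2 / x != 0 by rewrite mulf_neq0 ?invr_eq0.
    have -> : z = kx_scale (g ^+ i./2 / x) (g ^+ i./2 / x)^-1 y.
      apply: val_inj; rewrite val_kx_scale ?invr_eq0 // Ey Ez; fld.
    exact: Dsq.
  have -> : z = kx_scale (g ^+ i./2) (g ^+ i./2)^-1 a.
    apply: val_inj; rewrite val_kx_scale ?invr_eq0 // Ez; fld.
  exact: Dsq.
move=> x x0; have a0 := kx_neq0 a.
have y0 : val a * g * (x / val a) ^+ 2 \in predC1 0.
  by rewrite inE !mulf_neq0 ?expf_neq0 ?mulf_neq0 ?invr_eq0.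
pose y : kx k := Sub (val a * g * (x / val a) ^+ 2) y0.
have nvy : ~~ (v y <= M)%MS by apply: (gns y (x / val a)); rewrite ?mulf_neq0 ?invr_eq0.
have : (v a *m sg (gw k) *m wproj sg psi (val y) <= M)%MS.
  apply: Mproj; apply: submx_trans (MS _ (gw_in_SL k)); exact: submxMr.
rewrite {1}/v -(mulmxA _ P) -hW mulmxA vproj kvec_kmx summxE (bigD1 y) //= big1 => [|z zy]; last first.
  by rewrite mxE kvec_coord (negPf zy) mulr0.
rewrite addr0 mxE kvec_coord eqxx mulr1.
have -> : val a * (val a * g * (x / val a) ^+ 2) = g * x ^+ 2 by fld.
apply: contraTeq => J0; rewrite vM // mulf_neq0 // invr_eq0.
exact: (mchar_neq0 mo (kx_neq0 y)).
Qed.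

(** * Lifting roots of unity along the reduction *)

Section Lifting.
Variables (k : finFieldType) (p l : nat) (K F : closedFieldType) (O : {pred K}) (red : K -> F).
Hypotheses (pk : p \in [pchar k]) (l_pr : prime l) (lp : l != p).
Hypotheses (K0 : [pchar K] =i pred0) (lF : l \in [pchar F]).
Hypothesis RD : residue_data O red.

Lemma pcharK_nat n : (0 < n)%N -> n%:R != 0 :> K.
Proof. by move=> n0; rewrite (pcharf0P _).1 // -lt0n. Qed.

Lemma pF_neq0 : p%:R != 0 :> F.
Proof.
rewrite -(dvdn_pcharf lF) dvdn_prime2 ?(pcharf_prime pk) //.
Qed.

Lemma card_k_pow : exists n, #|k| = (p ^ n)%N.
Proof.
exists (logn p #|k|); have := pprimeChar_pgroup pk; rewrite /pgroup cardsT => h.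
by rewrite -[LHS](part_pnat_id h) p_part.
Qed.

Lemma qF_neq0 : (#|k|)%:R != 0 :> F.
Proof. by have [n ->] := card_k_pow; rewrite natrX expf_neq0 // pF_neq0. Qed.

Lemma qK_neq0 : (#|k|)%:R != 0 :> K.
Proof. by apply: pcharK_nat; rewrite (leq_trans _ (finNzRing_gt1 k)). Qed.

Lemma OV_unit x : x \in O -> red x != 0 -> x^-1 \in O.
Proof.
move=> Ox; apply: contraNT => nOx; apply/eqP.
by case: RD => _ [_ _ _ h _]; apply/h => //; right.
Qed.

Lemma redV x : x \in O -> red x != 0 -> red x^-1 = (red x)^-1.
Proof.
move=> Ox rx; have OVx := OV_unit Ox rx; apply: (mulfI rx).
rewrite -(redM RD) // mulfV ?mulfV ?(red1 RD) //.
by apply: contraNneq rx => ->; rewrite (red0 RD).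
Qed.

(** [P] splits over the closed field [K] and its roots, being roots of unity, are integral. The
    reduced product of the [x - r] vanishes, so some factor reduces to 0. *)
Lemma lift_root (P : {poly K}) N x : P \is monic -> (0 < N)%N ->
  (forall r, root P r -> r ^+ N = 1) -> x \in O -> red P.[x] = 0 ->
  exists r, [/\ root P r, r \in O & red r = red x].
Proof.
move=> mP N0 hP Ox rP; have [rs Ers] := closed_field_poly_normal P.
rewrite (monicP mP) scale1r in Ers.
have Ors r : r \in rs -> r \in O.
  by move=> rrs; apply: (Oroot RD N0); apply: hP; rewrite Ers root_prod_XsubC.
have Px : P.[x] = \prod_(r <- rs) (x - r).
  by rewrite Ers horner_prod; apply: eq_bigr => r _; rewrite !hornerE.
have : \prod_(r <- rs) (red x - red r) == 0.
  rewrite -rP Px big_seq [X in _ == red X]big_seq (redprod RD) => [|r rrs]; last first.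
    by rewrite (OB RD) // Ors.
  by apply/eqP/eq_bigr => r rrs; rewrite (redB RD) // Ors.
rewrite prodf_seq_eq0 => /hasP [r rrs /=]; rewrite subr_eq0 => /eqP e.
by exists r; split; rewrite ?Ors // Ers root_prod_XsubC.
Qed.

(** [e] is a root of the quotient of ['X^p - 1] by ['X - 1]; as [p] is invertible in both [K] and
    [F], neither [e] nor its reduction is 1. *)
Lemma psi_pair : exists psiK : k -> K,
  [/\ additive_char psiK, forall x, psiK x \in O & additive_char (fun x => red (psiK x))].
Proof.
have p_pr := pcharf_prime pk; have p1 := prime_gt1 p_pr.
have [f fE] := additive_exponent pk.
pose P : {poly K} := \sum_(i < p) 'X^i.
have sP : size P = p.
  rewrite /P -(big_mkord xpredT (fun i => 'X^i)).
  case: (p) p1 => // n _; rewrite big_nat_recr //= addrC size_polyDl size_polyXn //.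
  rewrite ltnS; apply: (leq_trans (size_sum _ _ _)); apply/bigmax_leqP_seq => i.
  by rewrite mem_index_iota size_polyXn => /andP [].
have [|e re] := closed_rootP P _; first by rewrite sP gtn_eqF.
have Pe (R : fieldType) (z : R) : z != 1 \/ p%:R != 0 :> R -> \sum_(i < p) z ^+ i = 0 -> z ^+ p = 1 /\ z != 1.
  move=> h s0; split.
    by apply/eqP; rewrite -subr_eq0 subrX1 s0 mulr0.
  case: h => // pR; apply: contraNneq pR => z1; rewrite -s0 z1.
  by rewrite (eq_bigr (fun=> 1)) ?sumr_const ?card_ord // => i _; rewrite expr1n.
have s0 : \sum_(i < p) e ^+ i = 0.
  move: re; rewrite /root /P horner_sum => /eqP e0; rewrite -[RHS]e0.
  by apply: eq_bigr => i _; rewrite hornerXn.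
have [ep e1] := Pe K e (or_intror (pcharK_nat (prime_gt0 p_pr))) s0.
have Oe := Oroot RD (prime_gt0 p_pr) ep.
have [rep re1] : red e ^+ p = 1 /\ red e != 1.
  apply: Pe; first by right; exact: pF_neq0.
  transitivity (red (\sum_(i < p) e ^+ i)); last by rewrite s0 (red0 RD).
  rewrite (redsum RD) => [|i _]; last exact: (OX RD).
  by apply: eq_bigr => i _; rewrite (redX RD).
exists (fun x => e ^+ f x); split; first exact: fE.
  by move=> x; exact: (OX RD).
have [h1 h2 h3] := fE F (red e) rep re1.
split=> /= [|x y|]; [by rewrite (redX RD) | by rewrite !(redX RD) //; apply: h2 | ].
by have [x hx] := h3; exists x; rewrite (redX RD).
Qed.

End Lifting.

Section RootLifting.
Variables (K F : closedFieldType) (O : {pred K}) (red : K -> F).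
Hypothesis K0 : [pchar K] =i pred0.
Hypothesis RD : residue_data O red.

Lemma lift_unity_root n y : (0 < n)%N -> y ^+ n = 1 ->
  exists s, [/\ s ^+ n = 1, s \in O & red s = y].
Proof.
move=> n0 yn; have [x Ox Ex] := red_surj RD y.
have [|||s [rs Os Es]] := @lift_root K F O red RD ('X^n - 1%:P) n x _ n0 _ Ox.
- by rewrite monicXnsubC.
- by move=> r; rewrite /root !hornerE subr_eq0 => /eqP.
- by rewrite !hornerE (redB RD) ?(OX RD) ?(O1 RD) // (redX RD) // Ex yn (red1 RD) subrr.
exists s; split=> //; last by rewrite Es.
by move: rs; rewrite /root !hornerE subr_eq0 => /eqP.
Qed.

(** The reduced sum of the ['X^i] for [i < n] vanishes at [y], because [y != 1] or because [n] is 0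
    in [F]. In characteristic 0 it does not vanish at 1, so the lift differs from 1 even above
    [y = 1]. *)
Lemma lift_nontrivial_unity_root n y : (0 < n)%N -> y ^+ n = 1 -> (y = 1 -> n%:R = 0 :> F) ->
  exists s, [/\ s ^+ n = 1, s != 1, s \in O & red s = y].
Proof.
move=> n0 yn y1; have [x Ox Ex] := red_surj RD y.
pose P : {poly K} := \sum_(i < n) 'X^i.
have EP z : P.[z] = \sum_(i < n) z ^+ i.
  by rewrite /P horner_sum; apply: eq_bigr => i _; rewrite hornerXn.
have Pn z : root P z -> z ^+ n = 1.
  by rewrite /root EP => /eqP e; apply/eqP; rewrite -subr_eq0 subrX1 e mulr0.
have mP : P \is monic.
  have : 'X^n - 1%:P \is @monic K by rewrite monicXnsubC.
  by rewrite subrX1 (monicMl _ (monicXsubC 1)).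
have rP : red P.[x] = 0.
  rewrite EP (redsum RD) => [|i _]; last exact: (OX RD).
  have -> : \sum_(i < n) red (x ^+ i) = \sum_(i < n) y ^+ i.
    by apply: eq_bigr => i _; rewrite (redX RD) // Ex.
  have [e | ne] := eqVneq y 1.
    rewrite e (eq_bigr (fun=> 1)) => [|i _]; last by rewrite expr1n.
    by rewrite sumr_const card_ord y1.
  by apply: (mulfI (x := y - 1)); rewrite ?subr_eq0 // -subrX1 yn subrr mulr0.
have [s [rs Os Es]] := lift_root RD mP n0 Pn Ox rP.
exists s; split; rewrite ?Es ?Pn //.
apply: contraTneq rs => ->; rewrite /root EP (eq_bigr (fun=> 1)) => [|i _]; last by rewrite expr1n.
by rewrite sumr_const card_ord (pcharf0P _).1 // -lt0n.
Qed.

Lemma lift_root_over a b z s : (0 < a)%N -> (0 < b)%N -> s ^+ b = 1 -> s \in O ->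
  red s = z ^+ a -> exists r, [/\ r ^+ a = s, r \in O & red r = z].
Proof.
move=> a0 b0 sb Os Es; have [x Ox Ex] := red_surj RD z.
have ab0 : (0 < a * b)%N by rewrite muln_gt0 a0.
have [|||r [rr Or Er]] := @lift_root K F O red RD ('X^a - s%:P) (a * b) x _ ab0 _ Ox.
- by rewrite monicXnsubC.
- by move=> r; rewrite /root !hornerE subr_eq0 => /eqP e; rewrite exprM e.
- by rewrite !hornerE (redB RD) ?(OX RD) // (redX RD) // Ex Es subrr.
exists r; split=> //; last by rewrite Er.
by move: rr; rewrite /root !hornerE subr_eq0 => /eqP.
Qed.

End RootLifting.

Section CuspidalLift.
Variables (k : finFieldType) (K F : closedFieldType) (O : {pred K}) (red : K -> F).
Hypothesis K0 : [pchar K] =i pred0.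
Hypothesis RD : residue_data O red.
Hypothesis q0 : (#|k|)%:R != 0 :> F.
Variable psiK : k -> K.
Let psi x := red (psiK x).
Hypotheses (acK : additive_char psiK) (Opsi : forall x, psiK x \in O) (ac : additive_char psi).
Variables (m : nat) (sg : mx_representation F (GL2 k) m).
Hypothesis irr : mx_irreducible sg.
Local Notation sS := (normal_sub (SL2_normal k)).

Section WithTheta.
Variables (omega J : k -> F) (P : 'M[F]_(#|kx k|, m)).
Hypothesis mo : multiplicative_char omega.
Hypothesis KD : kirillov_data sg psi omega J P.
Variables (L : finFieldType) (iota : {rmorphism k -> L}).
Hypothesis cardL : #|L| = (#|k| ^ 2)%N.
Local Notation Nm := (Nm iota).
Local Notation Tr := (Tr iota).
Variable zeta : L.
Hypotheses (zeta0 : zeta != 0) (zetaP : forall t, t != 0 -> exists i, t = zeta ^+ i).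
Variable theta : L -> F.
Hypotheses (mt : multiplicative_char theta)
  (theta_om : forall a, a != 0 -> theta (iota a) = omega a)
  (theta_T : forall s n, n != 0 ->
     Tfun psi omega J s n = - \sum_(t | (Tr t == s) && (Nm t == n)) theta t)
  (theta_J : forall u, u != 0 ->
     J u = - (#|k|)%:R^-1 * \sum_(t | Nm t == u) psi (Tr t) * theta t)
  (theta_nt : forall u, u != 0 -> \sum_(t | Nm t == u) theta t = 0).

Let q1 : (1 < #|k|)%N := card_k_gt1 k.

Lemma card_L1 : #|L|.-1 = (#|k|.-1 * #|k|.+1)%N.
Proof. by clear -cardL; rewrite cardL -mulnn; case: (#|k|) (card_k_gt1 k) => // n _; lia. Qed.

Lemma zeta_prim : (#|k|.-1 * #|k|.+1).-primitive_root zeta.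
Proof. by rewrite -card_L1; exact: generator_primitive. Qed.

Lemma Nm_zeta_neq0 : Nm zeta != 0.
Proof. by rewrite Nm_eq0. Qed.

Lemma Nm_zeta_nonsquare y : odd #|k| -> Nm zeta != y ^+ 2.
Proof.
move=> odd_q; apply/eqP => e.
have gP := Nm_generator iota cardL zeta0 zetaP.
have pg := generator_primitive Nm_zeta_neq0 gP.
have y0 : y != 0 by apply: contraNneq Nm_zeta_neq0 => y0; rewrite e y0 expr0n.
have h : #|k|.-1 = (2 * #|k|.-1./2)%N by move: odd_q q1; lia.
have : Nm zeta ^+ #|k|.-1./2 = 1 by rewrite e -exprM -h expf_card1.
move/eqP; rewrite -(prim_order_dvd pg) => /dvdn_leq; move: h q1; lia.
Qed.

(** If [theta] is trivial on the norm one group, its sum there is [q + 1], which must vanish. In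
    this modular case a lift of [theta] of the same order would factor through the norm. *)
Lemma theta_trivial : theta zeta ^+ #|k|.-1 = 1 -> (#|k|.+1)%:R = 0 :> F.
Proof.
move=> z1; rewrite -(theta_nt (oner_neq0 k)) -(card_Nm iota cardL (oner_neq0 k)).
rewrite -sumr_const; apply: eq_big => [t | t]; rewrite !inE // => /eqP t1.
have t0 : t != 0 by rewrite -(Nm_eq0 iota cardL) t1 oner_eq0.
have [i Ei] := zetaP t0.
have := NmExp iota cardL t; rewrite t1 rmorph1 Ei -exprM => /esym/eqP.
rewrite -(prim_order_dvd zeta_prim) dvdn_pmul2r // => /dvdnP [j ->].
by rewrite (mcharX mt) // mulnC exprM z1 expr1n.
Qed.

(** By [reducible_J] the trace at [zeta] vanishes; it is minus the sum of [theta] at [zeta] and at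
    its conjugate, which gives the sign. *)
Lemma reducible_theta : wproj sg psi 0 = 0 -> ~ mx_irreducible (subg_repr sg sS) ->
  theta zeta ^+ #|k|.-1 = -1.
Proof.
move=> cusp nirr.
have gP := Nm_generator iota cardL zeta0 zetaP.
have J0 := reducible_J irr ac q0 mo KD cusp Nm_zeta_neq0 gP nirr.
have := theta_T (Tr zeta) Nm_zeta_neq0; rewrite /Tfun big1 => [|x x0]; last first.
  by rewrite J0 // mulr0 mul0r.
move/esym/eqP; rewrite oppr_eq0 (bigD1 zeta) ?eqxx //= (bigD1 (fconj k zeta)) /=; last first.
  by rewrite Tr_conj // Nm_conj // !eqxx (zeta_nonsplit iota cardL zetaP).
rewrite big1 => [|t /andP [/andP [/andP [/eqP et /eqP en] tz] tc]]; last first.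
  by have [e | e] := same_charpoly cardL et en; rewrite e eqxx in tz tc.
rewrite addr0 /fconj (mcharX mt) // -[#|k|](prednK (ltnW q1)) exprS.
rewrite -[X in X + _]mulr1 -mulrDr mulf_eq0 (negPf (mchar_neq0 mt zeta0)) /=.
by rewrite addrC addr_eq0 => /eqP.
Qed.

(** For even [q] the identity [(-1) ^+ #|k|.+1 = 1] would make 2, and then [q], zero in [F]. *)
Lemma reducible_odd : theta zeta ^+ #|k|.-1 = -1 -> odd #|k|.
Proof.
move=> e; case: (boolP (odd _)) => // ev.
have := mul_char_gen zeta0 mt; rewrite card_L1 exprM e -signr_odd /= ev /= expr1 => e1.
have two : 2%:R = 0 :> F by rewrite mulr2n -{1}e1 addNr.
case/negP: q0; rewrite -[#|k|]odd_double_half (negPf ev) add0n -mul2n natrM two mul0r //.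
Qed.

Section WithRoot.
Variables (r : K) (Or : r \in O) (Er : red r = theta zeta).
Hypotheses (r1 : r ^+ #|k|.-1 != 1) (rN : (r ^+ #|k|.-1) ^+ #|k|.+1 = 1).
Variable thetaK : L -> K.
Hypotheses (mtK : multiplicative_char thetaK) (thetaKX : forall i, thetaK (zeta ^+ i) = r ^+ i).

Lemma thetaK_O t : t != 0 -> thetaK t \in O.
Proof. by move=> /zetaP [i ->]; rewrite thetaKX (OX RD). Qed.

Lemma thetaK_red t : t != 0 -> red (thetaK t) = theta t.
Proof. by move=> /zetaP [i ->]; rewrite thetaKX (redX RD) // Er (mcharX mt). Qed.

Let NmE1 : Nm (zeta ^+ #|k|.-1) = 1.
Proof.
apply: (fmorph_inj iota); rewrite (NmExp iota cardL) -exprM rmorph1.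
exact: (prim_expr_order zeta_prim).
Qed.

(** Multiplication by [zeta ^+ #|k|.-1], of norm 1, permutes the fibre and scales the sum by
    [r ^+ #|k|.-1], which is not 1. *)
Lemma thetaK_nt u : u != 0 -> \sum_(t | Nm t == u) thetaK t = 0.
Proof.
move=> u0; set s := \sum_(t | _) _.
have e0 : zeta ^+ #|k|.-1 != 0 by rewrite expf_neq0.
have : r ^+ #|k|.-1 * s = s.
  rewrite /s mulr_sumr [RHS](reindex_inj (mulfI e0)) /=.
  apply: eq_big => [t | t /eqP tu]; first by rewrite (NmM iota cardL) NmE1 mul1r.
  rewrite (mcharM mtK) ?thetaKX // -(Nm_eq0 iota cardL) tu //.
move/eqP; rewrite -subr_eq0 -{2}[s]mul1r -mulrBl mulf_eq0 subr_eq0 (negPf r1) /=.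
by move/eqP.
Qed.

Let qK : (#|k|)%:R != 0 :> K := qK_neq0 k K0.
Let omK := central_char iota thetaK.
Let JK := Jsum iota psiK thetaK.
Let mom : multiplicative_char omK := central_mul_char iota mtK.

Lemma thetaK_system : GL2_system (kirU psiK) (kirD omK) (kirW omK JK).
Proof.
apply: kir_system => // x z x0 z0.
  exact: (Jsum_ww cardL acK mtK qK thetaK_nt).
exact: (Jsum_wuw cardL acK mtK qK thetaK_nt).
Qed.

Let om_O x : x != 0 -> omK x \in O.
Proof. by move=> x0; rewrite thetaK_O ?fmorph_eq0. Qed.

Let om_red x : x != 0 -> red (omK x) = omega x.
Proof. by move=> x0; rewrite thetaK_red ?fmorph_eq0 // theta_om. Qed.

Let rq : red (#|k|)%:R != 0. Proof. by rewrite (red_nat RD). Qed.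
Let Oq : - (#|k|)%:R^-1 \in O.
Proof. by rewrite (ON RD) // (OV_unit RD) ?(Onat RD). Qed.

Let J_O u : u != 0 -> JK u \in O.
Proof.
move=> u0; rewrite /JK /Jsum (OM RD) // (Osum RD) // => t /eqP tu.
by rewrite (OM RD) // thetaK_O // -(Nm_eq0 iota cardL) tu.
Qed.

Let J_red u : u != 0 -> red (JK u) = J u.
Proof.
move=> u0; rewrite /JK /Jsum theta_J //.
have Ot t : Nm t == u -> thetaK t \in O.
  by move=> /eqP tu; rewrite thetaK_O // -(Nm_eq0 iota cardL) tu.
rewrite (redM RD) //; last by rewrite (Osum RD) // => t tu; rewrite (OM RD) // Ot.
rewrite (redN RD) ?(OV_unit RD) ?(Onat RD) // (redV RD) ?(Onat RD) // (red_nat RD).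
rewrite (redsum RD) => [|t tu]; last by rewrite (OM RD) // Ot.
congr (_ * _); apply: eq_bigr => t tu; rewrite (redM RD) ?Ot // thetaK_red //.
by rewrite -(Nm_eq0 iota cardL) (eqP tu).
Qed.

Lemma thetaK_lifts : lifts O red (sys_repr thetaK_system) sg.
Proof.
have [fP fuP hU hD hW] := KD.
have omV (y : kx k) : (omK (val y))^-1 = omK (val y)^-1 by rewrite (mcharV mom) ?kx_neq0.
have V0 (y : kx k) : (val y)^-1 != 0 by rewrite invr_eq0 kx_neq0.
apply: (sys_lifts RD thetaK_system irr fP).
- by apply/card_gt0P; exists (Sub 1 (oner_neq0 k)).
- by move=> b; apply: (Omx_mono RD) => x.
- by move=> a d a0 d0; apply: (Omx_mono RD) => x; exact: om_O.
- by apply: Omx_kmx => x y; rewrite omV (OM RD) ?om_O ?J_O ?mulf_neq0 ?kx_neq0.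
- by move=> b; rewrite (red_mono RD) hU.
- move=> a d a0 d0; rewrite (red_mono RD) -hD //; congr (_ *m _).
  by apply: kvec_inj => x; rewrite !kvec_mono om_red.
- rewrite red_kmx -hW; congr (_ *m _); apply/matrixP => i j; rewrite !mxE.
  have n0 : val (enum_val i : kx k) * val (enum_val j : kx k) != 0 by rewrite mulf_neq0 ?kx_neq0.
  rewrite omV (redM RD) ?om_O ?J_O // om_red // J_red // (mcharV mo) ?kx_neq0 //.
Qed.

(** Conjugation of [t] multiplies [thetaK t] by [-1] when [Nm t] is not a square, so [JK] vanishes
    at nonsquares and [W] preserves square classes. The projection onto square weights then commutes
    with [SL2]. *)
Lemma thetaK_reducible : odd #|k| -> r ^+ #|k|.-1 = -1 ->
  ~ mx_irreducible (subg_repr (sys_repr thetaK_system) sS).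
Proof.
move=> odd_q rm1.
pose sq (u : k) := [exists y, u == y ^+ 2].
have J0 u : u != 0 -> ~~ sq u -> JK u = 0.
  move=> u0 nsq; rewrite /JK /Jsum; set s := \sum_(t | _) _.
  suff e : s = - s.
    have : 2%:R * s = 0 by rewrite mulr_natl mulr2n {1}e addNr.
    by move/eqP; rewrite mulf_eq0 (negPf (pcharK_nat K0 _)) //= => /eqP ->; rewrite mulr0.
  rewrite {1}/s (reindex_inj (inv_inj (fconjK cardL))) /= -sumrN.
  apply: eq_big => [t | t /eqP tu]; first by rewrite (Nm_conj iota cardL).
  have t0 : t != 0.
    by move: u0; rewrite -tu (Nm_conj iota cardL) (Nm_eq0 iota cardL).
  have [i Ei] := zetaP t0.
  rewrite (Tr_conj iota cardL) -mulrN; congr (_ * _).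
  have odd_i : odd i.
    apply: contraNT nsq => ev; apply/existsP; exists (Nm zeta ^+ i./2).
    rewrite -tu (Nm_conj iota cardL) Ei (NmX iota cardL) -exprM muln2.
    by rewrite -{1}(odd_double_half i) (negPf ev).
  rewrite /fconj (mcharX mtK) // Ei thetaKX -[#|k|](prednK (ltnW q1)) exprS -exprM mulnC.
  by rewrite exprM rm1 -signr_odd odd_i expr1 mulrN1.
have sqM x y : y != 0 -> sq x -> sq y = sq (x * y) \/ x = 0.
  move=> y0 /existsP [z /eqP Ez]; have [x0 | x0] := eqVneq x 0; [by right | left].
  have z0 : z != 0 by apply: contraNneq x0 => z0; rewrite Ez z0 expr0n.
  apply/existsP/existsP => -[w /eqP Ew].
    by exists (z * w); rewrite exprMn -Ez -Ew.
  by exists (w / z); rewrite exprMn -Ew exprVn -Ez mulrC mulKf.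
pose A : 'M[K]_#|kx k| := mono (fun x : kx k => (sq (val x))%:R) id.
apply: (sys_reducible (S := thetaK_system) (A := A)).
- by move=> b; apply: kvec_inj => x; rewrite !mulmxA !kvec_mono -!scalemxAl !kvec_mono !scalerA mulrC.
- move=> a a0; have Va0 : a^-1 != 0 by rewrite invr_eq0.
  apply: kvec_inj => x; rewrite !mulmxA !kvec_mono -!scalemxAl !kvec_mono !scalerA mulrC.
  congr (_ * _ *: _); rewrite val_kx_scale //; congr (nat_of_bool _)%:R.
  have sa : sq (a ^+ 2) by apply/existsP; exists a.
  have [e |/eqP] := sqM _ _ (kx_neq0 x) sa; last by rewrite expf_eq0 (negPf a0).
  by rewrite /= e; congr sq; rewrite invrK expr2 mulrC mulrA.
- apply: kvec_inj => x; rewrite !mulmxA kvec_mono -scalemxAl kvec_kirW mulmx_suml scaler_sumr.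
  apply: eq_bigr => y _; rewrite -scalemxAl kvec_mono !scalerA.
  have xy0 : val x * val y != 0 by rewrite mulf_neq0 ?kx_neq0.
  have J1 : sq (val x) != sq (val y) -> JK (val x * val y) = 0.
    move=> ne; apply: J0 => //; apply: contra ne => sxy; apply/eqP.
    case sx: (sq (val x)); last case sy: (sq (val y)) => //.
      have [-> // | /eqP] := sqM _ _ (kx_neq0 y) sx.
      by rewrite (negPf (kx_neq0 x)).
    have [|/eqP] := sqM _ _ (kx_neq0 x) sy; last by rewrite (negPf (kx_neq0 y)).
    by rewrite sx mulrC sxy.
  have [-> | ne] := eqVneq (sq (val x)) (sq (val y)); first by rewrite mulrC.
  by rewrite J1 // !(mulr0, mul0r).
- apply/negP => /is_scalar_mxP [a Ea].
  have ev (x : kx k) : a *: kvec x = (sq (val x))%:R *: kvec x :> 'rV[K]__.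
    by rewrite -mul_mx_scalar -Ea kvec_mono.
  have := ev (Sub 1 (oner_neq0 k)); have := ev (Sub (Nm zeta) Nm_zeta_neq0).
  have s1 : sq 1 by apply/existsP; exists 1; rewrite expr1n.
  have sz : ~~ sq (Nm zeta) by rewrite negb_exists; apply/forallP => y; exact: Nm_zeta_nonsquare.
  rewrite !SubK s1 (negPf sz) scale0r scale1r => /eqP.
  rewrite scaler_eq0 (negPf (kvec_neq0 _ _)) orbF => /eqP ->; rewrite scale0r => /esym/eqP.
  by rewrite (negPf (kvec_neq0 _ _)).
Qed.

End WithRoot.
End WithTheta.

Lemma cuspidal_lift : wproj sg psi 0 = 0 ->
  exists n (st : mx_representation K (GL2 k) n), lifts O red st sg /\
    (~ mx_irreducible (subg_repr sg sS) -> ~ mx_irreducible (subg_repr st sS)).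
Proof.
move=> cusp; have q1 := card_k_gt1 k.
have q10 : (0 < #|k|.-1)%N by rewrite -ltnS prednK // ltnW.
have [omega [J [P [mo KD]]]] := kirillov_model irr ac q0 cusp.
have [L [iota cardL]] := quadratic_extension k.
have [zeta zeta0 zetaP] := finField_generator L.
have [theta [mt tom tT tJ tnt]] := cuspidal_theta irr ac q0 mo KD iota cardL zeta0 zetaP.
have zN : (theta zeta ^+ #|k|.-1) ^+ #|k|.+1 = 1.
  by rewrite -exprM -(card_L1 cardL) (mul_char_gen zeta0 mt).
(* The value on a generator of the norm one group is lifted first, since both constraints, [s != 1]
   and [s = -1] in the reducible case, concern it alone. [lift_root_over] then finds [r] above
   [theta zeta] with [r ^+ #|k|.-1 = s]. *)
suff [s [sN s1 Os Es sred]] : exists s, [/\ s ^+ #|k|.+1 = 1, s != 1, s \in O,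
    red s = theta zeta ^+ #|k|.-1 &
    ~ mx_irreducible (subg_repr sg sS) -> odd #|k| /\ s = -1].
  have [r [Ers Or Er]] := lift_root_over RD q10 (ltn0Sn #|k|) sN Os Es.
  have rN : r ^+ #|L|.-1 = 1 by rewrite (card_L1 cardL) exprM Ers.
  have [thetaK [mtK tKX]] := mul_char_exists zeta0 zetaP rN.
  rewrite -Ers in s1.
  exists #|kx k|, (sys_repr (thetaK_system iota cardL zeta0 zetaP s1 mtK tKX)); split.
    exact: (thetaK_lifts mo KD cardL zeta0 zetaP mt tom tJ Or Er).
  by case/sred => odd_q sm1; apply: thetaK_reducible => //; rewrite Ers.
have [ir | nir] := classic (mx_irreducible (subg_repr sg sS)).
  have tt := theta_trivial cardL zeta0 zetaP mt tnt.
  have [s [h1 h2 h3 h4]] := lift_nontrivial_unity_root K0 RD (ltn0Sn _) zN tt.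
  by exists s; split.
have zm1 := reducible_theta mo KD cardL zeta0 zetaP mt tT cusp nir.
have odd_q := reducible_odd cardL zeta0 mt zm1.
exists (-1); split=> //.
- by rewrite -signr_odd /= odd_q.
- by rewrite eq_sym -subr_eq0 opprK -mulr2n (pcharK_nat K0).
- by rewrite (ON RD) // (O1 RD).
- by rewrite (redN RD) ?(O1 RD) // (red1 RD).
Qed.

End CuspidalLift.

(** * Principal series *)

(* [option k] is the projective line: [None] stands for a Borel eigenvector v and
   [Some b] for v W U(b). *)
Section PrincipalSeries.
Variables (k : finFieldType) (R : fieldType) (chi1 chi2 : k -> R).
Hypotheses (mc1 : multiplicative_char chi1) (mc2 : multiplicative_char chi2).
Local Notation I := (option k).
Local Notation N := #|{: option k}|.
Implicit Types (a b c d : k) (x : I).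

Definition psU b : 'M[R]_N := mono (fun=> 1) (omap (fun c => c + b)).
Definition psD a d : 'M[R]_N :=
  mono (fun x => if x is Some _ then chi1 d * chi2 a else chi1 a * chi2 d)
       (omap (fun c => c * d / a)).
(** The coefficients come from [sys_wuw]: for a Borel eigenvector [v], the vector [v W U(c) W]
    equals [v D(- c^-1, - c) W U(- c^-1)]. *)
Definition psW : 'M[R]_N :=
  mono (fun x => if x is Some c then
                   if c == 0 then chi1 (-1) * chi2 (-1) else chi1 (- c^-1) * chi2 (- c)
                 else 1)
       (fun x => if x is Some c then if c == 0 then None else Some (- c^-1) else Some 0).

Lemma ps_system : GL2_system psU psD psW.
Proof.
have m1 : -1 != 0 :> k by rewrite oppr_eq0 oner_eq0.
have N0 c : c != 0 -> - c != 0 by rewrite oppr_eq0.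
have V0 c : c != 0 -> c^-1 != 0 by rewrite invr_eq0.
have VN c : c != 0 -> - c^-1 != 0 by move=> c0; rewrite N0 // V0.
have NV c : - (- c)^-1 = c^-1 by rewrite invrN opprK.
have chi12 c : c != 0 -> chi1 c * chi1 c^-1 = 1 by move=> c0; rewrite -(mcharM mc1) ?V0 // mulfV // (mchar1 mc1).
have n1 : (-1)^-1 = -1 :> k by rewrite invrN invr1.
split.
- apply: kvec_inj => -[c|]; rewrite kvec_mono mulmx1 scale1r //=.
  by rewrite addr0.
- move=> b b'; apply: kvec_inj => -[c|]; rewrite mulmxA !kvec_mono -scalemxAl kvec_mono !scale1r //=.
  by rewrite addrA.
- apply: kvec_inj => -[c|]; rewrite kvec_mono mulmx1 (mchar1 mc1) (mchar1 mc2) mulr1 scale1r //=.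
  by rewrite mulr1 divr1.
- move=> a d a' d' a0 d0 a0' d0'.
  apply: kvec_inj => -[c|]; rewrite mulmxA !kvec_mono -scalemxAl kvec_mono scalerA /=;
    rewrite !(mcharM mc1) ?(mcharM mc2) // mulrACA //.
  by congr (_ *: kvec (Some _)); field; rewrite a0 a0'.
- move=> a d b a0 d0.
  apply: kvec_inj => -[c|]; rewrite !mulmxA !kvec_mono -!scalemxAl !kvec_mono !scalerA mul1r mulr1 //=.
  by congr (_ *: kvec (Some _)); field; rewrite a0 d0.
- move=> a d a0 d0.
  apply: kvec_inj => -[c|]; rewrite !mulmxA !kvec_mono -!scalemxAl !kvec_mono !scalerA /=; last first.
    by rewrite !mul0r mul1r mulr1.
  have [-> | c0] := eqVneq c 0; first by rewrite !mul0r eqxx mulrC.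
  have cad0 : c * a / d != 0 by rewrite !mulf_neq0 ?V0.
  rewrite (negPf cad0) /=; congr (_ *: kvec (Some _)); last by field; rewrite a0 d0 c0.
  have e1 : - (c * a / d)^-1 = - c^-1 * d / a by field; rewrite a0 d0 c0.
  have e2 : - (c * a / d) = - c * a / d by ring.
  rewrite e1 e2 !(mcharM mc1) ?(mcharM mc2) ?mulf_neq0 ?VN ?V0 ?N0 //.
  rewrite (mcharV mc1) // (mcharV mc2) //.
  by field; rewrite (mchar_neq0 mc1) // (mchar_neq0 mc2).
- apply: kvec_inj => -[c|]; rewrite !mulmxA !kvec_mono -!scalemxAl !kvec_mono !scalerA /=; last first.
    by rewrite eqxx mul1r.
  have [-> | c0] := eqVneq c 0; first by rewrite mulr1 mul0r mul0r.
  rewrite (negPf (VN _ c0)) /=; congr (_ *: kvec (Some _)); last by field; rewrite c0 m1.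
  have e1 : - (- c^-1)^-1 = c by rewrite NV invrK.
  rewrite e1 opprK mulrACA -(mcharM mc1) ?(VN _ c0) // -(mcharM mc2) ?V0 ?N0 //.
  by congr (chi1 _ * chi2 _); field.
- have WS c : c != 0 -> kvec (Some c) *m psW = (chi1 (- c^-1) * chi2 (- c)) *: kvec (Some (- c^-1)).
    by move=> c0; rewrite kvec_mono (negPf c0).
  have W0 : kvec (Some 0) *m psW = (chi1 (-1) * chi2 (-1)) *: kvec None by rewrite kvec_mono eqxx.
  have WN : kvec None *m psW = kvec (Some 0) by rewrite kvec_mono scale1r.
  have US b c : kvec (Some c) *m psU b = kvec (Some (c + b)) by rewrite kvec_mono scale1r.
  have UN b : kvec None *m psU b = kvec None by rewrite kvec_mono scale1r.
  have DS c : kvec (Some c) *m psD (-1) (-1) = (chi1 (-1) * chi2 (-1)) *: kvec (Some c).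
    by rewrite kvec_mono /= mulfK.
  have DN : kvec None *m psD (-1) (-1) = (chi1 (-1) * chi2 (-1)) *: kvec None by rewrite kvec_mono.
  apply: kvec_inj => x; rewrite !mulmxA.
  move: WS W0 WN US UN DS DN x.
  move: (psD (-1) (-1)) psU psW (@kvec R (option k)) => D U W e WS W0 WN US UN DS DN [c|]; last first.
    by rewrite WN US add0r WS ?oner_neq0 // UN DN -!scalemxAl WN US add0r invr1.
  have [-> | c0] := eqVneq c 0.
    rewrite W0 -!scalemxAl UN WN US DS add0r -!scalemxAl WS // -!scalemxAl US n1 opprK addrN.
    by rewrite (mchar1 mc1) (mchar1 mc2) mul1r scale1r.
  have [-> | c1] := eqVneq c 1.
    rewrite WS ?oner_neq0 // invr1 -!scalemxAl !US addNr subrr W0 DS -!scalemxAl W0 -!scalemxAl.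
    by rewrite UN.
  have cm1 : c - 1 != 0 by rewrite subr_eq0.
  have E : - c^-1 + 1 = (c - 1) / c by field.
  have E0 : (c - 1) / c != 0 by rewrite mulf_neq0 ?V0.
  rewrite WS // -!scalemxAl !US E WS // DS -!scalemxAl WS // -!scalemxAl US !scalerA.
  congr (_ *: e (Some _)); last by field; rewrite c0 cm1.
  rewrite (mulrACA (chi1 (- c^-1))) (mulrACA (chi1 (-1))) -!(mcharM mc1) -?(mcharM mc2) ?VN ?N0 ?oner_neq0 //.
  by congr (chi1 _ * chi2 _); field; rewrite ?c0 ?cm1.
Qed.

Section Hom.
Variables (n : nat) (U : k -> 'M[R]_n) (D : k -> k -> 'M[R]_n) (W : 'M[R]_n).
Hypothesis S : GL2_system U D W.
Variable v : 'rV[R]_n.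
Hypotheses (vU : forall b, v *m U b = v)
  (vD : forall a d, a != 0 -> d != 0 -> v *m D a d = (chi1 a * chi2 d) *: v).

(** Images of the basis vectors under the map from the principal series that a Borel eigenvector
    determines; the lemmas below are Frobenius reciprocity for it. *)
Definition psvec x := if x is Some b then v *m W *m U b else v.

Lemma psvecU x b : psvec x *m U b = psvec (omap (fun c => c + b) x).
Proof. by case: x => [c|] /=; rewrite ?vU // -mulmxA (sysUM S). Qed.

Lemma psvecD x a d : a != 0 -> d != 0 -> psvec x *m D a d =
  (if x is Some _ then chi1 d * chi2 a else chi1 a * chi2 d) *: psvec (omap (fun c => c * d / a) x).
Proof.
move=> a0 d0; case: x => [c|] /=; last exact: vD.
have -> : c = a * (c * d / a) / d by field; rewrite a0 d0.
rewrite -mulmxA -(sysDU S) // mulmxA -(mulmxA v) (sysWD S) // mulmxA vD // -!scalemxAl.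
by congr (_ *: (_ *m U _)); field; rewrite a0 d0.
Qed.

Lemma psvecW x : psvec x *m W =
  (if x is Some c then
     if c == 0 then chi1 (-1) * chi2 (-1) else chi1 (- c^-1) * chi2 (- c)
   else 1) *: psvec (if x is Some c then if c == 0 then None else Some (- c^-1) else Some 0).
Proof.
have m1 : -1 != 0 :> k by rewrite oppr_eq0 oner_eq0.
case: x => [c|] /=; last by rewrite scale1r (sysU0 S) mulmx1.
have [-> | c0] := eqVneq c 0.
  by rewrite (sysU0 S) mulmx1 -mulmxA (sysWW S) vD.
have nc0 : - c != 0 by rewrite oppr_eq0.
have nc1 : - c^-1 != 0 by rewrite oppr_eq0 invr_eq0.
rewrite -(mulmxA v) -(mulmxA v) (sys_wuw S) // !mulmxA vU vD // -!scalemxAl.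
by [].
Qed.

Lemma psvec_hom b : psU b *m rows_mx psvec = rows_mx psvec *m U b.
Proof.
by apply: kvec_inj => x; rewrite !mulmxA kvec_mono scale1r !kvec_rows psvecU.
Qed.

Lemma psvec_homD a d : a != 0 -> d != 0 -> psD a d *m rows_mx psvec = rows_mx psvec *m D a d.
Proof.
move=> a0 d0; apply: kvec_inj => x; rewrite !mulmxA kvec_mono -scalemxAl !kvec_rows.
by rewrite psvecD.
Qed.

Lemma psvec_homW : psW *m rows_mx psvec = rows_mx psvec *m W.
Proof.
by apply: kvec_inj => x; rewrite !mulmxA kvec_mono -scalemxAl !kvec_rows psvecW.
Qed.

End Hom.

End PrincipalSeries.

Section PrincipalSeriesReducible.
Variables (k : finFieldType) (R : closedFieldType) (chi1 chi2 : k -> R).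
Hypotheses (mc1 : multiplicative_char chi1) (mc2 : multiplicative_char chi2).
Hypothesis sq12 : forall x, x != 0 -> chi1 x ^+ 2 = chi2 x ^+ 2.

(* When chi1^2 = chi2^2 the two orders of inducing characters agree on SL2, so the
   second Borel eigenvector \sum_b e_b yields an SL2-endomorphism. *)
Lemma ps_reducible : ~ mx_irreducible
  (subg_repr (sys_repr (ps_system mc1 mc2)) (normal_sub (SL2_normal k))).
Proof.
pose S := ps_system mc1 mc2.
have swap a d : a != 0 -> d != 0 -> a * d = 1 ->
    chi2 a * chi1 d = chi1 a * chi2 d.
  move=> a0 d0 ad; have -> : d = a^-1.
    by apply: (mulfI a0); rewrite mulfV.
  rewrite (mcharV mc1) // (mcharV mc2) //.
  apply: (mulfI (mchar_neq0 mc1 a0)); apply: (mulfI (mchar_neq0 mc2 a0)).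
  have h1 := mchar_neq0 mc1 a0; have h2 := mchar_neq0 mc2 a0.
  rewrite [LHS](_ : _ = chi2 a ^+ 2); last by field.
  by rewrite -sq12 //; field.
pose f : 'rV[R]_#|{: option k}| := \sum_b kvec (Some b).
have fU b : f *m psU R b = f.
  rewrite /f mulmx_suml [RHS](reindex_inj (addIr b)) /=.
  by apply: eq_bigr => c _; rewrite kvec_mono scale1r.
have fD a d : a != 0 -> d != 0 -> f *m psD chi1 chi2 a d = (chi2 a * chi1 d) *: f.
  move=> a0 d0; have inj : injective (fun c : k => c * d / a).
    by move=> c c' /= /(mulIf (invr_neq0 a0)) /(mulIf d0).
  rewrite /f mulmx_suml scaler_sumr [RHS](reindex_inj inj) /=.
  by apply: eq_bigr => c _; rewrite kvec_mono /= mulrC.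
pose A := rows_mx (psvec (@psU k R) (psW chi1 chi2) f).
apply: (sys_reducible (S := S) (A := A)).
- by move=> b; rewrite -(psvec_hom S fU).
- move=> a a0; have Va0 : a^-1 != 0 by rewrite invr_eq0.
  rewrite -(psvec_homD S fD) //; congr (_ *m _).
  apply: kvec_inj => -[c|]; rewrite !kvec_mono /=; congr (_ *: _); last by rewrite swap // mulfV.
  by rewrite mulrC -swap 1?mulrC // mulVf.
- rewrite -(psvec_homW S fU fD); congr (_ *m _).
  apply: kvec_inj => -[c|]; rewrite !kvec_mono //=; congr (_ *: _).
  have [_ | c0] := eqVneq c 0; first exact: mulrC.
  by rewrite swap ?oppr_eq0 ?invr_eq0 // mulrNN mulVf.
- apply/negP => /is_scalar_mxP [a Ea].
  have : kvec None *m A = f by rewrite kvec_rows.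
  rewrite Ea mul_mx_scalar => /rowP/(_ (enum_rank (Some 0))).
  rewrite mxE kvec_coord mulr0 summxE (bigD1 0) //= kvec_coord eqxx big1 => [|b b0].
    by rewrite addr0 => /esym/eqP; rewrite oner_eq0.
  by rewrite kvec_coord (inj_eq (can_inj (g := odflt 0) _)) ?(negPf b0).
Qed.
End PrincipalSeriesReducible.

(** Relations pass to quotients; this gives those of Steinberg from [ps_system] without a second
    verification. *)
Lemma system_quotient (k : finFieldType) (R : fieldType) n n'
    (U : k -> 'M[R]_n) D W (U' : k -> 'M[R]_n') D' W' (Q : 'M_(n, n')) :
  GL2_system U D W -> row_full Q ->
  (forall b, U b *m Q = Q *m U' b) ->
  (forall a d, a != 0 -> d != 0 -> D a d *m Q = Q *m D' a d) ->
  W *m Q = Q *m W' -> GL2_system U' D' W'.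
Proof.
move=> S fQ hU hD hW.
have m1 : -1 != 0 :> k by rewrite oppr_eq0 oner_eq0.
have C X X' Y Y' : X *m Q = Q *m X' -> Y *m Q = Q *m Y' -> X *m Y *m Q = Q *m (X' *m Y').
  by move=> hX hY; rewrite -mulmxA hY !mulmxA hX.
split; move=> *; apply: (row_full_inj fQ).
- by rewrite -hU (sysU0 S) mul1mx mulmx1.
- by rewrite mulmxA -hU -mulmxA -hU mulmxA (sysUM S) hU.
- by rewrite -hD ?oner_neq0 // (sysD1 S) mul1mx mulmx1.
- by rewrite mulmxA -hD // -mulmxA -hD // mulmxA (sysDM S) // hD // mulf_neq0.
- by rewrite !mulmxA -hD // -hU -!mulmxA -hU -hD // !mulmxA (sysDU S).
- by rewrite !mulmxA -hW -hD // -!mulmxA -hD // -hW !mulmxA (sysWD S).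
- by rewrite !mulmxA -hW -mulmxA -hW mulmxA (sysWW S) hD.
- by rewrite -(C _ _ _ _ (C _ _ _ _ hW (hU 1)) hW) (sysWUW S); apply: (C _ _ _ _ (C _ _ _ _ (C _ _ _ _ (hU _) (hD _ _ m1 m1)) hW) (hU _)).
Qed.

Section Steinberg.
Variables (k : finFieldType) (R : fieldType) (chi : k -> R).
Hypothesis mc : multiplicative_char chi.
Implicit Types (a b c d : k).

Definition stU b : 'M[R]_#|k| := mono (fun=> 1) (fun c => c + b).
Definition stD a d : 'M[R]_#|k| := mono (fun=> chi a * chi d) (fun c => c * d / a).
Definition stW : 'M[R]_#|k| :=
  kmx (fun c c' => if c == 0 then -1 else if c' == - c^-1 then 1 else 0).

Lemma kvec_stW c : kvec c *m stW = if c == 0 then - \sum_c' kvec c' else kvec (- c^-1).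
Proof.
rewrite kvec_kmx; have [c0 | c0] := eqVneq c 0.
  by rewrite -sumrN; apply: eq_bigr => c' _; rewrite scaleN1r.
rewrite (bigD1 (- c^-1)) //= eqxx scale1r big1 ?addr0 // => c' ne.
by rewrite (negPf ne) scale0r.
Qed.

Lemma steinberg_system : GL2_system stU stD stW.
Proof.
(* The quotient of the principal series of [chi], [chi] by the sum of all basis vectors: [None]
   becomes minus the sum of the others. *)
pose w : option k -> 'rV[R]_#|k| := oapp kvec (- \sum_c kvec c).
pose Q := rows_mx w.
have Qw x : kvec x *m Q = w x by rewrite kvec_rows.
have s2 : chi (-1) * chi (-1) = 1.
  have m1 : -1 != 0 :> k by rewrite oppr_eq0 oner_eq0.
  by rewrite -(mcharM mc) // mulrNN mulr1 (mchar1 mc).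
apply: (system_quotient (ps_system mc mc) (Q := Q)).
- rewrite -sub1mx; apply/row_subP => i; rewrite rowE mulmx1 /= -[i]enum_valK -/(kvec _).
  by rewrite -[kvec _](Qw (Some (enum_val i))) submxMl.
- move=> b; apply: kvec_inj => x; rewrite !mulmxA kvec_mono scale1r !Qw.
  case: x => [c|] /=; first by rewrite kvec_mono scale1r.
  rewrite mulNmx mulmx_suml [in LHS](reindex_inj (addIr b)); congr (- _).
  by apply: eq_bigr => c _; rewrite kvec_mono scale1r.
- move=> a d a0 d0; apply: kvec_inj => x; rewrite !mulmxA kvec_mono -scalemxAl !Qw.
  case: x => [c|] /=; first by rewrite kvec_mono mulrC.
  have inj : injective (fun c : k => c * d / a).
    by move=> c c' /= /(mulIf (invr_neq0 a0)) /(mulIf d0).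
  rewrite mulNmx mulmx_suml [in LHS](reindex_inj inj) scalerN scaler_sumr; congr (- _).
  by apply: eq_bigr => c _; rewrite kvec_mono.
apply: kvec_inj => x; rewrite !mulmxA kvec_mono -scalemxAl !Qw.
case: x => [c|] /=.
  rewrite kvec_stW; have [_ | c0] := eqVneq c 0; first by rewrite s2 scale1r.
  rewrite -(mcharM mc) ?oppr_eq0 ?invr_eq0 // mulrNN mulVf // (mchar1 mc) scale1r //.
rewrite scale1r mulNmx mulmx_suml (bigD1 0) //= kvec_stW eqxx opprD opprK.
have -> : \sum_(c | c != 0) kvec c *m stW = \sum_(c | c != 0) kvec c.
  have inj : injective (fun c : k => - c^-1) by move=> c c' /oppr_inj /invr_inj.
  rewrite [RHS](reindex_inj inj); apply: eq_big => c; first by rewrite oppr_eq0 invr_eq0.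
  by move=> c0; rewrite kvec_stW (negPf c0).
by rewrite (bigD1 0) //= addrK.
Qed.

End Steinberg.

Section Scalar.
Variables (k : finFieldType) (R : fieldType) (chi : k -> R).
Hypothesis mc : multiplicative_char chi.

Lemma scalar_system : GL2_system (fun=> 1%:M : 'M[R]_1) (fun a d : k => (chi a * chi d)%:M) 1%:M.
Proof.
have m1 : -1 != 0 :> k by rewrite oppr_eq0 oner_eq0.
have s2 : chi (-1) * chi (-1) = 1 by rewrite -(mcharM mc) // mulrNN mulr1 (mchar1 mc).
split=> *; rewrite ?mul1mx ?mulmx1 ?s2 ?mul1mx //.
- by rewrite (mchar1 mc) mulr1.
- by rewrite -scalar_mxM !(mcharM mc) // mulrACA.
- by rewrite mulrC.
Qed.

End Scalar.

Lemma sum_option (V : nmodType) (T : finType) (G : option T -> V) :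
  \sum_x G x = G None + \sum_c G (Some c).
Proof.
rewrite (bigD1 None) //=; congr (_ + _).
rewrite (reindex_omap Some id) /= => [|[]] //.
by apply: eq_bigl => c; rewrite eqxx.
Qed.

Lemma mul_rows_mx (R : fieldType) (I : finType) m (w : 'rV[R]_#|I|) (u : I -> 'rV_m) :
  w *m rows_mx u = \sum_x w 0 (enum_rank x) *: u x.
Proof.
rewrite mulmx_sum_row -(sum_enum_val (fun x => w 0 (enum_rank x) *: u x)).
by apply: eq_bigr => i _; rewrite rowK enum_valK.
Qed.

(** * Noncuspidal representations as quotients of principal series *)

Section Noncuspidal.
Variables (k : finFieldType) (F : closedFieldType) (m : nat).
Variable sg : mx_representation F (GL2 k) m.
Hypothesis irr : mx_irreducible sg.
Variable psi : k -> F.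
Hypothesis ac : additive_char psi.
Hypothesis q0 : (#|k|)%:R != 0 :> F.
Implicit Types (a b c d : k).
Let S := repr_system sg.
Local Notation U b := (sg (gu b)).
Local Notation D a d := (sg (gd a d)).
Local Notation W := (sg (gw k)).
Local Notation E0 := (wproj sg psi 0).
Variable gam : k.
Hypotheses (gam0 : gam != 0) (gamP : forall x, x != 0 -> exists i, x = gam ^+ i).

(** The centre acts by scalars, so a vector fixed by the unipotent group that is an eigenvector of
    [gd gam 1] is one for the whole torus; [chi2] is the central character divided by [chi1]. *)
Lemma borel_eigenvector : E0 != 0 -> exists chi1 chi2 (v : 'rV[F]_m),
  [/\ multiplicative_char chi1, multiplicative_char chi2, v != 0,
      forall b, v *m U b = v &
      forall a d, a != 0 -> d != 0 -> v *m D a d = (chi1 a * chi2 d) *: v].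
Proof.
move=> V0; have o0 := oner_neq0 k.
have stab : (E0 *m D gam 1 <= E0)%MS.
  have h : has_weight sg psi 0 (E0 *m D gam 1).
    have := weight_D gam0 o0 (wprojU sg ac 0).
    by rewrite mul0r mul0r.
  by rewrite -(wproj_weight ac q0 h) submxMl.
have [al /rowV0Pn [v]] := stable_eigenvector V0 stab.
rewrite sub_capmx => /andP [vE /sub_kermxP vA] v0.
have vU b : v *m U b = v.
  have /submxP [u ->] := vE.
  by rewrite (has_weight_mul sg ac 0 u) mulr0 (achar0 ac) scale1r.
have {}vA : v *m D gam 1 = al *: v.
  by apply/eqP; rewrite -subr_eq0 -mul_mx_scalar -mulmxBr vA.
have vX i : v *m D (gam ^+ i) 1 = al ^+ i *: v.
  elim: i => [|i IH]; first by rewrite !expr0 (sysD1 S) mulmx1 scale1r.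
  have -> : D (gam ^+ i.+1) 1 = D (gam ^+ i) 1 *m D gam 1.
    by rewrite (sysDM S) ?expf_neq0 // mulr1 exprSr.
  by rewrite mulmxA IH -scalemxAl vA scalerA exprSr.
have alN : al ^+ #|k|.-1 = 1.
  have := vX #|k|.-1; rewrite expf_card1 // (sysD1 S) mulmx1 => /eqP.
  rewrite -subr_eq0 -{1}[v]scale1r -scalerBl scaler_eq0 (negPf v0) orbF subr_eq0.
  by move/eqP.
have [chi1 [mc1 chi1X]] := mul_char_exists gam0 gamP alN.
have [om [mo omE]] := omega_exists irr.
exists chi1, (fun d => om d / chi1 d), v; split=> //.
  split=> [|x y x0 y0]; first by rewrite (mchar1 mo) (mchar1 mc1) divr1.
  by rewrite (mcharM mo) // (mcharM mc1) // invfM mulrACA.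
move=> a d a0 d0; have ad0 : a / d != 0 by rewrite mulf_neq0 ?invr_eq0.
have -> : D a d = D d d *m D (a / d) 1.
  by rewrite (sysDM S) // mulr1 mulrC divfK.
have [i Ei] := gamP ad0.
rewrite omE // mulmxA mul_mx_scalar -scalemxAl Ei vX -chi1X -Ei scalerA.
by rewrite (mcharM mc1) ?invr_eq0 // (mcharV mc1) // mulrCA.
Qed.

Section WithEigenvector.
Variables (chi1 chi2 : k -> F) (v : 'rV[F]_m).
Hypotheses (mc1 : multiplicative_char chi1) (mc2 : multiplicative_char chi2).
Hypotheses (v0 : v != 0) (vU : forall b, v *m U b = v)
  (vD : forall a d, a != 0 -> d != 0 -> v *m D a d = (chi1 a * chi2 d) *: v).
Local Notation vec := (psvec (fun b => U b) W v).
Let f := \sum_b vec (Some b).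

Lemma vec_full : row_full (rows_mx vec).
Proof.
have modP : mxmodule sg <<rows_mx vec>>%MS.
  rewrite (eqmx_module _ (genmxE _)); apply/mxmoduleP; apply: gen_GL2.
  - move=> g h Hg Hh _; rewrite GL2_reprM mulmxA.
    by apply: submx_trans (submxMr _ (Hg (GL2_mem g))) (Hh (GL2_mem h)).
  - by move=> b _; rewrite -(psvec_hom S vU) submxMl.
  - by move=> a d a0 d0 _; rewrite -(psvec_homD S vD) // submxMl.
  - by rewrite -(psvec_homW S vU vD) submxMl.
have [_ /(_ _ modP)] := (mx_irrP sg).1 irr.
rewrite -mxrank_eq0 genmxE mxrank_eq0 /row_full genmxE; apply.
apply: contra_neq v0 => h; have := kvec_rows vec None; rewrite h mulmx0 //.
Qed.

Lemma vec_span (u : 'rV_m) : exists c : option k -> F, u = \sum_x c x *: vec x.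
Proof.
have /submxP [w ->] : (u <= rows_mx vec)%MS.
  by apply: submx_trans (submx1 _) _; rewrite sub1mx vec_full.
by exists (fun x => w 0 (enum_rank x)); rewrite mul_rows_mx.
Qed.

Lemma psvec_sumD a d : a != 0 -> d != 0 -> f *m D a d = (chi2 a * chi1 d) *: f.
Proof.
move=> a0 d0; have inj : injective (fun c : k => c * d / a).
  by move=> c c' /= /(mulIf (invr_neq0 a0)) /(mulIf d0).
rewrite /f mulmx_suml scaler_sumr [RHS](reindex_inj inj) /=.
by apply: eq_bigr => c _; rewrite (psvecD S vD (Some c)) // mulrC.
Qed.

Lemma sum_vecU x : \sum_b vec x *m U b = if x is Some _ then f else (#|k|)%:R *: v.
Proof.
case: x => [c|] /=; last first.
  by rewrite (eq_bigr (fun=> v)) => [|b _]; rewrite ?vU // sumr_const scaler_nat.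
rewrite /f [RHS](reindex_inj (addrI c)) /=; apply: eq_bigr => b _.
by rewrite -mulmxA (sysUM S).
Qed.

(** Averaging over the unipotent group fixes [v] and sends every [vec (Some b)] to a multiple of
    [f]: one fixed vector per Bruhat cell. *)
Lemma fixed_span (u : 'rV_m) : (forall b, u *m U b = u) -> exists x y : F, u = x *: v + y *: f.
Proof.
move=> uU; have [c Ec] := vec_span u.
have Eu : u = (#|k|)%:R^-1 *: \sum_b u *m U b.
  by rewrite (eq_bigr (fun=> u)) ?sumr_const -?scaler_nat ?scalerA ?mulVf ?scale1r.
exists (c None), ((#|k|)%:R^-1 * \sum_b c (Some b)); rewrite {1}Eu.
under eq_bigr do rewrite {1}Ec mulmx_suml.
rewrite exchange_big /=.
under eq_bigr do under eq_bigr do rewrite -scalemxAl.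
under eq_bigr do rewrite -scaler_sumr sum_vecU.
by rewrite sum_option /= -scaler_suml scalerDr !scalerA mulrCA mulVf // mulr1.
Qed.

(** A proper simple [M] meets its translate in 0, so it contains no eigenvector of [gd gam 1]; yet
    it is stable under the square, which is central times an element of [SL2]. It contains a nonzero
    fixed vector [x *: v + y *: f]. Equal characters would make this an eigenvector, and different
    squares would separate its two components inside [M]. *)
Lemma reducible_chars : ~ mx_irreducible (subg_repr sg (normal_sub (SL2_normal k))) ->
  chi1 gam != chi2 gam /\ chi1 gam ^+ 2 = chi2 gam ^+ 2.
Proof.
set sS := normal_sub _ => red; have o0 := oner_neq0 k; have [_ nz1 _] := irr.
have [M sM _] := classicallyP (mxsimple_exists (mxmodule1 (subg_repr sg sS)) nz1).
have [modM M0 minM] := sM.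
have I0 : (M :&: M *m D gam 1 = 0)%MS.
  case: (Clifford_dichotomy irr gam0 gamP sM) => [rM | [_ //]].
  case: red; have M1 : (M :=: 1%:M)%MS.
    by apply/eqmxP; rewrite submx1 sub1mx /row_full rM eqxx.
  split; [exact: mxmodule1 | exact: nz1 | move=> N modN _ N0].
  by rewrite -M1; apply: minM => //; rewrite M1 submx1.
have MS h : h \in SL2 k -> (M *m sg h <= M)%MS by move=> Sh; exact: (mxmoduleP modM h Sh).
have noeig (t : 'rV_m) (c : F) : (t <= M)%MS -> t *m D gam 1 = c *: t -> t = 0.
  move=> tM tX; apply/eqP; apply: contraT => t0.
  have := D_neq0 sg gam0 o0 t0; rewrite -submx0 -{}I0 sub_capmx submxMr // andbT.
  by rewrite tX scalemx_sub.
pose Z := \sum_b U b.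
have ZU b : Z *m U b = Z.
  rewrite /Z mulmx_suml [RHS](reindex_inj (addIr b)) /=.
  by apply: eq_bigr => c _; rewrite (sysUM S).
have XZ : D gam 1 *m Z = Z *m D gam 1.
  rewrite /Z mulmx_suml mulmx_sumr [RHS](reindex_inj (mulfI gam0)) /=.
  by apply: eq_bigr => c _; rewrite (sysDU S) // divr1.
(* [Z] commutes with [gd gam 1], so if it killed [M] it would kill the sum of [M] and its translate,
   which is everything; but [Z] multiplies [v] by [q]. *)
have MZ0 : M *m Z != 0.
  apply: contra_neq v0 => MZ.
  have Z0 : Z = 0.
    apply/eqP; rewrite -submx0 -[Z]mul1mx.
    apply: (submx_trans (submxMr Z _)); first by rewrite -(Clifford_sum irr gam0 gamP modM M0).
    by rewrite addsmxMr -mulmxA XZ mulmxA MZ mul0mx addsmx0.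
  have : v *m Z = (#|k|)%:R *: v.
    by rewrite /Z mulmx_sumr (eq_bigr (fun=> v)) => [|b _]; rewrite ?vU // sumr_const scaler_nat.
  by rewrite Z0 mulmx0 => /esym/eqP; rewrite scaler_eq0 (negPf q0) => /eqP.
have /rowV0Pn [w /submxP [u Ew] w0] := MZ0.
have wM : (w <= M)%MS.
  rewrite Ew mulmxA /Z mulmx_sumr summx_sub // => b _; rewrite -mulmxA.
  by rewrite mulmx_sub // MS // gu_in_SL.
have [|x [y Ewv]] := fixed_span (u := w); first by move=> b; rewrite Ew -!mulmxA ZU.
have vX : v *m D gam 1 = chi1 gam *: v by rewrite vD // (mchar1 mc2) mulr1.
have fX : f *m D gam 1 = chi2 gam *: f by rewrite psvec_sumD // (mchar1 mc1) mulr1.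
have wX : w *m D gam 1 = (x * chi1 gam) *: v + (y * chi2 gam) *: f.
  by rewrite Ewv mulmxDl -!scalemxAl vX fX !scalerA.
have wXX : w *m D gam 1 *m D gam 1 = (x * chi1 gam ^+ 2) *: v + (y * chi2 gam ^+ 2) *: f.
  by rewrite wX mulmxDl -!scalemxAl vX fX !scalerA -!mulrA.
have wXXM : (w *m D gam 1 *m D gam 1 <= M)%MS.
  have [om [_ omE]] := omega_exists irr.
  have Vg0 : gam^-1 != 0 by rewrite invr_eq0.
  have -> : w *m D gam 1 *m D gam 1 = om gam *: (w *m D gam gam^-1).
    rewrite -mul_mx_scalar -omE // -!mulmxA !(sysDM S) //.
    by rewrite mulVf // mulr1.
  by rewrite scalemx_sub // (submx_trans (submxMr _ wM)) // MS // gd_in_SL.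
split.
  apply: contra_neq w0 => e; apply: (noeig w (chi1 gam)) => //.
  by rewrite wX -e Ewv scalerDr !scalerA ![chi1 gam * _]mulrC.
apply/eqP; apply: contraT => ne; case/eqP: w0.
have xv : x *: v = 0.
  have : ((chi1 gam ^+ 2 - chi2 gam ^+ 2) *: (x *: v) <= M)%MS.
    have -> : (chi1 gam ^+ 2 - chi2 gam ^+ 2) *: (x *: v) =
        w *m D gam 1 *m D gam 1 - chi2 gam ^+ 2 *: w.
      rewrite wXX Ewv scalerDr !scalerA opprD addrACA.
      by rewrite [chi2 gam ^+ 2 * y]mulrC subrr addr0 -scalerBl; congr (_ *: _); ring.
    by rewrite addmx_sub // eqmx_opp scalemx_sub.
  rewrite eqmx_scale ?subr_eq0 // => xvM; apply: (noeig _ (chi1 gam)) => //.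
  by rewrite -scalemxAl vX !scalerA mulrC.
have yf : y *: f = 0.
  have : ((chi2 gam ^+ 2 - chi1 gam ^+ 2) *: (y *: f) <= M)%MS.
    have -> : (chi2 gam ^+ 2 - chi1 gam ^+ 2) *: (y *: f) =
        w *m D gam 1 *m D gam 1 - chi1 gam ^+ 2 *: w.
      by rewrite wXX Ewv xv add0r -[x * _]mulrC -(scalerA _ x) xv scaler0 add0r !scalerA -scalerBl;
        congr (_ *: _); ring.
    by rewrite addmx_sub // eqmx_opp scalemx_sub.
  rewrite eqmx_scale ?subr_eq0 1?eq_sym // => yfM; apply: (noeig _ (chi2 gam)) => //.
  by rewrite -scalemxAl fX !scalerA mulrC.
by rewrite Ewv xv yf addr0.
Qed.

Section Relations.

Definition fourier (V : lmodType F) (G : k -> V) a : V := \sum_b psi (- (a * b)) *: G b.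

Lemma fourier_const (V : lmodType F) (G : k -> V) :
  (forall a, a != 0 -> fourier G a = 0) -> forall b, G b = G 0.
Proof.
move=> h; suff e b : G b = (#|k|)%:R^-1 *: fourier G 0 by move=> b; rewrite !e.
have : \sum_a psi (a * b) *: fourier G a = (#|k|)%:R *: G b.
  under eq_bigr do rewrite scaler_sumr.
  rewrite exchange_big /= (bigD1 b) //= [X in _ + X]big1 => [|c cb].
    rewrite addr0 (eq_bigr (fun=> G b)) => [|a _]; first by rewrite sumr_const scaler_nat.
    by rewrite scalerA -(acharD ac) subrr (achar0 ac) scale1r.
  rewrite (eq_bigr (fun a => psi ((b - c) * a) *: G c)) => [|a _].
    by rewrite -scaler_suml (sum_achar ac) subr_eq0 eq_sym (negPf cb) scale0r.
  by rewrite scalerA -(acharD ac) -mulrBr mulrC.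
rewrite (bigD1 0) //= big1 => [|a a0]; last by rewrite h ?scaler0.
by rewrite mul0r (achar0 ac) scale1r addr0 => ->; rewrite scalerA mulVf // scale1r.
Qed.

Local Notation Fvec := (fourier (fun b => vec (Some b))).

Lemma fourier_vecD a d : a != 0 -> d != 0 -> Fvec a *m D d 1 = chi2 d *: Fvec (a * d).
Proof.
move=> a0 d0; rewrite /fourier mulmx_suml scaler_sumr [RHS](reindex_inj (divIf d0)) /=.
apply: eq_bigr => b _; rewrite -scalemxAl (psvecD S vD (Some b)) ?oner_neq0 //=.
rewrite (mchar1 mc1) mul1r mulr1 !scalerA [X in X *: _]mulrC; congr (_ * psi _ *: _).
by field.
Qed.

(** The torus permutes the nonzero frequencies up to nonzero scalars, so one vanishing Fourier
    coefficient kills them all. *)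
Lemma vec_const a : a != 0 -> Fvec a = 0 -> forall b, vec (Some b) = vec (Some 0).
Proof.
move=> a0 Fa; apply: (fourier_const (G := fun b => vec (Some b))) => d d0.
have da0 : d / a != 0 by rewrite mulf_neq0 ?invr_eq0.
have := fourier_vecD a0 da0; rewrite Fa mul0mx [a * _]mulrC divfK // => /esym/eqP.
by rewrite scaler_eq0 (negPf (mchar_neq0 mc2 da0)) => /eqP.
Qed.

(** A weighted sum of the [U b] kills [v] and turns the relation into a product of two Fourier
    coefficients, one of the scalars and one of the vectors. *)
Lemma relation_fourier (c : option k -> F) a : a != 0 -> \sum_x c x *: vec x = 0 ->
  fourier (fun b => c (Some b) : F^o) a *: Fvec (- a) = 0.
Proof.
move=> a0 rel.
have : (\sum_x c x *: vec x) *m (\sum_b psi (a * b) *: U b) = 0 by rewrite rel mul0mx.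
rewrite mulmx_suml sum_option.
have vec0 : vec None *m (\sum_b psi (a * b) *: U b) = 0.
  rewrite mulmx_sumr /= (eq_bigr (fun b => psi (a * b) *: v)) => [|b _]; last first.
    by rewrite -scalemxAr vU.
  by rewrite -scaler_suml (sum_achar ac) (negPf a0) scale0r.
rewrite -scalemxAl vec0 scaler0 add0r => h; rewrite -[RHS]h {h} [in LHS]/fourier scaler_suml.
apply: eq_bigr => b _; transitivity ((c (Some b) * psi (- (a * b))) *: Fvec (- a)).
  by congr (_ *: _); exact: mulrC.
rewrite -scalemxAl -scalerA; congr (_ *: _).
rewrite /fourier scaler_sumr [LHS](reindex_inj (addrI b)) mulmx_sumr /=; apply: eq_bigr => d _.
rewrite scalerA -(acharD ac) -scalemxAr (psvecU S vU (Some b)) /=; congr (psi _ *: _).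
by ring.
Qed.

Lemma psvec_relationW (c : option k -> F) : \sum_x c x *: vec x = 0 ->
  \sum_x (if x is Some u then if u == 0 then c None else c (Some (- u^-1)) * (chi1 u * chi2 u^-1)
           else c (Some 0) * (chi1 (-1) * chi2 (-1))) *: vec x = 0.
Proof.
move: (psvecW S vU vD); move: (psvec _ W v) => vc hW rel.
have : (\sum_x c x *: vc x) *m W = 0 by rewrite rel mul0mx.
rewrite mulmx_suml !sum_option => h; rewrite -[RHS]h {h}.
rewrite [in LHS](bigD1 0) //= [in RHS](bigD1 0) //= eqxx -!scalemxAl.
rewrite (hW None) (hW (Some 0)) /= eqxx !scalerA mulr1.
rewrite addrCA; congr (_ + (_ + _)).
have inj : injective (fun u : k => - u^-1) by move=> u u' /oppr_inj /invr_inj.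
rewrite [RHS](reindex_inj inj); apply: eq_big => u; first by rewrite oppr_eq0 invr_eq0.
move=> u0; rewrite (negPf u0) -scalemxAl (hW (Some _)).
by rewrite oppr_eq0 invr_eq0 (negPf u0) invrN invrK !opprK scalerA.
Qed.

(** Fourier analysis makes the coefficients constant on [Some]. Applying [W] gives a second
    relation, whose coefficients carry [chi1 u * chi2 u^-1]; its constancy ties in [c None] and
    compares the characters. *)
Lemma relation_shape (c : option k -> F) :
  (forall a, a != 0 -> Fvec a != 0) -> \sum_x c x *: vec x = 0 ->
  (forall b, c (Some b) = c None) /\
  (c None != 0 -> forall u, u != 0 -> chi1 u = chi2 u).
Proof.
move=> nz.
have const (d : option k -> F) : \sum_x d x *: vec x = 0 -> forall b, d (Some b) = d (Some 0).
  move=> rel; apply: (fourier_const (V := F^o) (G := fun b => d (Some b))) => a a0.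
  have /eqP := relation_fourier a0 rel; rewrite scaler_eq0 => /orP [/eqP // | ].
  by rewrite (negPf (nz _ _)) ?oppr_eq0.
move=> rel; have c0 := const _ rel; have /const h := psvec_relationW rel.
have o0 := oner_neq0 k.
have e u : u != 0 -> c (Some 0) * (chi1 u * chi2 u^-1) = c None.
  by move=> u0; have := h u; rewrite eqxx (negPf u0) c0.
have e1 : c (Some 0) = c None by rewrite -(e 1) // invr1 (mchar1 mc1) (mchar1 mc2) !mulr1.
split=> [b | cN u u0]; first by rewrite c0.
have := e u u0; rewrite e1 (mcharV mc2) // -[RHS]mulr1 => /(mulfI cN) /(congr1 ( *%R^~ (chi2 u))).
by rewrite divfK ?mul1r // (mchar_neq0 mc2).
Qed.

End Relations.

End WithEigenvector.
End Noncuspidal.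

(** * Lifting noncuspidal representations *)

Section NoncuspidalLift.
Variables (k : finFieldType) (K F : closedFieldType) (O : {pred K}) (red : K -> F).
Hypothesis K0 : [pchar K] =i pred0.
Hypothesis RD : residue_data O red.
Hypothesis q0 : (#|k|)%:R != 0 :> F.
Variable gam : k.
Hypotheses (gam0 : gam != 0) (gamP : forall x, x != 0 -> exists i, x = gam ^+ i).

Definition char_lift (chiK : k -> K) (chi : k -> F) :=
  [/\ multiplicative_char chiK, forall x, x != 0 -> chiK x \in O &
      forall x, x != 0 -> red (chiK x) = chi x].

Lemma char_lift_gen (chi : k -> F) r : multiplicative_char chi ->
  r ^+ #|k|.-1 = 1 -> r \in O -> red r = chi gam ->
  exists2 chiK, char_lift chiK chi & forall i, chiK (gam ^+ i) = r ^+ i.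
Proof.
move=> mc rN Or Er; have [chiK [mcK chiKX]] := mul_char_exists gam0 gamP rN.
exists chiK => //; split=> // x /gamP [i ->]; first by rewrite chiKX (OX RD).
by rewrite chiKX (redX RD) // Er (mcharX mc).
Qed.

Lemma card_k1_gt0 : (0 < #|k|.-1)%N.
Proof. by have := finNzRing_gt1 k; case: #|k| => [|[]]. Qed.

Lemma char_lift_exists chi : multiplicative_char chi -> exists chiK, char_lift chiK chi.
Proof.
move=> mc; have [r [rN Or Er]] := lift_unity_root RD card_k1_gt0 (mul_char_gen gam0 mc).
by have [chiK lc _] := char_lift_gen mc rN Or Er; exists chiK.
Qed.

(** Here [chi2 gam = - chi1 gam], so the generator values lift to [r] and [- r]. This needs [q - 1]
    even; otherwise 2, and with it [q], would vanish in [F]. *)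
Lemma char_lift_pair chi1 chi2 : multiplicative_char chi1 -> multiplicative_char chi2 ->
  chi1 gam != chi2 gam -> chi1 gam ^+ 2 = chi2 gam ^+ 2 ->
  exists chiK1 chiK2, [/\ char_lift chiK1 chi1, char_lift chiK2 chi2 &
    forall x, x != 0 -> chiK1 x ^+ 2 = chiK2 x ^+ 2].
Proof.
move=> mc1 mc2 ne e2.
have [r [rN Or Er]] := lift_unity_root RD card_k1_gt0 (mul_char_gen gam0 mc1).
have e : chi2 gam = - chi1 gam.
  move/eqP: e2; rewrite eq_sym eqf_sqr eq_sym (negPf ne) /= => /eqP //.
have evk : ~~ odd #|k|.-1.
  apply/negP => od; case/negP: q0.
  have := mul_char_gen gam0 mc2; rewrite e exprNn -signr_odd od mul_char_gen // mulr1 expr1 => e1.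
  have two : 2%:R = 0 :> F by rewrite mulr2n -{1}e1 addNr.
  rewrite -(odd_double_half #|k|) -mul2n; have := card_k1_gt0.
  by case: #|k| od => //= n -> _; rewrite add0n natrM two mul0r.
have [chiK1 l1 X1] := char_lift_gen mc1 rN Or Er.
have [|||chiK2 l2 X2] := char_lift_gen (r := - r) mc2.
- by rewrite exprNn -signr_odd (negPf evk) mul1r.
- by rewrite (ON RD).
- by rewrite (redN RD) // Er e.
exists chiK1, chiK2; split=> // x /gamP [i ->].
by rewrite X1 X2 -!exprM ![(i * 2)%N]mulnC !exprM sqrrN.
Qed.

Variables (m : nat) (sg : mx_representation F (GL2 k) m).
Hypothesis irr : mx_irreducible sg.
Variable psi : k -> F.
Hypothesis ac : additive_char psi.
Local Notation sS := (normal_sub (SL2_normal k)).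

Lemma noncuspidal_lift : wproj sg psi 0 != 0 ->
  exists n (st : mx_representation K (GL2 k) n), lifts O red st sg /\
    (~ mx_irreducible (subg_repr sg sS) -> ~ mx_irreducible (subg_repr st sS)).
Proof.
move=> nc; have o0 := oner_neq0 k.
have [chi1 [chi2 [v [mc1 mc2 v0 vU vD]]]] := borel_eigenvector irr ac q0 gam0 gamP nc.
have m1 : -1 != 0 :> k by rewrite oppr_eq0.
pose S := repr_system sg.
pose vec := psvec (fun b => sg (gu b)) (sg (gw k)) v.
have rc := reducible_chars irr q0 gam0 gamP mc1 mc2 v0 vU vD.
have eqchar : (forall x, x != 0 -> chi1 x = chi2 x) -> mx_irreducible (subg_repr sg sS).
  by move=> h; apply: NNPP => /rc []; rewrite h ?eqxx.
(* The relations among the [vec x] decide: all [vec (Some b)] equal gives a character of the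
   determinant, no relation the full principal series, and otherwise Steinberg. In the first and
   last cases [chi1] and [chi2] agree, so the restriction to [SL2] is irreducible and only a lift is
   required. *)
have [[a a0 Fa] | nz] := classic (exists2 a, a != 0 &
    fourier psi (fun b => vec (Some b)) a = 0).
  have cst : forall b, vec (Some b) = vec (Some 0) by exact: (vec_const ac q0 mc1 mc2 vD a0 Fa).
  have [eps0 hW] : chi1 (-1) * chi2 (-1) != 0 /\ forall x, vec x *m sg (gw k) = _ :=
    conj (mulf_neq0 (mchar_neq0 mc1 m1) (mchar_neq0 mc2 m1)) (psvecW S vU vD).
  have vE : v = vec (Some 0).
    apply: (scalerI eps0).
    have <- : vec (Some 0) *m sg (gw k) = (chi1 (-1) * chi2 (-1)) *: v by rewrite hW eqxx.
    by rewrite -(cst 1) hW oner_eq0 invr1; congr (_ *: _); rewrite cst; exact: cst.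
  have vW : v *m sg (gw k) = v by rewrite {2}vE (hW None) scale1r.
  have ec x : x != 0 -> chi1 x = chi2 x.
    move=> x0; have : v *m sg (gw k) *m sg (gd 1 x) = v *m sg (gd x 1) *m sg (gw k).
      by rewrite -!mulmxA (sysWD S).
    rewrite vW !vD // -scalemxAl vW (mchar1 mc1) (mchar1 mc2) mul1r mulr1 => /eqP.
    by rewrite -subr_eq0 -scalerBl scaler_eq0 (negPf v0) orbF subr_eq0 => /eqP.
  have [chiK [mcK OK rK]] := char_lift_exists mc1.
  exists _, (sys_repr (scalar_system mcK)); split; last by move/(_ (eqchar ec)).
  have fv : row_free v by rewrite /row_free rank_rV v0.
  apply: (sys_lifts RD (scalar_system mcK) irr fv) => //.
  - by move=> _; apply: (Omx_scalar RD); exact: (O1 RD).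
  - by move=> b d b0 d0; apply: (Omx_scalar RD); rewrite (OM RD) ?OK.
  - apply: (Omx_scalar RD); exact: (O1 RD).
  - by move=> b; rewrite (red_scalar RD) (red1 RD) mul1mx vU.
  - move=> b d b0 d0; rewrite (red_scalar RD) (redM RD) ?OK // !rK // mul_scalar_mx vD //.
    by rewrite -[chi2 d]ec.
  - by rewrite (red_scalar RD) (red1 RD) mul1mx vW.
have [fP | nfP] := boolP (row_free (rows_mx vec)).
  suff [chiK1 [chiK2 [l1 l2 sq]]] : exists chiK1 chiK2,
      [/\ char_lift chiK1 chi1, char_lift chiK2 chi2 & ~ mx_irreducible (subg_repr sg sS) ->
       forall x, x != 0 -> chiK1 x ^+ 2 = chiK2 x ^+ 2].
    have [mcK1 O1' r1] := l1; have [mcK2 O2 r2] := l2.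
    exists _, (sys_repr (ps_system mcK1 mcK2)); split; last first.
      by move=> /sq h; exact: ps_reducible.
    apply: (sys_lifts RD (ps_system mcK1 mcK2) irr fP).
    - by apply/card_gt0P; exists None.
    - by move=> b; apply: (Omx_mono RD) => x; exact: (O1 RD).
    - by move=> b d b0 d0; apply: (Omx_mono RD) => -[c|]; rewrite (OM RD) ?O1' ?O2.
    - apply: (Omx_mono RD) => -[c|]; last exact: (O1 RD).
      case: (eqVneq c 0) => c0; first by rewrite (OM RD) ?O1' ?O2.
      by rewrite (OM RD) ?O1' ?O2 // oppr_eq0 ?invr_eq0.
    - by move=> b; rewrite (red_mono RD) -(psvec_hom S vU); congr (_ *m _); apply: kvec_inj => x;
        rewrite !kvec_mono (red1 RD).
    - move=> b d b0 d0; rewrite (red_mono RD) -(psvec_homD S vD) //; congr (_ *m _).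
      by apply: kvec_inj => -[c|]; rewrite !kvec_mono (redM RD) ?O1' ?O2 // r1 // r2.
    - rewrite (red_mono RD) -(psvec_homW S vU vD); congr (_ *m _).
      apply: kvec_inj => -[c|]; rewrite !kvec_mono ?(red1 RD) //; congr (_ *: _).
      case: (eqVneq c 0) => c0; first by rewrite (redM RD) ?O1' ?O2 // r1 // r2.
      by rewrite (redM RD) ?O1' ?O2 ?r1 ?r2 // oppr_eq0 ?invr_eq0.
  have [ir | nir] := classic (mx_irreducible (subg_repr sg sS)).
    have [chiK1 l1] := char_lift_exists mc1; have [chiK2 l2] := char_lift_exists mc2.
    by exists chiK1, chiK2; split.
  have [ne e2] := rc nir; have [chiK1 [chiK2 [l1 l2 sq]]] := char_lift_pair mc1 mc2 ne e2.
  by exists chiK1, chiK2; split.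
have rsh (c : option k -> F) : \sum_x c x *: vec x = 0 -> _ :=
  @relation_shape _ _ _ sg _ ac q0 _ _ v mc1 mc2 vU vD c (fun a a0 => introN eqP (fun e => nz (ex_intro2 _ _ a a0 e))).
have [w /sub_kermxP wP w0] : exists2 w : 'rV_#|{: option k}|, (w <= kermx (rows_mx vec))%MS & w != 0.
  by apply/rowV0Pn; rewrite kermx_eq0.
rewrite mul_rows_mx in wP; have [wc we] := rsh (fun x => w 0 (enum_rank x)) wP.
set y := w 0 _ in wc we.
have y0 : y != 0.
  apply: contra_neq w0 => y0; apply/rowP => i; rewrite mxE -[i]enum_valK.
  by case: (enum_val i) => [b|] //; rewrite wc.
have {we}ec x : x != 0 -> chi1 x = chi2 x by exact: we.
have vE : v = - \sum_b vec (Some b).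
  apply/eqP; rewrite -addr_eq0; apply/eqP/(scalerI y0); rewrite scaler0 -[RHS]wP sum_option.
  by rewrite scalerDr scaler_sumr; congr (_ + _); apply: eq_bigr => b _; rewrite wc.
have eps1 : chi1 (-1) * chi2 (-1) = 1 by rewrite -ec // -(mcharM mc1) // mulrNN mulr1 (mchar1 mc1).
(* By [rsh] a relation with coefficient 0 at [None] is trivial, so these vectors are independent. *)
pose P' := rows_mx (fun b => vec (Some b)).
have fP' : row_free P'.
  rewrite -kermx_eq0; apply/rowV0P => u /sub_kermxP; rewrite mul_rows_mx => uP.
  have [|uc _] := rsh (oapp (fun b => u 0 (enum_rank b)) 0).
    by rewrite sum_option scale0r add0r.
  by apply/rowP => i; rewrite mxE -[i]enum_valK; exact: uc.
have [chiK [mcK OK rK]] := char_lift_exists mc1.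
exists _, (sys_repr (steinberg_system mcK)); split; last by move/(_ (eqchar ec)).
apply: (sys_lifts RD (steinberg_system mcK) irr fP').
- by apply/card_gt0P; exists 0.
- by move=> b; apply: (Omx_mono RD) => x; exact: (O1 RD).
- by move=> b d b0 d0; apply: (Omx_mono RD) => c; rewrite (OM RD) ?OK.
- apply: Omx_kmx => c c'; case: ifP => _; first by rewrite (ON RD) ?(O1 RD).
  by case: ifP => _; [exact: (O1 RD) | exact: (O0 RD)].
- move=> b; rewrite (red_mono RD); apply: kvec_inj => c.
  by rewrite !mulmxA kvec_mono (red1 RD) scale1r !kvec_rows (psvecU S vU (Some c)).
- move=> b d b0 d0; rewrite (red_mono RD); apply: kvec_inj => c.
  rewrite !mulmxA kvec_mono (redM RD) ?OK // !rK // -scalemxAl !kvec_rows.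
  by rewrite (psvecD S vD (Some c)) // -[chi2 b]ec // mulrC.
have -> : map_mx red (@stW k K) = @stW k F.
  rewrite red_kmx; apply/matrixP => i j; rewrite !mxE.
  by do 2?case: ifP => _; rewrite ?(redN RD) ?(O1 RD) ?(red1 RD) ?(red0 RD).
apply: kvec_inj => c; rewrite !mulmxA kvec_stW kvec_rows (psvecW S vU vD (Some c)).
have [_ | c0] := eqVneq c 0.
  rewrite mulNmx mulmx_suml eps1 scale1r /= [RHS]vE; congr (- _).
  by apply: eq_bigr => b _; rewrite kvec_rows.
rewrite kvec_rows -ec ?oppr_eq0 // -(mcharM mc1) ?oppr_eq0 ?invr_eq0 // mulrNN mulVf //.
by rewrite (mchar1 mc1) scale1r.
Qed.

End NoncuspidalLift.

Theorem theorem8p1 (k : finFieldType) (p l : nat)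
    (K F : closedFieldType) (O : {pred K}) (red : K -> F) :
  p \in [pchar k] -> prime l -> l != p ->
  [pchar K] =i pred0 -> l \in [pchar F] ->
  residue_data O red ->
  (forall m (sigma : mx_representation F (GL2 k) m),
     mx_irreducible sigma ->
     exists n (st : mx_representation K (GL2 k) n),
       is_reduction O red st sigma /\
       exists len : nat,
         mx_length (subg_repr st (SL2_sub_GL2 k)) len /\
         mx_length (subg_repr sigma (SL2_sub_GL2 k)) len)
  /\
  (forall m (sigma : mx_representation F (SL2 k) m),
     mx_irreducible sigma ->
     exists n (st : mx_representation K (SL2 k) n),
       is_reduction O red st sigma).
Proof.
move=> pk l_pr lp K0 lF RD.
have q0 := qF_neq0 pk l_pr lp lF.
have [psiK [acK Opsi ac]] := psi_pair pk l_pr lp K0 lF RD.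
have [gam gam0 gamP] := finField_generator k.
have core m (sigma : mx_representation F (GL2 k) m) : mx_irreducible sigma ->
    exists n (st : mx_representation K (GL2 k) n), lifts O red st sigma /\
    (~ mx_irreducible (subg_repr sigma (normal_sub (SL2_normal k))) ->
     ~ mx_irreducible (subg_repr st (normal_sub (SL2_normal k)))).
  move=> irr; have [c | nc] := eqVneq (wproj sigma (fun x => red (psiK x)) 0) 0.
    exact: (cuspidal_lift K0 RD q0 acK Opsi ac irr c).
  exact: (noncuspidal_lift RD q0 gam0 gamP irr ac nc).
by split; [exact: (GL2_part RD core) | exact: (SL2_part RD core)].
Qed.
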